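(* Let $K$ be a knot in $S^3$ with exterior $E_K$ and let $B_2$ be the $2$-fold branched cover of $S^3$ branched along $K$. The map $\Phi$ is a map from $R_0(E_K)$ onto $R^\tau(B_2)$ with the following properties. For $\rho\in R_0(E_K)$: (1) if $\rho$ is abelian, then $\Phi(\rho)$ is the trivial representation of $\pi_1(B_2)$; (2) if $\rho$ is irreducible and metabelian, then $\Phi(\rho)$ is a non-trivial abelian representation in $R^\tau(B_2)$; (3) if $\rho$ is non-metabelian (in particular irreducible), then $\Phi(\rho)$ is an irreducible representation in $R^\tau(B_2)$.
   Context: For a compact manifold $M$, $R(M)=\mathrm{Hom}(\pi_1(M),\mathrm{SL}_2(\mathbb C))$. A representation is abelian if its image is abelian, metabelian if the image of the commutator subgroup of $\pi_1(M)$ is abelian, reducible if its image preserves a line in $\mathbb C^2$, irreducible otherwise. $E_K$ is the complement of an open tubular neighbourhood of $K$; $\mu\in\pi_1(E_K)$ is a meridian. $p:C_2\to E_K$ is the $2$-fold cyclic cover, $p_*:\pi_1(C_2)\to\pi_1(E_K)$ the (injective) induced map, $\mu_2\in\pi_1(C_2)$ the element with $p_*(\mu_2)=\mu^2$; $\pi_1(B_2)\cong\pi_1(C_2)/\langle\langle\mu_2\rangle\rangle$ (quotient by the normal closure). $\tau$ is the automorphism of $\pi_1(C_2)$ given by $[\ell]\mapsto[\widetilde m\cdot\sigma(\ell)\cdot\widetilde m^{-1}]$, where $\sigma$ is the nontrivial covering transformation and $\widetilde m$ the lift of $\mu$ starting at the base point; thus $p_*(\tau(\gamma))=\mu\,p_*(\gamma)\mu^{-1}$.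 Since $\tau(\mu_2)=\mu_2$ it induces an automorphism $\tau$ of $\pi_1(B_2)$. $R^\tau(B_2)$ is the set of $\tau$-equivariant $\rho\in R(B_2)$, i.e. those for which there is $C\in\mathrm{SL}_2(\mathbb C)$ with $\rho(\tau(\gamma))=C\rho(\gamma)C^{-1}$ for all $\gamma$. $R_0(E_K)=\{\rho\in R(E_K)\mid\mathrm{tr}\,\rho(\mu)=0\}$. For $g\in\pi_1(E_K)$ let $[g]\in H_1(E_K;\mathbb Z)\cong\mathbb Z$ be its class ($[\mu]=1$). For $\rho\in R_0(E_K)$ (so $\rho(\mu)^2=-\mathbf 1$) and $\gamma\in\pi_1(C_2)$ set $\Phi(\rho)(\gamma)=(\sqrt{-1})^{[p_*(\gamma)]}\rho(p_*(\gamma))$ (here $[p_*(\gamma)]\in2\mathbb Z$). Then $\Phi(\rho)(\mu_2)=\mathbf 1$, so $\Phi(\rho)\in R(B_2)$. *)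

(* Defs.v *)
From HB Require Import structures.
From mathcomp Require Import all_boot all_order all_algebra.
From mathcomp Require Import generic_quotient.
From mathcomp Require Import all_classical all_reals all_analysis homotopy.
From mathcomp Require Import complex.
From mathcomp Require Import ring lra.

Set Implicit Arguments.
Unset Strict Implicit.
Unset Printing Implicit Defensive.

Import Order.TTheory GRing.Theory Num.Theory.
Import numFieldNormedType.Exports.

Local Open Scope classical_set_scope.
Local Open Scope ring_scope.
Local Open Scope quotient_scope.

Definition uI (R : realType) : Type := set_type `[0 : R, 1]%classic.

Section UnitInterval.
Variable R : realType.

HB.instance Definition _ := Choice.on (uI R).
HB.instance Definition _ := Topological.on (uI R).

(* clamp : R -> [0, 1] is the nearest-point retraction; paths are evaluated
   at clamp r when the parameter is given by a real expression *)
Definition clamp_val (r : R) : R := Num.max 0 (Num.min 1 r).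

Lemma clamp_subproof (r : R) : clamp_val r \in `[0 : R, 1]%classic.
Proof.
by rewrite inE /= in_itv /= /clamp_val le_max lexx /= ge_max ler01 ge_min lexx.
Qed.

Definition clamp (r : R) : uI R :=
  @exist R (fun x => x \in `[0 : R, 1]%classic) (clamp_val r) (clamp_subproof r).

Definition ival (t : uI R) : R := \val t.

Lemma ival_itv (t : uI R) : 0 <= ival t <= 1.
Proof. by have := valP t; rewrite inE /= in_itv. Qed.

Lemma clampK (r : R) : 0 <= r <= 1 -> ival (clamp r) = r.
Proof.
move=> /andP[r0 r1]; rewrite /ival /= /clamp_val.
by rewrite (min_idPr r1) (max_idPr r0).
Qed.

Lemma ivalK (t : uI R) : clamp (ival t) = t.
Proof. by apply: val_inj; exact: (clampK (ival_itv t)). Qed.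

Lemma uI_zero_one : clamp 0 != clamp 1.
Proof.
apply/eqP => /(congr1 ival); rewrite !clampK ?lexx ?ler01 // => /eqP.
by rewrite eq_sym oner_eq0.
Qed.

HB.instance Definition _ := isBiPointed.Build (uI R) uI_zero_one.

Lemma ival_continuous : continuous ival.
Proof. exact: initial_continuous. Qed.

Lemma clamp_continuous : continuous clamp.
Proof.
apply: (@continuous_comp_initial (set_type `[0 : R, 1]%classic) R R set_val).
move=> r.
apply: (continuous_max (f := fun=> 0 : R^o) (g := fun r : R => Num.min 1 r : R^o)).
  exact: cvg_cst.
apply: (continuous_min (f := fun=> 1 : R^o) (g := fun r : R => r : R^o)).
  exact: cvg_cst.
exact: cvg_id.
Qed.

Lemma ival0 : ival zero = 0. Proof. by rewrite clampK // lexx ler01. Qed.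
Lemma ival1 : ival one = 1. Proof. by rewrite clampK // lexx ler01. Qed.

Lemma irev_continuous : continuous (fun t : uI R => clamp (1 - ival t)).
Proof.
move=> t; apply: (@continuous_comp _ _ _ (fun t : uI R => 1 - ival t) clamp);
  last exact: clamp_continuous.
apply: (@cvgB R R _ (nbhs t) _ (fun=> 1) ival).
  exact: cvg_cst.
exact: ival_continuous.
Qed.

Lemma clamp_le0 (r : R) : r <= 0 -> clamp r = zero.
Proof.
move=> r0; apply: val_inj; rewrite /= /clamp_val.
have r1 : r <= 1 by apply: le_trans r0 ler01.
by rewrite (min_idPr r1) (min_idPr ler01) (max_idPl r0) (max_idPl (lexx 0)).
Qed.

Lemma clamp_ge1 (r : R) : 1 <= r -> clamp r = one.
Proof.
move=> r1; apply: val_inj; rewrite /= /clamp_val.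
by rewrite (min_idPl r1) (min_idPl (lexx 1)).
Qed.

End UnitInterval.

Lemma piecewise_continuous (R : realType) (X T : topologicalType) (h : X -> R)
    (c : R) (F G : X -> T) :
  continuous h -> continuous F -> continuous G ->
  (forall x, h x = c -> F x = G x) ->
  continuous (fun x => if h x <= c then F x else G x).
Proof.
move=> ch cF cG FG x U; rewrite /= => Ux.
have [hx|hx|hx] := ltgtP (h x) c; move: Ux.
- rewrite (ltW hx) => FU.
  have A : nbhs x (h @^-1` [set r | r < c]) by apply: (ch x); exact: lt_nbhsl.
  have B : nbhs x (F @^-1` U) by exact: (cF x).
  by apply: filterS (filterI A B) => y [/= /ltW -> ].
- rewrite leNgt hx /= => GU.
  have A : nbhs x (h @^-1` [set r | c < r]) by apply: (ch x); exact: lt_nbhsr.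
  have B : nbhs x (G @^-1` U) by exact: (cG x).
  by apply: filterS (filterI A B) => y [/= hy Uy]; rewrite leNgt hy.
- rewrite hx lexx => FU.
  have A : nbhs x (F @^-1` U) by exact: (cF x).
  have B : nbhs x (G @^-1` U) by apply: (cG x); rewrite -FG.
  by apply: filterS (filterI A B) => y [/= Fy Gy]; case: ifP.
Qed.

Lemma compose_continuous (X Y Z : topologicalType) (f : X -> Y) (g : Y -> Z) :
  continuous f -> continuous g -> continuous (fun x => g (f x)).
Proof. by move=> cf cg x; exact: (@continuous_comp _ _ _ f g x (cf x) (cg (f x))). Qed.

Lemma pair_continuous (X Y Z : topologicalType) (f : X -> Y) (g : X -> Z) :
  continuous f -> continuous g -> continuous (fun x => (f x, g x)).
Proof. by move=> cf cg x; apply: cvg_pair; [exact: cf|exact: cg]. Qed.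

Lemma fst_continuous (X Y : topologicalType) :
  continuous (fun p : X * Y => p.1).
Proof. by move=> p; exact: cvg_fst. Qed.

Lemma snd_continuous (X Y : topologicalType) :
  continuous (fun p : X * Y => p.2).
Proof. by move=> p; exact: cvg_snd. Qed.

Section Dilate.
Variable R : realType.

Let dbl_continuous : continuous (fun t : uI R => 2 * ival t).
Proof.
move=> t; apply: (@cvgM R _ (nbhs t) _ (fun=> 2) (@ival R)).
  exact: cvg_cst.
exact: ival_continuous.
Qed.

Lemma ifst_continuous : continuous (fun t : uI R => clamp (2 * ival t)).
Proof. exact: (compose_continuous dbl_continuous (@clamp_continuous R)). Qed.

Lemma isnd_continuous : continuous (fun t : uI R => clamp (2 * ival t - 1)).
Proof.
apply: (compose_continuous (f := fun t : uI R => 2 * ival t - 1));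
  last exact: clamp_continuous.
move=> t; apply: (@cvgB R R _ (nbhs t) _ (fun t : uI R => 2 * ival t) (fun=> 1)).
  exact: dbl_continuous.
exact: cvg_cst.
Qed.

End Dilate.

Section Paths.
Variables (R : realType) (T : topologicalType).
Local Notation I := (uI R).

Definition pcat_fun (f g : I -> T) (t : I) : T :=
  if ival t <= 2^-1 then f (clamp (2 * ival t)) else g (clamp (2 * ival t - 1)).

Lemma pcat_fun_continuous (f g : I -> T) :
  continuous f -> continuous g -> f one = g zero -> continuous (pcat_fun f g).
Proof.
move=> cf cg fg.
apply: piecewise_continuous.
- exact: ival_continuous.
- exact: (compose_continuous (@ifst_continuous R) cf).
- exact: (compose_continuous (@isnd_continuous R) cg).
- move=> t ->; rewrite divff ?pnatr_eq0// subrr clamp_ge1// clamp_le0//.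
Qed.

Lemma pcat_fun_clamp (f g : I -> T) (r : R) :
  pcat_fun f g (clamp r) =
  if r <= 2^-1 then f (clamp (2 * r)) else g (clamp (2 * r - 1)).
Proof.
rewrite /pcat_fun.
have [r0|r0] := leP r 0.
  have h : r <= 2^-1 by lra.
  by rewrite clamp_le0// ival0 h invr_ge0 ler0n !clamp_le0//; lra.
have [r1|r1] := leP r 1; first by rewrite clampK// (ltW r0) r1.
have h : (r <= 2^-1) = false by apply/negbTE; rewrite -ltNge; lra.
have h' : ((1 : R) <= 2^-1) = false by apply/negbTE; rewrite -ltNge; lra.
by rewrite clamp_ge1 ?ival1 ?h ?h' ?clamp_ge1//; lra.
Qed.

Definition prev_fun (f : I -> T) (t : I) : T := f (clamp (1 - ival t)).

Lemma prev_fun_continuous (f : I -> T) : continuous f -> continuous (prev_fun f).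
Proof.
move=> cf; exact: (compose_continuous (@irev_continuous R) cf).
Qed.

Section Cat.
Variables (x y z : T).
Variables (f : {path I from x to y}) (g : {path I from y to z}).

Lemma pcat_continuous : continuous (pcat_fun f g).
Proof.
apply: pcat_fun_continuous; [exact: cts_fun|exact: cts_fun|].
by rewrite path_one path_zero.
Qed.

Lemma pcat_zero : pcat_fun f g zero = x.
Proof. by rewrite pcat_fun_clamp mulr0 invr_ge0 ler0n path_zero. Qed.

Lemma pcat_one : pcat_fun f g one = z.
Proof.
have h' : ((1 : R) <= 2^-1) = false by apply/negbTE; rewrite -ltNge; lra.
by rewrite pcat_fun_clamp h' mulr1 clamp_ge1 ?path_one//; lra.
Qed.

Definition pcat : {path I from x to z} := mk_path pcat_continuous pcat_zero pcat_one.

Lemma prev_zero : prev_fun f zero = y.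
Proof. by rewrite /prev_fun ival0 subr0 path_one. Qed.

Lemma prev_one : prev_fun f one = x.
Proof. by rewrite /prev_fun ival1 subrr path_zero. Qed.

Definition prev : {path I from y to x} :=
  mk_path (prev_fun_continuous (@cts_fun _ _ f)) prev_zero prev_one.

End Cat.

Definition pconst (x : T) : {path I from x to x} := cst x.

(* H (s, t) : s is the parameter of the homotopy, t that of the paths *)
Definition homotopic (x y : T) (f g : {path I from x to y}) : Prop :=
  exists H : I * I -> T, [/\ continuous H,
    forall t, H (zero, t) = f t, forall t, H (one, t) = g t &
    forall s, H (s, zero) = x /\ H (s, one) = y].

Lemma homotopic_refl x y (f : {path I from x to y}) : homotopic f f.
Proof.
exists (fun p => f p.2); split => // [|s]; last by rewrite /= path_zero path_one.
exact: (compose_continuous (@snd_continuous I I) (@cts_fun _ _ f)).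
Qed.

Lemma homotopic_sym x y (f g : {path I from x to y}) :
  homotopic f g -> homotopic g f.
Proof.
move=> [H [cH H0 H1 He]].
exists (fun p => H (clamp (1 - ival p.1), p.2)); split => /=.
- apply: (compose_continuous (g := H)) cH.
  apply: pair_continuous; last exact: snd_continuous.
  exact: (compose_continuous (@fst_continuous I I) (@irev_continuous R)).
- by move=> t; rewrite ival0 subr0.
- by move=> t; rewrite ival1 subrr.
- by move=> s; exact: He.
Qed.

Let half1 : ((1 : R) <= 2^-1) = false.
Proof. by apply/negbTE; rewrite -ltNge; lra. Qed.

Lemma homotopic_trans x y (f g h : {path I from x to y}) :
  homotopic f g -> homotopic g h -> homotopic f h.
Proof.
move=> [H [cH H0 H1 He]] [K [cK K0 K1 Ke]].
exists (fun p => if ival p.1 <= 2^-1 then H (clamp (2 * ival p.1), p.2)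
                 else K (clamp (2 * ival p.1 - 1), p.2)); split => /=.
- apply: piecewise_continuous.
  + exact: (compose_continuous (@fst_continuous I I) (@ival_continuous R)).
  + apply: (compose_continuous (g := H)) cH.
    apply: pair_continuous; last exact: snd_continuous.
    exact: (compose_continuous (@fst_continuous I I) (@ifst_continuous R)).
  + apply: (compose_continuous (g := K)) cK.
    apply: pair_continuous; last exact: snd_continuous.
    exact: (compose_continuous (@fst_continuous I I) (@isnd_continuous R)).
  + move=> [s t] /= ->; rewrite divff ?pnatr_eq0// subrr.
    by rewrite clamp_ge1// clamp_le0// H1 K0.
- by move=> t; rewrite ival0 invr_ge0 ler0n mulr0 clamp_le0.
- by move=> t; rewrite ival1 half1 mulr1 clamp_ge1 ?K1//; lra.
- by move=> s; case: ifP => _; [exact: He|exact: Ke].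
Qed.

Lemma homotopic_cat x y z (f f' : {path I from x to y})
    (g g' : {path I from y to z}) :
  homotopic f f' -> homotopic g g' -> homotopic (pcat f g) (pcat f' g').
Proof.
move=> [H [cH H0 H1 He]] [K [cK K0 K1 Ke]].
exists (fun p => if ival p.2 <= 2^-1 then H (p.1, clamp (2 * ival p.2))
                 else K (p.1, clamp (2 * ival p.2 - 1))); split => /=.
- apply: piecewise_continuous.
  + exact: (compose_continuous (@snd_continuous I I) (@ival_continuous R)).
  + apply: (compose_continuous (g := H)) cH.
    apply: pair_continuous; first exact: fst_continuous.
    exact: (compose_continuous (@snd_continuous I I) (@ifst_continuous R)).
  + apply: (compose_continuous (g := K)) cK.
    apply: pair_continuous; first exact: fst_continuous.
    exact: (compose_continuous (@snd_continuous I I) (@isnd_continuous R)).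
  + move=> [s t] /= ->; rewrite divff ?pnatr_eq0// subrr.
    by rewrite clamp_ge1// clamp_le0// (He s).2 (Ke s).1.
- by move=> t; rewrite /pcat /mk_path /pcat_fun; case: ifP.
- by move=> t; rewrite /pcat /mk_path /pcat_fun; case: ifP.
- move=> s; rewrite ival0 invr_ge0 ler0n mulr0 clamp_le0// (He s).1; split=> //.
  by rewrite ival1 half1 mulr1 clamp_ge1 ?(Ke s).2//; lra.
Qed.

Lemma homotopic_rev x y (f f' : {path I from x to y}) :
  homotopic f f' -> homotopic (prev f) (prev f').
Proof.
move=> [H [cH H0 H1 He]].
exists (fun p => H (p.1, clamp (1 - ival p.2))); split => /=.
- apply: (compose_continuous (g := H)) cH.
  apply: pair_continuous; first exact: fst_continuous.
  exact: (compose_continuous (@snd_continuous I I) (@irev_continuous R)).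
- by move=> t; rewrite H0.
- by move=> t; rewrite H1.
- by move=> s; rewrite ival0 ival1 subr0 subrr (He s).1 (He s).2.
Qed.

Lemma homotopic_reparam x y (f : I -> T) (phi psi : I -> I)
    (p q : {path I from x to y}) :
  continuous f -> continuous phi -> continuous psi ->
  phi zero = psi zero -> phi one = psi one ->
  (forall t, p t = f (phi t)) -> (forall t, q t = f (psi t)) -> homotopic p q.
Proof.
move=> cf cphi cpsi e0 e1 pE qE.
exists (fun st => f (clamp ((1 - ival st.1) * ival (phi st.2) +
                            ival st.1 * ival (psi st.2)))); split => /=.
- apply: (compose_continuous (g := f)) cf.
  apply: (compose_continuous (g := @clamp R)); last exact: clamp_continuous.
  have c1 : continuous (fun st : I * I => ival st.1).
    exact: (compose_continuous (@fst_continuous I I) (@ival_continuous R)).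
  have c2 (h : I -> I) : continuous h -> continuous (fun st : I * I => ival (h st.2)).
    move=> ch; apply: (compose_continuous (g := @ival R)); last exact: ival_continuous.
    exact: (compose_continuous (@snd_continuous I I) ch).
  move=> st; apply: (@cvgD R R _ (nbhs st) _
      (fun st : I * I => (1 - ival st.1) * ival (phi st.2))
      (fun st : I * I => ival st.1 * ival (psi st.2))).
    apply: (@cvgM R _ (nbhs st) _ (fun st : I * I => 1 - ival st.1)
      (fun st : I * I => ival (phi st.2))); last exact: c2.
    apply: (@cvgB R R _ (nbhs st) _ (fun=> 1) (fun st : I * I => ival st.1)).
      exact: cvg_cst.
    exact: c1.
  apply: (@cvgM R _ (nbhs st) _ (fun st : I * I => ival st.1)
      (fun st : I * I => ival (psi st.2))); [exact: c1|exact: c2].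
- by move=> t; rewrite ival0 subr0 mul1r mul0r addr0 ivalK pE.
- by move=> t; rewrite ival1 subrr mul1r mul0r add0r ivalK qE.
- move=> s; rewrite e0 e1 -!mulrDl subrK !mul1r !ivalK.
  by rewrite -qE -qE path_zero path_one.
Qed.

Lemma pcatE x y z (f : {path I from x to y}) (g : {path I from y to z}) r :
  pcat f g (clamp r) =
  if r <= 2^-1 then f (clamp (2 * r)) else g (clamp (2 * r - 1)).
Proof. exact: pcat_fun_clamp. Qed.

Lemma pcatA x y z w (f : {path I from x to y}) (g : {path I from y to z})
    (h : {path I from z to w}) :
  homotopic (pcat f (pcat g h)) (pcat (pcat f g) h).
Proof.
pose m (t : I) : R :=
  Num.min (2 * ival t) (Num.min (ival t + 4^-1) ((ival t + 1) / 2)).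
apply: (@homotopic_reparam x w (pcat f (pcat g h)) id (fun t => clamp (m t))).
- exact: cts_fun.
- by move=> t; exact: cvg_id.
- apply: (compose_continuous (g := @clamp R)); last exact: clamp_continuous.
  have ci := @ival_continuous R.
  have c1 : continuous (fun t : I => 2 * ival t).
    move=> t; apply: (@cvgM R _ (nbhs t) _ (fun=> 2) (@ival R)).
      exact: cvg_cst.
    exact: ival_continuous.
  have c2 a : continuous (fun t : I => ival t + a).
    move=> t; apply: (@cvgD R R _ (nbhs t) _ (@ival R) (fun=> a)).
      exact: ival_continuous.
    exact: cvg_cst.
  have c3 : continuous (fun t : I => (ival t + 1) / 2).
    move=> t; apply: (@cvgM R _ (nbhs t) _ (fun t : I => ival t + 1) (fun=> 2^-1)).
      exact: c2.
    exact: cvg_cst.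
  move=> t.
  apply: (continuous_min (f := fun t : I => 2 * ival t : R^o)
    (g := fun t : I => Num.min (ival t + 4^-1) ((ival t + 1) / 2) : R^o)).
    exact: c1.
  apply: (continuous_min (f := fun t : I => ival t + 4^-1 : R^o)
    (g := fun t : I => (ival t + 1) / 2 : R^o)); [exact: c2|exact: c3].
- apply/esym/clamp_le0; rewrite /m ival0 mulr0.
  by rewrite ge_min lexx.
- apply/esym/clamp_ge1; rewrite /m ival1.
  by rewrite !le_min; apply/and3P; split; lra.
- by [].
- move=> t.
  rewrite -{1}(ivalK t) /m; have := ival_itv t; move: (ival t) => r.
  move=> /andP[r0 r1].
  have [r4|r4] := leP r 4^-1.
    have -> : Num.min (2 * r) (Num.min (r + 4^-1) ((r + 1) / 2)) = 2 * r.
      by apply/min_idPl; rewrite le_min; apply/andP; split; lra.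
    have h1 : r <= 2^-1 by lra.
    have h2 : 2 * r <= 2^-1 by lra.
    by rewrite !(pcatE, h1, h2).
  have [r2|r2] := leP r 2^-1.
    have -> : Num.min (2 * r) (Num.min (r + 4^-1) ((r + 1) / 2)) = r + 4^-1.
      rewrite (min_idPl (_ : r + 4^-1 <= (r + 1) / 2)); last by lra.
      by apply/min_idPr; lra.
    have h1 : (2 * r <= 2^-1) = false by apply/negbTE; rewrite -ltNge; lra.
    have h2 : (r + 4^-1 <= 2^-1) = false by apply/negbTE; rewrite -ltNge; lra.
    have h3 : 2 * (r + 4^-1) - 1 <= 2^-1 by lra.
    rewrite !(pcatE, r2, h1, h2, h3).
    by congr (g (clamp _)); field.
  have -> : Num.min (2 * r) (Num.min (r + 4^-1) ((r + 1) / 2)) = (r + 1) / 2.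
    rewrite (min_idPr (_ : (r + 1) / 2 <= r + 4^-1)); last by lra.
    by apply/min_idPr; lra.
  have h1 : (r <= 2^-1) = false by apply/negbTE; rewrite -ltNge; lra.
  have h2 : ((r + 1) / 2 <= 2^-1) = false by apply/negbTE; rewrite -ltNge; lra.
  have h3 : (2 * ((r + 1) / 2) - 1 <= 2^-1) = false.
    by apply/negbTE; rewrite -ltNge; lra.
  rewrite !(pcatE, h1, h2, h3).
  by congr (h (clamp _)); field.
Qed.

Lemma pcat1p x y (f : {path I from x to y}) : homotopic (pcat (pconst x) f) f.
Proof.
apply: (@homotopic_reparam x y f (fun t => clamp (2 * ival t - 1)) id).
- exact: cts_fun.
- exact: isnd_continuous.
- by move=> t; exact: cvg_id.
- by apply: clamp_le0; rewrite ival0; lra.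
- by apply: clamp_ge1; rewrite ival1; lra.
- move=> t; rewrite -{1}(ivalK t) pcatE; case: ifP => // h.
  by rewrite (@clamp_le0 R (2 * ival t - 1)) ?path_zero//; lra.
- by [].
Qed.

Lemma pcatp1 x y (f : {path I from x to y}) : homotopic (pcat f (pconst y)) f.
Proof.
apply: (@homotopic_reparam x y f (fun t => clamp (2 * ival t)) id).
- exact: cts_fun.
- exact: ifst_continuous.
- by move=> t; exact: cvg_id.
- by apply: clamp_le0; rewrite ival0; lra.
- by apply: clamp_ge1; rewrite ival1; lra.
- move=> t; rewrite -{1}(ivalK t) pcatE; case: ifP => // /negbT h.
  by rewrite (@clamp_ge1 R (2 * ival t)) ?path_one//; move: h; rewrite -ltNge => h; lra.
- by [].
Qed.

Lemma pcatpV x y (f : {path I from x to y}) :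
  homotopic (pcat f (prev f)) (pconst x).
Proof.
pose m (t : I) : R := Num.min (2 * ival t) (2 - 2 * ival t).
apply: (@homotopic_reparam x x f (fun t => clamp (m t)) (fun=> zero)).
- exact: cts_fun.
- apply: (compose_continuous (g := @clamp R)); last exact: clamp_continuous.
  have c1 : continuous (fun t : I => 2 * ival t).
    move=> t; apply: (@cvgM R _ (nbhs t) _ (fun=> 2) (@ival R)).
      exact: cvg_cst.
    exact: ival_continuous.
  move=> t.
  apply: (continuous_min (f := fun t : I => 2 * ival t : R^o)
    (g := fun t : I => 2 - 2 * ival t : R^o)); first exact: c1.
  apply: (@cvgB R R _ (nbhs t) _ (fun=> 2) (fun t : I => 2 * ival t)).
    exact: cvg_cst.
  exact: c1.
- exact: cst_continuous.
- by apply: clamp_le0; rewrite /m ival0 mulr0 ge_min lexx.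
- by apply: clamp_le0; rewrite /m ival1 ge_min; apply/orP; right; lra.
- move=> t; rewrite -{1}(ivalK t) /m pcatE; move: (ival t) => r.
  case: ifP => [h|/negbT].
    by rewrite (min_idPl (_ : 2 * r <= 2 - 2 * r))//; lra.
  rewrite -ltNge => h.
  rewrite (min_idPr (_ : 2 - 2 * r <= 2 * r)); last by lra.
  rewrite [LHS]/(prev_fun f (clamp (2 * r - 1))) /prev_fun.
  have [r1|r1] := leP r 1; last first.
    by rewrite (@clamp_ge1 _ (2 * r - 1)) ?ival1 ?clamp_le0//; lra.
  rewrite clampK; last by apply/andP; split; lra.
  by congr (f (clamp _)); ring.
- by move=> t; rewrite path_zero.
Qed.

Lemma prevK x y (f : {path I from x to y}) : homotopic (prev (prev f)) f.
Proof.
apply: (@homotopic_reparam x y f id id) => //.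
- exact: cts_fun.
- by move=> t; exact: cvg_id.
- by move=> t; exact: cvg_id.
- move=> t; rewrite [LHS]/(f (clamp (1 - ival (clamp (1 - ival t))))).
  rewrite clampK ?subKr ?ivalK//.
  by have /andP[t0 t1] := ival_itv t; apply/andP; split; lra.
Qed.

Lemma pcatVp x y (f : {path I from x to y}) :
  homotopic (pcat (prev f) f) (pconst y).
Proof.
apply: homotopic_trans (pcatpV (prev f)).
by apply: homotopic_cat; [exact: homotopic_refl|exact/homotopic_sym/prevK].
Qed.

Definition homotopicb x y (f g : {path I from x to y}) : bool := `[< homotopic f g >].

Lemma homotopicb_refl x y : reflexive (@homotopicb x y).
Proof. by move=> f; apply/asboolP; exact: homotopic_refl. Qed.

Lemma homotopicb_sym x y : symmetric (@homotopicb x y).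
Proof.
by move=> f g; apply/asboolP/asboolP; exact: homotopic_sym.
Qed.

Lemma homotopicb_trans x y : transitive (@homotopicb x y).
Proof.
move=> g f h /asboolP fg /asboolP gh; apply/asboolP.
exact: homotopic_trans fg gh.
Qed.

Canonical homotopic_equiv x y := EquivRel (@homotopicb x y)
  (@homotopicb_refl x y) (@homotopicb_sym x y) (@homotopicb_trans x y).

End Paths.

Arguments pconst R {T} x.

(* the fundamental group, f * g being the class of "f, then g" *)
Definition pi1 (R : realType) (T : topologicalType) (x : T) : Type :=
  {eq_quot (homotopic_equiv R x x)}.

Section FundamentalGroup.
Variables (R : realType) (T : topologicalType) (x : T).
Local Notation loop := {path (uI R) from x to x}.

HB.instance Definition _ := Choice.on (pi1 R x).
HB.instance Definition _ := EqQuotient.on (pi1 R x).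

Definition pi1_class (f : loop) : pi1 R x := \pi f.

Lemma pi1_classP (f g : loop) : pi1_class f = pi1_class g <-> homotopic f g.
Proof. by split => [/eqmodP/asboolP|?]; last exact/eqmodP/asboolP. Qed.

Lemma pi1_classK (a : pi1 R x) : pi1_class (repr a) = a.
Proof. exact: reprK. Qed.

Lemma pi1_repr (f : loop) : homotopic (repr (pi1_class f)) f.
Proof. by apply/pi1_classP; rewrite pi1_classK. Qed.

Definition pi1_mul (a b : pi1 R x) : pi1 R x := pi1_class (pcat (repr a) (repr b)).
Definition pi1_inv (a : pi1 R x) : pi1 R x := pi1_class (prev (repr a)).
Definition pi1_one : pi1 R x := pi1_class (pconst R x).

Lemma pi1_class_cat (f g : loop) :
  pi1_class (pcat f g) = pi1_mul (pi1_class f) (pi1_class g).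
Proof. by apply/pi1_classP/homotopic_sym/homotopic_cat; exact: pi1_repr. Qed.

Lemma pi1_class_rev (f : loop) : pi1_class (prev f) = pi1_inv (pi1_class f).
Proof. by apply/pi1_classP/homotopic_sym/homotopic_rev/pi1_repr. Qed.

Lemma pi1_mulA : associative pi1_mul.
Proof.
move=> a b c; rewrite -(pi1_classK a) -(pi1_classK b) -(pi1_classK c).
by rewrite -!pi1_class_cat; apply/pi1_classP; exact: pcatA.
Qed.

Lemma pi1_mul1 : left_id pi1_one pi1_mul.
Proof.
by move=> a; rewrite -(pi1_classK a) -pi1_class_cat; apply/pi1_classP/pcat1p.
Qed.

Lemma pi1_mulr1 : right_id pi1_one pi1_mul.
Proof.
by move=> a; rewrite -(pi1_classK a) -pi1_class_cat; apply/pi1_classP/pcatp1.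
Qed.

Lemma pi1_mulV : left_inverse pi1_one pi1_inv pi1_mul.
Proof.
move=> a; rewrite -(pi1_classK a) -pi1_class_rev -pi1_class_cat.
exact/pi1_classP/pcatVp.
Qed.

Lemma pi1_mulrV : right_inverse pi1_one pi1_inv pi1_mul.
Proof.
move=> a; rewrite -(pi1_classK a) -pi1_class_rev -pi1_class_cat.
exact/pi1_classP/pcatpV.
Qed.

HB.instance Definition _ :=
  isGroup.Build (pi1 R x) pi1_mulA pi1_mul1 pi1_mulr1 pi1_mulV pi1_mulrV.

End FundamentalGroup.

Section InducedMap.
Variables (R : realType) (T U : topologicalType) (f : continuousType T U) (x : T).

Definition path_map (y : T) (l : {path (uI R) from x to y}) :
  {path (uI R) from f x to f y} := f \o l.

Definition pi1_map (a : pi1 R x) : pi1 R (f x) := pi1_class (path_map (repr a)).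

End InducedMap.

Definition path_connected (R : realType) (T : topologicalType) : Prop :=
  forall x y : T, inhabited {path (uI R) from x to y}.

Section Groups.
Local Open Scope group_scope.
Variable G : groupType.

Definition is_subgroup (H : set G) : Prop :=
  H 1 /\ forall x y, H x -> H y -> H (x / y).

Definition is_normal_subgroup (H : set G) : Prop :=
  is_subgroup H /\ forall x y, H x -> H (x ^ y).

Definition commutator_subgroup : set G :=
  smallest is_subgroup [set [~ x, y] | x in setT & y in setT].

Definition normal_closure (A : set G) : set G := smallest is_normal_subgroup A.

Lemma normal_closure_normal (A : set G) : is_normal_subgroup (normal_closure A).
Proof.
split; first split.
- by move=> H [[[H1 _] _] _].
- by move=> x y Ax Ay H HH; case: (HH) => [[[_ HD] _] _]; apply: HD; [exact: Ax|exact: Ay].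
- by move=> x y Ax H HH; case: (HH) => [[_ HJ] _]; apply: HJ; exact: Ax.
Qed.

Definition relb (A : set G) (x y : G) : bool := `[< normal_closure A (x / y) >].

Lemma ncl1 A : normal_closure A 1.
Proof. exact: (normal_closure_normal A).1.1. Qed.

Lemma nclF A x y : normal_closure A x -> normal_closure A y -> normal_closure A (x / y).
Proof. exact: (normal_closure_normal A).1.2. Qed.

Lemma nclV A x : normal_closure A x -> normal_closure A x^-1.
Proof. by move=> /(nclF (@ncl1 A)); rewrite mul1g. Qed.

Lemma nclM A x y : normal_closure A x -> normal_closure A y -> normal_closure A (x * y).
Proof. by move=> Ax /nclV /(nclF Ax); rewrite invgK. Qed.

Lemma nclJ A x y : normal_closure A x -> normal_closure A (x ^ y).
Proof. exact: (normal_closure_normal A).2. Qed.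

Lemma relb_refl A : reflexive (relb A).
Proof. by move=> x; apply/asboolP; rewrite mulgV; exact: ncl1. Qed.

Lemma relb_sym A : symmetric (relb A).
Proof.
by move=> x y; apply/asboolP/asboolP => /nclV; rewrite invgM invgK.
Qed.

Lemma relb_trans A : transitive (relb A).
Proof.
move=> y x z /asboolP xy /asboolP yz; apply/asboolP.
by have := nclM xy yz; rewrite mulgA mulgVK.
Qed.

Canonical rel_equiv A := EquivRel (relb A) (@relb_refl A) (@relb_sym A) (@relb_trans A).

End Groups.

Definition gquot (G : groupType) (A : set G) : Type := {eq_quot (rel_equiv A)}.

Section QuotientGroup.
Local Open Scope group_scope.
Variables (G : groupType) (A : set G).

HB.instance Definition _ := Choice.on (gquot A).
HB.instance Definition _ := EqQuotient.on (gquot A).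

Definition gproj (x : G) : gquot A := \pi x.

Lemma gprojP x y : gproj x = gproj y <-> normal_closure A (x / y).
Proof. by split => [/eqmodP/asboolP|?]; last exact/eqmodP/asboolP. Qed.

Lemma gprojK (a : gquot A) : gproj (repr a) = a.
Proof. exact: reprK. Qed.

Definition gquot_mul (a b : gquot A) : gquot A := gproj (repr a * repr b).
Definition gquot_inv (a : gquot A) : gquot A := gproj (repr a)^-1.
Definition gquot_one : gquot A := gproj 1.

Lemma gprojM x y : gproj (x * y) = gquot_mul (gproj x) (gproj y).
Proof.
apply/gprojP.
have hx : normal_closure A (x / repr (gproj x)) by apply/gprojP; rewrite gprojK.
have hy : normal_closure A (y / repr (gproj y)) by apply/gprojP; rewrite gprojK.
have := nclM (nclJ x^-1 hy) hx.
by rewrite /conjg invgK !mulgA mulgVK invgM mulgA.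
Qed.

Lemma gprojV x : gproj x^-1 = gquot_inv (gproj x).
Proof.
apply/gprojP.
have hx : normal_closure A (repr (gproj x) / x) by apply/gprojP; rewrite gprojK.
have := nclJ x hx.
by rewrite /conjg -!mulgA mulVg mulg1 invgK.
Qed.

Lemma gquot_mulA : associative gquot_mul.
Proof.
move=> a b c; rewrite -(gprojK a) -(gprojK b) -(gprojK c).
by rewrite -!gprojM mulgA.
Qed.

Lemma gquot_mul1 : left_id gquot_one gquot_mul.
Proof. by move=> a; rewrite -(gprojK a) -gprojM mul1g. Qed.

Lemma gquot_mulr1 : right_id gquot_one gquot_mul.
Proof. by move=> a; rewrite -(gprojK a) -gprojM mulg1. Qed.

Lemma gquot_mulV : left_inverse gquot_one gquot_inv gquot_mul.
Proof. by move=> a; rewrite -(gprojK a) -gprojV -gprojM mulVg. Qed.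

Lemma gquot_mulrV : right_inverse gquot_one gquot_inv gquot_mul.
Proof. by move=> a; rewrite -(gprojK a) -gprojV -gprojM mulgV. Qed.

HB.instance Definition _ := isGroup.Build (gquot A)
  gquot_mulA gquot_mul1 gquot_mulr1 gquot_mulV gquot_mulrV.

End QuotientGroup.

Section Representations.
Variables (R : realType) (G : groupType).
Local Notation C := R[i].
Implicit Type rho : G -> 'M[C]_2.

Definition reps : set (G -> 'M[C]_2) :=
  [set rho | (forall g, \det (rho g) = 1) /\
             (forall g h, rho (g * h)%g = rho g *m rho h)].

Definition trivial_rep : G -> 'M[C]_2 := fun=> 1%:M.

Definition abelian_rep rho : Prop := forall g h, rho g *m rho h = rho h *m rho g.

Definition metabelian_rep rho : Prop :=
  forall g h, commutator_subgroup g -> commutator_subgroup h ->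
    rho g *m rho h = rho h *m rho g.

Definition reducible_rep rho : Prop :=
  exists2 v : 'cV[C]_2, v != 0 & forall g, exists c : C, rho g *m v = c *: v.

Definition irreducible_rep rho : Prop := ~ reducible_rep rho.

Definition tracefree_reps (mu : G) : set (G -> 'M[C]_2) :=
  [set rho | reps rho /\ \tr (rho mu) = 0].

Definition equivariant_reps (tau : G -> G) : set (G -> 'M[C]_2) :=
  [set rho | reps rho /\
    exists2 A : 'M[C]_2, \det A = 1 &
      forall g, rho (tau g) = A *m rho g *m invmx A].

End Representations.

Arguments trivial_rep {R} G.

Definition evenly_covered (F : Type) (X Y : topologicalType) (p : X -> Y)
    (U : set Y) : Prop :=
  exists V : F -> set X,
    [/\ forall i, open (V i), trivIset setT V, p @^-1` U = \bigcup_i V i &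
        forall i, set_bij (V i) U p /\
          (forall W, open W -> W `<=` V i -> open (p @` W))].

(* F is the (discrete) fibre; p is then F-sheeted *)
Definition covering_map (F : Type) (X Y : topologicalType) (p : X -> Y) : Prop :=
  continuous p /\
  forall y, exists U : set Y, [/\ open U, U y & evenly_covered F p U].

Definition covering_transformation (X Y : topologicalType) (p : X -> Y)
    (s : X -> X) : Prop :=
  [/\ continuous s, (exists s', [/\ continuous s', cancel s s' & cancel s' s]) &
      p \o s = p].

Definition sphere (R : realType) (n : nat) : set 'rV[R]_n.+1 :=
  [set x | \sum_i x ord0 i ^+ 2 = 1].
Arguments sphere : clear implicits.

Section Knots.
Variable R : realType.
Local Notation I := (uI R).
Local Notation S1 := (sphere R 1).
Local Notation S3 := (sphere R 3).

(* nu is a parametrisation of an open tubular neighbourhood of K, extending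
   beyond the closed unit disc bundle, with core S^1 x {0} parametrising K.
   Having such a nu is what makes the topological knot K tame; either
   orientation of nu is allowed. *)
Definition tubular_parametrization (K : set S3)
    (nu : (S1 * 'rV[R]_2)%type -> S3) : Prop :=
  [/\ continuous nu, injective nu, (forall A, open A -> open (nu @` A)) &
      K = [set nu (theta, 0) | theta in [set: S1]]].

Definition open_disc : set 'rV[R]_2 := [set z | \sum_i z ord0 i ^+ 2 < 1].

Definition knot_exterior (nu : (S1 * 'rV[R]_2)%type -> S3) : set S3 :=
  ~` (nu @` [set q | open_disc q.2]).

Definition circle_path (t : R) : 'rV[R]_2 :=
  \row_j (if j == ord0 then cos (2 * pi * t) else sin (2 * pi * t)).

(* m is a meridian loop based at x: up to homotopy it follows an arc d to the
   boundary torus, runs once around the boundary of a fibre disc of the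
   tubular neighbourhood, and returns along d. *)
Definition meridian_loop (nu : (S1 * 'rV[R]_2)%type -> S3)
    (x : knot_exterior nu) (m : {path I from x to x}) : Prop :=
  exists (theta : S1) (y : knot_exterior nu)
         (d : {path I from x to y}) (c : {path I from y to y}),
    (forall t, \val (c t) = nu (theta, circle_path (ival t))) /\
    homotopic m (pcat (pcat d c) (prev d)).

End Knots.

(* cls : G -> Z induces an isomorphism from the abelianization of G (i.e., from
   H_1 when G is a fundamental group) onto Z that maps the class of mu to 1. *)
Definition homology_class (G : groupType) (mu : G) (cls : G -> int) : Prop :=
  [/\ forall g h, cls (g * h)%g = cls g + cls h, cls mu = 1 &
      forall g, cls g = 0 <-> commutator_subgroup g].

Section TwofoldCover.
Variables (R : realType) (E C2 : topologicalType).
Variables (p : continuousType C2 E) (sigma : continuousType C2 C2) (c0 : C2).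

(* [l] |-> [mt . sigma(l) . mt^-1], for a path mt from c0 to sigma c0 *)
Definition cover_tau (mt : {path (uI R) from c0 to sigma c0}) (a : pi1 R c0) :
    pi1 R c0 :=
  pi1_class (pcat (pcat mt (path_map sigma (repr a))) (prev mt)).

(* pi_1(B_2), as the quotient of pi_1(C_2) by the normal closure of mu2 *)
Definition pi1_branched (mu2 : pi1 R c0) : Type := gquot [set mu2].

HB.instance Definition _ mu2 := Group.on (pi1_branched mu2).

Definition to_branched (mu2 a : pi1 R c0) : pi1_branched mu2 := gproj [set mu2] a.

Definition branched_tau mt (mu2 : pi1 R c0) (b : pi1_branched mu2) :
  pi1_branched mu2 := to_branched mu2 (cover_tau mt (repr b)).

Definition Phi_cover (cls : pi1 R (p c0) -> int)
    (rho : pi1 R (p c0) -> 'M[R[i]]_2) (a : pi1 R c0) : 'M[R[i]]_2 :=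
  'i ^ cls (pi1_map p a) *: rho (pi1_map p a).

(* the map induced by Phi_cover on pi_1(B_2), evaluated on representatives *)
Definition Phi (cls : pi1 R (p c0) -> int) (mu2 : pi1 R c0)
    (rho : pi1 R (p c0) -> 'M[R[i]]_2) (b : pi1_branched mu2) :
  'M[R[i]]_2 := Phi_cover cls rho (repr b).

End TwofoldCover.

(* Main.v *)
Require Import Defs.
From HB Require Import structures.
From mathcomp Require Import all_boot all_order all_algebra.
From mathcomp Require Import generic_quotient.
From mathcomp Require Import all_classical all_reals all_analysis homotopy.
From mathcomp Require Import complex.
From mathcomp Require Import ring lra.

Set Implicit Arguments.
Unset Strict Implicit.
Unset Printing Implicit Defensive.

Import Order.TTheory GRing.Theory Num.Theory.
Import numFieldNormedType.Exports.

Local Open Scope classical_set_scope.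
Local Open Scope ring_scope.

(** The correspondence rests on the index-two subgroup [p_* pi_1(C_2)] of the
knot group [pi = pi_1(E_K)], which contains [mu^2] but not [mu].  It consists of
the classes of even degree in [H_1 = Z], so it contains the commutator subgroup
[pi'].

Because [rho(mu)^2 = -1], the twist by powers of [i] makes [Phi(rho)] a
representation of [pi_1(C_2)] that kills [mu_2]; conjugation by [rho(mu)] is its
[tau]-equivariance.  Dividing an element of [pi_1(C_2)] by a power of [mu_2] to
bring it into degree zero shows that [Phi(rho)] has the same image as the
restriction of [rho] to [pi'] ([Phi_cover_in_commutator]), and [pi] is generated
by [mu] and [pi'].  The three properties are then elementary statements about
2x2 matrices of determinant one: an abelian [rho] kills [pi']; if [rho] kills
[pi'], an eigenvector of [rho(mu)] spans an invariant line; and if [rho(pi')]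
preserves the line [L], either [rho(mu)L = L], so that [rho] is reducible and
the commutators act unipotently on the same flag, or [L] and [rho(mu)L] are two
common eigenlines.  In both cases [rho(pi')] is commutative.

For surjectivity, let [r] be equivariant through [B] in [SL_2(C)].  As [tau^2] is
trivial on [pi_1(B_2)], the matrix [B^2 = tr(B) B - 1] commutes with the image of
[r].  If [tr B = 0], then [B^2 = -1] and the untwisted [r] extends to [pi] by
[mu |-> B] ([index2_extM], [Phi_lift]).  Otherwise [B] itself commutes with the
image, [r] is [tau]-invariant and extends to [pi] by [mu |-> 1].  Meridians
normally generate a knot group, so this extension, hence [r], is trivial, and any
trace-free matrix of determinant one can play the part of [B] ([Phi_surjective]).

The last step is where the geometry of the sphere enters.  That the knot group
is normally generated by the meridian ([meridian_normally_generates]) is a van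
Kampen argument for [S^3 = E_K cup N], with [N] the open tube, together with the
simple connectedness of [S^3].  It is carried by the notion of a [holonomy]: a
functional on paths with values in a group which is multiplicative under
concatenation and invariant under homotopy with fixed end points.  A holonomy
on [E_K] that is trivial on the meridian is matched with one on [N], and two
matching holonomies have a horizontal section over any square in [S^3]
([van_kampen_holonomy]); over a null-homotopy of a loop this says that the loop
has trivial holonomy.  Horizontal sections over squares, and lifts of squares to
a covering, are both found by gluing local solutions along edges, through an
induction principle for rectangles ([rectangle_induction]) that replaces
Lebesgue numbers and subdivisions. *)

(** * Induction on intervals and rectangles *)
Section Induction.
Variable R : realType.

(** Cousin's principle; it plays the role of the compactness of intervals throughout. *)
Lemma interval_induction (P : R -> R -> Prop) :
  (forall a m b, a <= m -> m <= b -> P a m -> P m b -> P a b) ->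
  (forall x, exists2 e, 0 < e &
     forall a b, x - e < a -> a <= b -> b < x + e -> P a b) ->
  forall a b, a <= b -> P a b.
Proof.
move=> Padd Ploc a b ab.
pose S := [set t | [/\ a <= t, t <= b & P a t]].
have Sa : S a.
  split=> //; have [e e0 Pe] := Ploc a.
  by apply: Pe; rewrite ?lexx //; lra.
have Sub : ubound S b by move=> t [].
have Ssup : has_sup S by split; [exists a|exists b].
have sb : sup S <= b by apply: ge_sup => //; exists a.
have as_ : a <= sup S by apply: sup_upper_bound.
have [e e0 Pe] := Ploc (sup S).
have [t [at_ tb Pt] st] := sup_adherent e0 Ssup.
have ts : t <= sup S by apply: sup_upper_bound.
have [sb'|sb'] := ltP (sup S + e / 2) b.
  have : S (sup S + e / 2).
    split; [lra|lra|apply: (Padd _ t) => //; first lra].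
    by apply: Pe; lra.
  by move=> /(sup_upper_bound Ssup); lra.
by apply: (Padd _ t) => //; apply: Pe; lra.
Qed.

Lemma rectangle_induction (P : R -> R -> R -> R -> Prop) :
  (forall a m b c d, a <= m -> m <= b -> c <= d ->
     P a m c d -> P m b c d -> P a b c d) ->
  (forall a b c m d, a <= b -> c <= m -> m <= d ->
     P a b c m -> P a b m d -> P a b c d) ->
  (forall x y, exists2 e, 0 < e & forall a b c d,
     x - e < a -> a <= b -> b < x + e ->
     y - e < c -> c <= d -> d < y + e -> P a b c d) ->
  forall a b c d, a <= b -> c <= d -> P a b c d.
Proof.
move=> Ph Pv Ploc a b c d ab cd.
apply: (interval_induction (P := fun a b => P a b c d)) ab => [a' m b' am mb|x].
  exact: Ph.
(* The bound on the width of the strip around [x] has to be uniform in the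
   ordinate; it is obtained by a second induction, along the strip. *)
apply: (interval_induction (P := fun c d => exists2 e, 0 < e &
  forall a b, x - e < a -> a <= b -> b < x + e -> P a b c d)) cd
  => [c' m d' cm md [e e0 Pe] [f f0 Pf]|y].
  exists (Num.min e f); first by rewrite lt_min e0.
  have ge : Num.min e f <= e by rewrite ge_min lexx.
  have gf : Num.min e f <= f by rewrite ge_min lexx orbT.
  move=> a' b' xa ab bx; apply: (Pv _ _ _ m) => //; [apply: Pe|apply: Pf] => //; lra.
have [e e0 Pe] := Ploc x y; exists e => // c' d' yc cd' dy.
by exists e => // a' b' xa ab' bx; exact: Pe.
Qed.

End Induction.

(** * Segments of the plane *)
Section RealContinuity.
Variables (R : realType) (X : topologicalType).
Implicit Types f g : X -> R.

Lemma real_continuousD f g : continuous f -> continuous g -> continuous (fun x => f x + g x).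
Proof. by move=> cf cg x; apply: (@cvgD R R _ (nbhs x) _ f g); [exact: cf|exact: cg]. Qed.

Lemma real_continuousB f g : continuous f -> continuous g -> continuous (fun x => f x - g x).
Proof. by move=> cf cg x; apply: (@cvgB R R _ (nbhs x) _ f g); [exact: cf|exact: cg]. Qed.

Lemma real_continuousM f g : continuous f -> continuous g -> continuous (fun x => f x * g x).
Proof. by move=> cf cg x; apply: (@cvgM R _ (nbhs x) _ f g); [exact: cf|exact: cg]. Qed.

Lemma clamp_comp_continuous f : continuous f -> continuous (fun x => clamp (f x)).
Proof. by move=> cf; apply: (Defs.compose_continuous (g := @clamp R)) cf _; exact: clamp_continuous. Qed.

End RealContinuity.

Section Segments.
Variable R : realType.
Local Notation I := (uI R).

Definition seg (u v : R * R) (t : I) : R * R :=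
  (u.1 + ival t * (v.1 - u.1), u.2 + ival t * (v.2 - u.2)).

Lemma seg_continuous u v : continuous (seg u v).
Proof.
by apply: pair_continuous; (apply: real_continuousD; first exact: cst_continuous);
  (apply: real_continuousM; [exact: ival_continuous|exact: cst_continuous]).
Qed.

Lemma seg_zero u v : seg u v zero = u.
Proof. by rewrite /seg ival0 !mul0r !addr0 -surjective_pairing. Qed.

Lemma seg_one u v : seg u v one = v.
Proof. by rewrite /seg ival1 !mul1r !subrKC -surjective_pairing. Qed.

Lemma unitP (t : I) : 0 <= ival t /\ ival t <= 1.
Proof. by have /andP[] := ival_itv t. Qed.

(** Maps on the unit square are extended to the whole plane by precomposition with
this retraction, so that inductions on rectangles need no boundary cases. *)
Definition clamp2 (u : R * R) : I * I := (clamp u.1, clamp u.2).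

Lemma clamp2_continuous : continuous clamp2.
Proof.
by apply: pair_continuous; apply: clamp_comp_continuous; [exact: fst_continuous|exact: snd_continuous].
Qed.

End Segments.

(** * Holonomies *)
Section Holonomy.
Variable R : realType.
Local Notation I := (uI R).
Local Open Scope group_scope.

(** The functional is defined on bare functions rather than on paths with prescribed
end points, so that no transport along equalities of end points is needed;
discontinuous arguments are junk. *)
Record holonomy (X : topologicalType) (G : groupType) (chi : (I -> X) -> G) : Prop :=
  Holonomy {
  hol_cat : forall f g, continuous f -> continuous g -> f one = g zero ->
    chi (pcat_fun f g) = chi f * chi g;
  hol_homotopy : forall H : I * I -> X, continuous H ->
    (forall s, H (s, zero) = H (zero, zero)) ->
    (forall s, H (s, one) = H (zero, one)) ->
    chi (fun t => H (zero, t)) = chi (fun t => H (one, t)) }.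

Lemma hol_pull (X Y : topologicalType) (G : groupType) (chi : (I -> X) -> G)
    (j : Y -> X) :
  continuous j -> holonomy chi -> holonomy (fun f : I -> Y => chi (fun t => j (f t))).
Proof.
move=> cj [hc hh]; split.
- move=> f g cf cg fg.
  rewrite -hc; [|exact: Defs.compose_continuous|exact: Defs.compose_continuous|by rewrite fg].
  by congr chi; apply/funext => t; rewrite /pcat_fun; case: ifP.
- move=> H cH H0 H1.
  apply: (hh (fun p => j (H p))); first exact: Defs.compose_continuous.
    by move=> s; rewrite H0.
  by move=> s; rewrite H1.
Qed.

Variables (X : topologicalType) (G : groupType) (chi : (I -> X) -> G).
Hypothesis hchi : holonomy chi.

(** The plane is convex: two paths in it with the same end points are homotopic by
the straight-line homotopy.  All the computation rules for holonomies follow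
from this case. *)
Lemma hol_planar (F : R * R -> X) (c c' : I -> R * R) :
  continuous F -> continuous c -> continuous c' ->
  c zero = c' zero -> c one = c' one ->
  chi (fun t => F (c t)) = chi (fun t => F (c' t)).
Proof.
move=> cF cc cc' e0 e1.
have c1 := Defs.compose_continuous cc (@fst_continuous _ _).
have c2 := Defs.compose_continuous cc (@snd_continuous _ _).
have c1' := Defs.compose_continuous cc' (@fst_continuous _ _).
have c2' := Defs.compose_continuous cc' (@snd_continuous _ _).
pose H (st : I * I) : R * R :=
  ((1 - ival st.1) * (c st.2).1 + ival st.1 * (c' st.2).1,
   (1 - ival st.1) * (c st.2).2 + ival st.1 * (c' st.2).2)%R.
have cH : continuous H.
  have cs : continuous (fun st : I * I => ival st.1).
    exact: (Defs.compose_continuous (@fst_continuous I I) (@ival_continuous R)).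
  have ct (h : I -> R) : continuous h -> continuous (fun st : I * I => h st.2).
    exact: (Defs.compose_continuous (@snd_continuous I I)).
  have cs' : continuous (fun st : I * I => 1 - ival st.1)%R.
    by apply: real_continuousB; [exact: cst_continuous|exact: cs].
  apply: pair_continuous; apply: real_continuousD.
  - exact: real_continuousM cs' (ct _ c1).
  - exact: real_continuousM cs (ct _ c1').
  - exact: real_continuousM cs' (ct _ c2).
  - exact: real_continuousM cs (ct _ c2').
have H0 t : H (zero, t) = c t.
  by rewrite /H /= ival0 !mul0r subr0 !mul1r !addr0 -surjective_pairing.
have H1 t : H (one, t) = c' t.
  by rewrite /H /= ival1 !mul1r subrr !mul0r !add0r -surjective_pairing.
have := hol_homotopy hchi (H := fun p => F (H p)) (Defs.compose_continuous cH cF).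
have -> : (fun t => F (H (zero, t))) = (fun t => F (c t)).
  by apply/funext => t; rewrite H0.
have -> : (fun t => F (H (one, t))) = (fun t => F (c' t)).
  by apply/funext => t; rewrite H1.
apply.
- by move=> s; rewrite H0 /H /= e0 -!mulrDl subrK !mul1r -surjective_pairing.
- by move=> s; rewrite H0 /H /= e1 -!mulrDl subrK !mul1r -surjective_pairing.
Qed.

Lemma hol_planar_cat (F : R * R -> X) (c c' c'' : I -> R * R) :
  continuous F -> continuous c -> continuous c' -> continuous c'' ->
  c zero = c' zero -> c' one = c'' zero -> c'' one = c one ->
  chi (fun t => F (c t)) = chi (fun t => F (c' t)) * chi (fun t => F (c'' t)).
Proof.
move=> cF cc cc' cc'' e0 e1 e2.
rewrite -(hol_cat hchi); first last.
- by rewrite e1.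
- exact: Defs.compose_continuous cF.
- exact: Defs.compose_continuous cF.
have -> : pcat_fun (fun t => F (c' t)) (fun t => F (c'' t)) =
          (fun t => F (pcat_fun c' c'' t)).
  by apply/funext => t; rewrite /pcat_fun; case: ifP.
apply: hol_planar => //; first exact: pcat_fun_continuous.
- by rewrite e0 pcat_fun_clamp mulr0 invr_ge0 ler0n.
- rewrite -e2 pcat_fun_clamp ifF ?mulr1; last by apply/negbTE; rewrite -ltNge; lra.
  by rewrite [in RHS]clamp_ge1 //; lra.
Qed.

Lemma hol_seg (F : R * R -> X) u v w : continuous F ->
  chi (fun t => F (seg u w t)) = chi (fun t => F (seg u v t)) * chi (fun t => F (seg v w t)).
Proof.
by move=> cF; apply: hol_planar_cat; rewrite ?seg_zero ?seg_one //; exact: seg_continuous.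
Qed.

Lemma hol_cst x : chi (fun=> x) = 1.
Proof.
have := @hol_seg (fun=> x) (0, 0)%R (0, 0)%R (0, 0)%R (@cst_continuous _ _ _).
by move=> /(congr1 (fun g => (chi (fun=> x))^-1 * g)); rewrite mulKg mulVg.
Qed.

Lemma hol_square (K : I * I -> X) : continuous K ->
  chi (fun t => K (zero, t)) * chi (fun s => K (s, one)) =
  chi (fun s => K (s, zero)) * chi (fun t => K (one, t)).
Proof.
move=> cK; pose F u := K (clamp2 u).
have cF : continuous F by exact: (Defs.compose_continuous (@clamp2_continuous R) cK).
pose a : R * R := (0, 0)%R; pose b : R * R := (0, 1)%R.
pose c : R * R := (1, 0)%R; pose d : R * R := (1, 1)%R.
have := hol_seg a c d cF; rewrite (hol_seg a b d cF).
have e1 : (fun t => F (seg a b t)) = (fun t => K (zero, t)).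
  apply/funext => t; rewrite /F /clamp2 /seg /=.
  by rewrite subrr mulr0 addr0 subr0 mulr1 add0r ivalK.
have e2 : (fun t => F (seg b d t)) = (fun t => K (t, one)).
  apply/funext => t; rewrite /F /clamp2 /seg /=.
  by rewrite subrr mulr0 addr0 subr0 mulr1 add0r ivalK.
have e3 : (fun t => F (seg a c t)) = (fun t => K (t, zero)).
  apply/funext => t; rewrite /F /clamp2 /seg /=.
  by rewrite subrr mulr0 addr0 subr0 mulr1 add0r ivalK.
have e4 : (fun t => F (seg c d t)) = (fun t => K (one, t)).
  apply/funext => t; rewrite /F /clamp2 /seg /=.
  by rewrite subrr mulr0 addr0 subr0 mulr1 add0r ivalK.
by rewrite e1 e2 e3 e4.
Qed.

Lemma hol_square_edges (K : I * I -> X) (a b c d : I -> X) : continuous K ->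
  (forall t, K (zero, t) = a t) -> (forall s, K (s, one) = b s) ->
  (forall s, K (s, zero) = c s) -> (forall t, K (one, t) = d t) ->
  chi a * chi b = chi c * chi d.
Proof.
move=> cK /funext <- /funext <- /funext <- /funext <-; exact: hol_square.
Qed.

Definition subpath (f : I -> X) (a b : R) (t : I) : X :=
  f (clamp (a + ival t * (b - a))%R).

Lemma subpath_continuous f a b : continuous f -> continuous (subpath f a b).
Proof.
move=> cf; apply: (Defs.compose_continuous (g := f)) (cf); apply: clamp_comp_continuous.
apply: real_continuousD; first exact: cst_continuous.
by apply: real_continuousM; [exact: ival_continuous|exact: cst_continuous].
Qed.

Lemma subpath_zero f a b : subpath f a b zero = f (clamp a).
Proof. by rewrite /subpath ival0 mul0r addr0. Qed.

Lemma subpath_one f a b : subpath f a b one = f (clamp b).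
Proof. by rewrite /subpath ival1 mul1r subrKC. Qed.

Lemma subpath01 f : subpath f 0 1 = f.
Proof. by apply/funext => t; rewrite /subpath subr0 mulr1 add0r ivalK. Qed.

Lemma hol_subpath f a b c : continuous f ->
  chi (subpath f a c) = chi (subpath f a b) * chi (subpath f b c).
Proof.
move=> cf; pose F (u : R * R) := f (clamp u.1).
apply: (@hol_seg F (a, 0)%R (b, 0)%R (c, 0)%R).
by apply: (Defs.compose_continuous (g := f)) (cf); apply: clamp_comp_continuous; exact: fst_continuous.
Qed.

Lemma hol_subpath_rev f a b : continuous f ->
  chi (subpath f b a) = (chi (subpath f a b))^-1.
Proof.
move=> cf; have := hol_subpath a b a cf.
have -> : subpath f a a = fun=> f (clamp a).
  by apply/funext => t; rewrite /subpath subrr mulr0 addr0.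
by rewrite hol_cst => e; rewrite -[RHS]mulg1 e mulKg.
Qed.

(** A holonomy that is locally a coboundary of one global function [sigma] is its
coboundary, by additivity over subpaths. *)
Lemma locally_exact (sigma : X -> G) :
  (forall x, exists U, [/\ open U, U x & forall f : I -> X, continuous f ->
     (forall t, U (f t)) -> chi f = sigma (f zero) * (sigma (f one))^-1]) ->
  forall f, continuous f -> chi f = sigma (f zero) * (sigma (f one))^-1.
Proof.
move=> loc f cf.
suff h : forall a b : R, (a <= b)%R ->
    chi (subpath f a b) = sigma (f (clamp a)) * (sigma (f (clamp b)))^-1.
  by have := h 0%R 1%R ler01; rewrite subpath01.
apply: interval_induction => [a m b _ _|x].
  by rewrite (hol_subpath a m b cf) => -> ->; rewrite !mulgA mulgVK.
have [U [oU Ux hU]] := loc (f (clamp x)).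
have cfc := Defs.compose_continuous (@clamp_continuous R) cf.
have /(@nbhs_ballP R) [e /= e0 he] : nbhs x ((fun r => f (clamp r)) @^-1` U).
  by apply: cfc; exact: open_nbhs_nbhs.
exists e => // a b xa ab bx; rewrite hU ?subpath_zero ?subpath_one //.
  exact: subpath_continuous.
move=> t; apply: he; rewrite /ball /= ltr_distlC.
have [t0 t1] := unitP t; apply/andP; split; nra.
Qed.

End Holonomy.

(** * Rectangles *)
Section Rectangles.
Variable R : realType.
Implicit Types (u v : R * R) (a b c d : R).

Definition rect a b c d : set (R * R) :=
  [set u | [/\ a <= u.1, u.1 <= b, c <= u.2 & u.2 <= d]].

Definition rclamp a b (x : R) : R := Num.max a (Num.min b x).

Lemma rclamp_continuous a b : continuous (rclamp a b).
Proof.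
move=> r.
apply: (continuous_max (f := fun=> a : R^o) (g := fun r : R => Num.min b r : R^o)).
  exact: cvg_cst.
apply: (continuous_min (f := fun=> b : R^o) (g := fun r : R => r : R^o)).
  exact: cvg_cst.
exact: cvg_id.
Qed.

Lemma rclamp_id a b x : a <= x -> x <= b -> rclamp a b x = x.
Proof. by move=> ax xb; rewrite /rclamp (min_idPr xb) (max_idPr ax). Qed.

Lemma rclamp_itv a b x : a <= b -> a <= rclamp a b x /\ rclamp a b x <= b.
Proof. by move=> ab; rewrite /rclamp le_max lexx ge_max ab ge_min lexx. Qed.

(** The nearest-point retraction of the plane onto the rectangle. *)
Definition rect_clamp a b c d u : R * R := (rclamp a b u.1, rclamp c d u.2).

Lemma rect_clamp_continuous a b c d : continuous (rect_clamp a b c d).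
Proof.
apply: pair_continuous.
  exact: (Defs.compose_continuous (@fst_continuous _ _) (@rclamp_continuous a b)).
exact: (Defs.compose_continuous (@snd_continuous _ _) (@rclamp_continuous c d)).
Qed.

Lemma rect_clamp_id a b c d u : rect a b c d u -> rect_clamp a b c d u = u.
Proof.
by case: u => x y [/= ? ? ? ?]; rewrite /rect_clamp /= !rclamp_id.
Qed.

Lemma rect_clampP a b c d u : a <= b -> c <= d -> rect a b c d (rect_clamp a b c d u).
Proof.
by move=> ab cd; have [? ?] := rclamp_itv u.1 ab; have [? ?] := rclamp_itv u.2 cd.
Qed.

Lemma rect_seg a b c d u v t :
  rect a b c d u -> rect a b c d v -> rect a b c d (seg u v t).
Proof.
move=> [? ? ? ?] [? ? ? ?]; have [t0 t1] := unitP t.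
by split; rewrite /seg /=; nra.
Qed.

Lemma rect_nbhs (A : set (R * R)) x y : nbhs (x, y) A ->
  exists2 e, 0 < e & forall a b c d, x - e < a -> b < x + e ->
    y - e < c -> d < y + e -> rect a b c d `<=` A.
Proof.
move=> /(@nbhs_ballP R) [e /= e0 he]; exists e => // a b c d xa bx yc dy u [? ? ? ?].
by apply: he; split; rewrite /ball /= ltr_distlC; apply/andP; split; lra.
Qed.

(** Exchanging the coordinates reduces gluing along horizontal edges to gluing along
vertical ones. *)
Definition swap u : R * R := (u.2, u.1).

Lemma swap_continuous : continuous swap.
Proof. by apply: pair_continuous; [exact: snd_continuous|exact: fst_continuous]. Qed.

Lemma swapK : involutive swap. Proof. by case. Qed.

Lemma rect_swap a b c d u : rect a b c d u -> rect c d a b (swap u).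
Proof. by case. Qed.

End Rectangles.

(** * A van Kampen theorem for holonomies *)
Section VanKampen.
Variables (R : realType) (X : topologicalType) (J : Type) (Y : J -> topologicalType).
Variables (j : forall i, Y i -> X) (G : groupType).
Variable chi : forall i, (uI R -> Y i) -> G.
Local Notation I := (uI R).
Local Open Scope group_scope.

Hypothesis hchi : forall i, holonomy (@chi i).
(** For [i = k] this says that a holonomy only depends on the image of a path in
[X], as when the maps [j] are injective. *)
Hypothesis compat : forall i k (f : I -> Y i) (g : I -> Y k),
  continuous f -> continuous g -> (forall t, j (f t) = j (g t)) -> chi f = chi g.
Hypothesis cover : forall x : X, exists (W : set X) (i : J) (k : X -> Y i),
  [/\ open W, W x, forall y, W y -> {for y, continuous k} &
      forall y, W y -> j (k y) = y].

Implicit Types (H : R * R -> X) (s : R * R -> G).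

(** A section of the trivial bundle with fibre [G] over a rectangle, parallel for the
holonomies pulled back by [H].  Testing on straight segments suffices, and a
segment crosses an edge at most once, which is what makes gluing possible. *)
Definition horizontal H (a b c d : R) s : Prop :=
  forall i (f : I -> Y i) u v, rect a b c d u -> rect a b c d v -> continuous f ->
    (forall t, j (f t) = H (seg u v t)) -> s v = s u * chi f.

Lemma horizontal_sub H a b c d a' b' c' d' s :
  rect a' b' c' d' `<=` rect a b c d -> horizontal H a b c d s -> horizontal H a' b' c' d' s.
Proof. by move=> sub fs i f u v /sub hu /sub hv; exact: fs. Qed.

Lemma horizontal_swap H a b c d s :
  horizontal H a b c d s -> horizontal (H \o @swap R) c d a b (s \o @swap R).
Proof.
by move=> fs i f u v /rect_swap hu /rect_swap hv cf fE; apply: fs.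
Qed.

Lemma horizontal_shift H a b c d s g :
  horizontal H a b c d s -> horizontal H a b c d (fun u => g * s u).
Proof. by move=> fs i f u v hu hv cf fE; rewrite -mulgA (fs i f u v). Qed.

(** Near any point, [H] factors through one of the pieces. *)
Lemma local_lift_in_piece H x y : continuous H ->
  exists2 e, (0 < e)%R & forall a b c d, (x - e < a)%R -> (a <= b)%R -> (b < x + e)%R ->
    (y - e < c)%R -> (c <= d)%R -> (d < y + e)%R ->
    exists i (F : R * R -> Y i), continuous F /\
      forall u, rect a b c d u -> j (F u) = H u.
Proof.
move=> cH; have [W [i [k [oW Wx ck kK]]]] := cover (H (x, y)).
have [e e0 he] : exists2 e : R, (0 < e)%R & forall a b c d, (x - e < a)%R ->
    (b < x + e)%R -> (y - e < c)%R -> (d < y + e)%R -> rect a b c d `<=` H @^-1` W.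
  by apply: rect_nbhs; apply: cH; exact: open_nbhs_nbhs.
exists e => // a b c d xa ab bx yc cd dy; have {}he := he a b c d xa bx yc dy.
exists i, (fun u => k (H (rect_clamp a b c d u))); split; last first.
  by move=> u hu; rewrite rect_clamp_id // kK //; exact: he.
move=> u; apply: (@continuous_comp _ _ _ (fun u => H (rect_clamp a b c d u)) k).
  exact: (Defs.compose_continuous (@rect_clamp_continuous R a b c d) cH).
by apply/ck/he; exact: rect_clampP.
Qed.

(** Transport along the segments issued from the lower left corner is horizontal:
the holonomy of a triangle is trivial. *)
Lemma horizontal_local H x y : continuous H ->
  exists2 e, (0 < e)%R & forall a b c d, (x - e < a)%R -> (a <= b)%R -> (b < x + e)%R ->
    (y - e < c)%R -> (c <= d)%R -> (d < y + e)%R -> exists s, horizontal H a b c d s.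
Proof.
move=> cH; have [e e0 he] := local_lift_in_piece x y cH.
exists e => // a b c d xa ab bx yc cd dy.
have [i [F [cF FE]]] := he a b c d xa ab bx yc cd dy.
exists (fun u => chi (fun t => F (seg (a, c) u t))) => i' f u v hu hv cf fE.
rewrite (hol_seg (hchi i) _ u _ cF); congr (_ * _).
apply: compat => //.
  exact: (Defs.compose_continuous (@seg_continuous R u v) cF).
by move=> t; rewrite fE FE //; exact: rect_seg.
Qed.

(** Along an edge, a horizontal section is determined by one value. *)
Lemma horizontal_unique H (m c d : R) s1 s2 : continuous H ->
  horizontal H m m c d s1 -> horizontal H m m c d s2 -> s1 (m, c) = s2 (m, c) ->
  forall t, (c <= t)%R -> (t <= d)%R -> s1 (m, t) = s2 (m, t).
Proof.
move=> cH f1 f2 e0 t ct td.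
suff h : forall a b : R, (a <= b)%R -> (c <= a)%R -> (b <= d)%R ->
    s1 (m, a) = s2 (m, a) -> s1 (m, b) = s2 (m, b) by apply: (h c t).
apply: interval_induction => [a n b an nb h1 h2 ca bd /h1 h|y].
  by apply: h2 => //; [lra|apply: h; lra].
have [e e0' he] := local_lift_in_piece m y cH.
exists e => // a b ya ab yb ca bd es.
have [i [F [cF FE]]] : exists i (F : R * R -> Y i), continuous F /\
      forall u, rect m m a b u -> j (F u) = H u.
  by apply: he => //; lra.
have ha : rect m m a b (m, a) by split => /=; rewrite ?lexx.
have hb : rect m m a b (m, b) by split => /=; rewrite ?lexx.
have sub : rect m m a b `<=` rect m m c d by move=> u [? ? ? ?]; split => //; lra.
have cf := Defs.compose_continuous (@seg_continuous R (m, a) (m, b)) cF.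
have fE t' : j (F (seg (m, a) (m, b) t')) = H (seg (m, a) (m, b) t').
  by apply: FE; exact: rect_seg.
rewrite (f1 i _ (m, a) (m, b) (sub _ ha) (sub _ hb) cf fE) es.
by rewrite -(f2 i _ (m, a) (m, b) (sub _ ha) (sub _ hb) cf fE).
Qed.

(** Translate the second section so that the two agree at one end of the common
edge, hence on the whole edge; a segment crossing the edge is cut there. *)
Lemma horizontal_glue H (a m b c d : R) : continuous H ->
  (a <= m)%R -> (m <= b)%R -> (c <= d)%R ->
  (exists s, horizontal H a m c d s) -> (exists s, horizontal H m b c d s) ->
  exists s, horizontal H a b c d s.
Proof.
move=> cH am mb cd [s1 f1] [s2' f2'].
pose s2 u := s1 (m, c) * (s2' (m, c))^-1 * s2' u.
have f2 : horizontal H m b c d s2 by exact: horizontal_shift.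
have edge t : (c <= t)%R -> (t <= d)%R -> s1 (m, t) = s2 (m, t).
  apply: (@horizontal_unique H m c d) => //; last by rewrite /s2 mulgVK.
    by apply: horizontal_sub f1 => u [? ? ? ?]; split => //; lra.
  by apply: horizontal_sub f2 => u [? ? ? ?]; split => //; lra.
pose s u := if (u.1 <= m)%R then s1 u else s2 u.
have half i (f : I -> Y i) u v : rect a b c d u -> rect a b c d v ->
    (u.1 <= v.1)%R -> continuous f ->
    (forall t, j (f t) = H (seg u v t)) -> s v = s u * chi f.
  move=> [u1 u2 u3 u4] [v1 v2 v3 v4] uv cf fE; rewrite /s.
  have [vm|mv] := leP v.1 m.
    rewrite (le_trans uv vm); apply: (f1 i) => //; split => //; lra.
  have [um|mu] := leP u.1 m; last by apply: (f2 i) => //; split => //; lra.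
  (* the parameter at which the segment meets the line of abscissa [m] *)
  pose r := ((m - u.1) / (v.1 - u.1))%R.
  have uv0 : (v.1 - u.1 != 0)%R by rewrite subr_eq0; lra.
  have rE : (r * (v.1 - u.1) = m - u.1)%R by rewrite /r mulfVK.
  have r0 : (0 <= r)%R by apply: divr_ge0; lra.
  have r1 : (r <= 1)%R by rewrite /r ler_pdivrMr; lra.
  pose w := seg u v (clamp r).
  have w1 : w.1 = m.
    by rewrite /w /seg /= clampK ?r0 // rE subrKC.
  have hw : w = (m, w.2) by rewrite -w1 -surjective_pairing.
  have w3 : (c <= w.2)%R by rewrite /w /seg /= clampK ?r0 //; nra.
  have w4 : (w.2 <= d)%R by rewrite /w /seg /= clampK ?r0 //; nra.
  have subE p q t : (0 <= p <= 1)%R -> (0 <= q <= 1)%R ->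
      j (subpath f p q t) = H (seg (seg u v (clamp p)) (seg u v (clamp q)) t).
    move=> hp hq; rewrite /subpath fE; congr H; rewrite /seg /= !clampK //.
      by congr (_, _)%core; ring.
    by have [t0 t1] := unitP t; case/andP: hp => ? ?; case/andP: hq => ? ?;
      apply/andP; split; nra.
  have -> : chi f = chi (subpath f 0 r) * chi (subpath f r 1).
    by rewrite -(hol_subpath (hchi i)) // subpath01.
  rewrite mulgA -(f1 i (subpath f 0 r) u w); first last.
  - move=> t; rewrite subE ?lexx ?ler01 ?r0 //.
    by rewrite clamp_le0 // seg_zero.
  - exact: subpath_continuous.
  - by split; rewrite ?w1 //.
  - by split; rewrite ?w1 //.
  rewrite hw edge //; apply: (f2 i) => //.
  - by split => //; lra.
  - exact: subpath_continuous.
  - by move=> t; rewrite -hw subE ?lexx ?ler01 ?r0 // [clamp 1]clamp_ge1 // seg_one.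
(* A segment run from right to left is reversed. *)
exists s => i f u v hu hv cf fE.
have [uv|/ltW vu] := leP u.1 v.1; first exact: half.
have -> : chi f = (chi (subpath f 1 0))^-1.
  by rewrite (hol_subpath_rev (hchi i)) // subpath01 invgK.
apply: (can_inj (fun x => mulgK (chi (subpath f 1 0)) x)); rewrite mulgVK.
rewrite -(half i (subpath f 1 0) v u) //; first exact: subpath_continuous.
move=> t; rewrite /subpath fE; congr H; rewrite /seg /= clampK.
  by congr (_, _)%core; ring.
by have [t0 t1] := unitP t; apply/andP; split; lra.
Qed.

Lemma horizontal_exists H (a b c d : R) : continuous H -> (a <= b)%R -> (c <= d)%R ->
  exists s, horizontal H a b c d s.
Proof.
move=> cH; move: a b c d; apply: rectangle_induction.
- by move=> a m b c d *; exact: (@horizontal_glue H a m b c d).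
- move=> a b c m d ab cm md [s1 /horizontal_swap f1] [s2 /horizontal_swap f2].
  have [s /horizontal_swap fs] : exists s, horizontal (H \o @swap R) c d a b s.
    apply: (@horizontal_glue _ c m d a b) => //; [|by exists (s1 \o @swap R)|by exists (s2 \o @swap R)].
    exact: Defs.compose_continuous (@swap_continuous R) cH.
  have E : (H \o @swap R) \o @swap R = H by apply/funext => u /=; rewrite swapK.
  by rewrite E in fs; exists (s \o @swap R).
- by move=> x y; exact: horizontal_local.
Qed.

(** A horizontal section over the null-homotopy is constant along the three constant
edges, so that its variation along the fourth, the holonomy of the loop, is
trivial. *)
Theorem van_kampen_holonomy i (f : I -> Y i) (H : I * I -> X) (x : X) :
  continuous f -> continuous H -> (forall t, H (zero, t) = j (f t)) ->
  (forall t, H (one, t) = x) -> (forall t, H (t, zero) = x) ->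
  (forall t, H (t, one) = x) -> chi f = 1.
Proof.
move=> cf cH H0 H1 Hz Ho.
pose F u := H (clamp2 u).
have cF : continuous F by exact: Defs.compose_continuous (@clamp2_continuous R) cH.
have [s fs] := horizontal_exists cF (@ler01 R) (@ler01 R).
have xE : x = j (f zero) by rewrite -H0 Hz.
have const u v : rect 0 1 0 1 u -> rect 0 1 0 1 v ->
    (forall t, F (seg u v t) = x) -> s v = s u.
  move=> hu hv FE; rewrite (fs i (fun=> f zero) u v) ?(hol_cst (hchi i)) ?mulg1 //.
    exact: cst_continuous.
  by move=> t; rewrite FE xE.
have r00 : rect 0 1 0 1 (0 : R, 0 : R)%R by split => /=; lra.
have r01 : rect 0 1 0 1 (0 : R, 1 : R)%R by split => /=; lra.
have r10 : rect 0 1 0 1 (1 : R, 0 : R)%R by split => /=; lra.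
have r11 : rect 0 1 0 1 (1 : R, 1 : R)%R by split => /=; lra.
have e1 : s (0, 1)%R = s (0, 0)%R * chi f.
  apply: fs => // t; rewrite /F /clamp2 /seg /= !subr0 mulr0 !add0r mulr1 ivalK.
  by rewrite -H0.
have e2 : s (1, 0)%R = s (0, 0)%R.
  by apply: const => // t; rewrite /F /clamp2 /seg /= !subr0 mulr0 !add0r Hz.
have e3 : s (1, 1)%R = s (1, 0)%R.
  by apply: const => // t; rewrite /F /clamp2 /seg /= subrr mulr0 !addr0 H1.
have e4 : s (1, 1)%R = s (0, 1)%R.
  by apply: const => // t; rewrite /F /clamp2 /seg /= subrr mulr0 !addr0 Ho.
by apply: (mulgI (s (0, 0)%R)); rewrite -e1 -e4 e3 e2 mulg1.
Qed.

End VanKampen.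

(** * Lifting paths and squares to a covering *)
Section Lifting.
Variables (R : realType) (F : Type) (X Y : topologicalType) (p : X -> Y).
Local Notation I := (uI R).
Hypothesis hp : covering_map F p.

(** The definition of an evenly covered set in terms of local inverses [k i] of [p].
The base point [x0] gives these total functions a value off the neighbourhood. *)
Lemma covering_sheets (x0 : X) (y : Y) :
  exists (U : set Y) (V : F -> set X) (k : F -> Y -> X),
    [/\ open U /\ U y, forall i, open (V i),
        forall i l x, V i x -> V l x -> i = l,
        forall x, U (p x) -> exists i, V i x &
        forall i, [/\ forall z, U z -> {for z, continuous (k i)},
          forall z, U z -> p (k i z) = z & forall x, V i x -> k i (p x) = x]].
Proof.
have [_ /(_ y) [U [oU Uy [V [oV tV pU hV]]]]] := hp.
have sur i z : U z -> exists2 x, V i x & p x = z.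
  by move=> Uz; have [[_ _ /(_ z Uz)]] := hV i.
have inj i x x' : V i x -> V i x' -> p x = p x' -> x = x'.
  move=> Vx Vx'; have [[_ pinj _] _] := hV i.
  by apply: pinj; rewrite inE.
pose k i z := xget x0 [set x | V i x /\ p x = z].
have kP i z : U z -> V i (k i z) /\ p (k i z) = z.
  by move=> /(sur i) [x Vx pxz]; rewrite /k; case: xgetP => [x' _ //|/(_ x)]; case.
have VU i x : V i x -> U (p x).
  by move=> Vx; have : (p @^-1` U) x by rewrite pU; exists i.
exists U, V, k; split=> //.
- move=> i l x Vi Vl.
  by have := tV i l Logic.I Logic.I; apply; exists x.
- by move=> x Ux; have : (p @^-1` U) x by []; rewrite pU => -[i _ ?]; exists i.
move=> i; split.
- move=> z Uz; have [Vk pk] := kP i z Uz.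
  move=> A; rewrite nbhsE => -[B [oB Bk] BA].
  have oW : open (p @` (B `&` V i)).
    by apply: (hV i).2; [exact: openI|move=> ? []].
  apply: (filterS (P := p @` (B `&` V i))); last first.
    by apply: open_nbhs_nbhs; split => //; exists (k i z).
  move=> _ [x [Bx Vx] <-]; apply: BA.
  have [Vk' pk'] := kP i (p x) (VU _ _ Vx).
  by rewrite (inj i _ _ Vk' Vx pk').
- by move=> z /(kP i) [].
- move=> x Vx; have [Vk' pk'] := kP i (p x) (VU _ _ Vx).
  exact: inj Vk' Vx pk'.
Qed.

(** Locally two lifts are on the same sheet or on different ones, so that the
proposition that they agree is locally constant. *)
Lemma lift_unique_real (f g : R -> X) : continuous f -> continuous g ->
  (forall t, p (f t) = p (g t)) -> forall a b, f a = g a -> f b = g b.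
Proof.
move=> cf cg fg.
suff h : forall a b : R, a <= b -> f a = g a <-> f b = g b.
  by move=> a b; have [ab|/ltW ba] := leP a b; [have := h a b ab|have := h b a ba]; tauto.
apply: interval_induction => [a m b _ _ h1 h2|t]; first by tauto.
have [U [V [k [[oU Ut] oV dV VU hk]]]] := covering_sheets (f t) (p (f t)).
have [i Vi] := VU (f t) Ut.
have [l Vl] : exists l, V l (g t) by apply: VU; rewrite -fg.
have /(@nbhs_ballP R) [e /= e0 he] : nbhs t (f @^-1` V i `&` g @^-1` V l).
  by apply: filterI; [apply: cf|apply: cg]; exact: open_nbhs_nbhs.
have key s : t - e < s -> s < t + e -> f s = g s <-> i = l.
  move=> s1 s2; have [Vf Vg] : (f @^-1` V i `&` g @^-1` V l) s.
    by apply: he; rewrite /ball /= ltr_distlC s1.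
  split=> [e1|il]; first by apply: (dV i l (f s)) => //; rewrite e1.
  rewrite -il in Vg; have [_ _ kp] := hk i.
  by rewrite -(kp _ Vf) -(kp _ Vg) fg.
exists e => // a b ta ab tb.
have ka : f a = g a <-> i = l by apply: key; lra.
have kb : f b = g b <-> i = l by apply: key; lra.
by rewrite ka kb.
Qed.

Lemma lift_unique (f g : I -> X) : continuous f -> continuous g ->
  (forall t, p (f t) = p (g t)) -> f zero = g zero -> f = g.
Proof.
move=> cf cg fg e0; apply/funext => t; rewrite -(ivalK t).
apply: (@lift_unique_real (fun r => f (clamp r)) (fun r => g (clamp r)) _ _ _ 0) => //.
- exact: Defs.compose_continuous (@clamp_continuous R) cf.
- exact: Defs.compose_continuous (@clamp_continuous R) cg.
Qed.

Definition liftable (H : R * R -> Y) (a b c d : R) : Prop :=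
  forall x0, p x0 = H (a, c) -> exists L : R * R -> X,
    [/\ continuous L, forall u, p (L u) = H (rect_clamp a b c d u) & L (a, c) = x0].

(** The two lifts agree at one end of the common edge, hence along it, by uniqueness
of path lifting. *)
Lemma liftable_glue H (a m b c d : R) : a <= m -> m <= b -> c <= d ->
  liftable H a m c d -> liftable H m b c d -> liftable H a b c d.
Proof.
move=> am mb cd l1 l2 x0 px0.
have [L1 [cL1 pL1 L10]] := l1 x0 px0.
have cl x y z : x <= y -> rclamp x y (rclamp x y z) = rclamp x y z :> R.
  by move=> xy; have [? ?] := rclamp_itv z xy; exact: rclamp_id.
have [L2 [cL2 pL2 L20]] : exists L2 : R * R -> X, [/\ continuous L2,
    forall u, p (L2 u) = H (rect_clamp m b c d u) & L2 (m, c) = L1 (m, c)].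
  by apply: l2; rewrite pL1 rect_clamp_id //; split => /=; rewrite ?lexx.
have edge t : L1 (m, t) = L2 (m, t).
  have cm : continuous (fun t : R => (m, t)).
    by apply: pair_continuous; [exact: cst_continuous|move=> ?; exact: cvg_id].
  apply: (@lift_unique_real (fun t => L1 (m, t)) (fun t => L2 (m, t)) _ _ _ c) => //.
  - exact: Defs.compose_continuous cm cL1.
  - exact: Defs.compose_continuous cm cL2.
  - by move=> s; rewrite pL1 pL2 /rect_clamp /= !(@rclamp_id _ _ _ m) ?lexx.
exists (fun u => if u.1 <= m then L1 u else L2 u); split.
- apply: piecewise_continuous => //; first exact: fst_continuous.
  by case=> x y /= ->; exact: edge.
- move=> u; case: ifP => [um|/negbT]; rewrite ?pL1 ?pL2.
    congr (H (_, _)); rewrite /rclamp (min_idPr um).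
    by rewrite (min_idPr (le_trans um mb)).
  rewrite -ltNge => mu; congr (H (_, _)); rewrite /rclamp.
  have mm : m <= Num.min b u.1 by rewrite le_min mb (ltW mu).
  by rewrite (max_idPr mm) (max_idPr (le_trans am mm)).
- by rewrite /= am.
Qed.

Lemma liftable_swap H (a b c d : R) : liftable H a b c d ->
  liftable (H \o @swap R) c d a b.
Proof.
move=> l x0 px0; have [L [cL pL L0]] := l x0 px0.
exists (L \o @swap R); split => //.
  exact: Defs.compose_continuous (@swap_continuous R) cL.
by move=> u; rewrite /= pL.
Qed.

Lemma liftable_local (H : R * R -> Y) x y : continuous H ->
  exists2 e, 0 < e & forall a b c d, x - e < a -> a <= b -> b < x + e ->
    y - e < c -> c <= d -> d < y + e -> liftable H a b c d.
Proof.
move=> cH.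
have [[x0]|nX] := pselect (inhabited X); last first.
  by exists 1 => // a b c d _ _ _ _ _ _ x0; case: nX.
have [U [V [k [[oU Uy] oV _ VU hk]]]] := covering_sheets x0 (H (x, y)).
have [e e0 he] : exists2 e : R, 0 < e & forall a b c d, x - e < a ->
    b < x + e -> y - e < c -> d < y + e -> rect a b c d `<=` H @^-1` U.
  by apply: rect_nbhs; apply: cH; exact: open_nbhs_nbhs.
exists e => // a b c d xa ab bx yc cd dy x1 px1; have {}he := he a b c d xa bx yc dy.
have hac : rect a b c d (a, c) by split => /=; rewrite ?lexx.
have [i Vi] : exists i, V i x1 by apply: VU; rewrite px1; exact: he.
have [ck pk kp] := hk i.
exists (fun u => k i (H (rect_clamp a b c d u))); split.
- move=> u; apply: (@continuous_comp _ _ _ (fun u => H (rect_clamp a b c d u)) (k i)).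
    exact: (Defs.compose_continuous (@rect_clamp_continuous R a b c d) cH).
  by apply/ck/he; exact: rect_clampP.
- by move=> u; rewrite pk //; apply: he; exact: rect_clampP.
- by rewrite rect_clamp_id // -px1 kp.
Qed.

Lemma liftable_rect (H : R * R -> Y) a b c d : continuous H ->
  a <= b -> c <= d -> liftable H a b c d.
Proof.
move=> cH; move: a b c d; apply: rectangle_induction.
- by move=> a m b c d *; exact: (@liftable_glue H a m b c d).
- move=> a b c m d ab cm md /liftable_swap f1 /liftable_swap f2.
  have /liftable_swap := liftable_glue cm md ab f1 f2.
  have -> // : (H \o @swap R) \o @swap R = H by apply/funext => u /=; rewrite swapK.
- by move=> x y; exact: liftable_local.
Qed.

Lemma lift_square (H : I * I -> Y) (x0 : X) : continuous H -> p x0 = H (zero, zero) ->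
  exists L : I * I -> X,
    [/\ continuous L, forall q, p (L q) = H q & L (zero, zero) = x0].
Proof.
move=> cH px0.
have : liftable (fun u => H (clamp2 u)) 0 1 0 1.
  have : continuous (fun u => H (clamp2 u)).
    exact: Defs.compose_continuous (@clamp2_continuous R) cH.
  move=> cF; exact: (liftable_rect cF (@ler01 R) (@ler01 R)).
move=> /(_ x0 px0) [L [cL pL L0]].
exists (fun q => L (ival q.1, ival q.2)); split.
- apply: (Defs.compose_continuous (g := L)) (cL).
  apply: pair_continuous.
    exact: Defs.compose_continuous (@fst_continuous _ _) (@ival_continuous R).
  exact: Defs.compose_continuous (@snd_continuous _ _) (@ival_continuous R).
- move=> [s t]; rewrite pL rect_clamp_id; last first.
    by have [? ?] := unitP s; have [? ?] := unitP t.
  by rewrite /clamp2 /= !ivalK.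
- by rewrite /= !ival0.
Qed.

Lemma lift_path (f : I -> Y) (x0 : X) : continuous f -> p x0 = f zero ->
  exists g : I -> X, [/\ continuous g, forall t, p (g t) = f t & g zero = x0].
Proof.
move=> cf px0.
have [L [cL pL L0]] := @lift_square (fun q => f q.2) x0
  (Defs.compose_continuous (@snd_continuous _ _) cf) px0.
exists (fun t => L (zero, t)); split => //.
  apply: (Defs.compose_continuous (g := L)) (cL).
  by apply: pair_continuous; [exact: cst_continuous|move=> ?; exact: cvg_id].
Qed.

(** The lift of the homotopy starting at the common initial point restricts on its
four edges to lifts of known paths. *)
Lemma lift_homotopy (l l' : I -> X) (H : I * I -> Y) :
  continuous l -> continuous l' -> l zero = l' zero -> continuous H ->
  (forall t, H (zero, t) = p (l t)) -> (forall t, H (one, t) = p (l' t)) ->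
  (forall s, H (s, zero) = p (l zero)) -> (forall s, H (s, one) = p (l one)) ->
  exists L : I * I -> X, [/\ continuous L, forall t, L (zero, t) = l t,
    forall t, L (one, t) = l' t, forall s, L (s, zero) = l zero &
    forall s, L (s, one) = l one].
Proof.
move=> cl cl' ll' cH H0 H1 Hz Ho.
have [L [cL pL L0]] := @lift_square H (l zero) cH (esym (H0 zero)).
have cid : continuous (fun t : I => t) by move=> ?; exact: cvg_id.
have cr (s : I) : continuous (fun t => L (s, t)).
  apply: (Defs.compose_continuous (g := L)) (cL).
  by apply: pair_continuous => //; exact: cst_continuous.
have cs (t : I) : continuous (fun s => L (s, t)).
  apply: (Defs.compose_continuous (g := L)) (cL).
  by apply: pair_continuous => //; exact: cst_continuous.
have ccst (x : X) : continuous (fun _ : I => x) by exact: cst_continuous.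
have e0 : (fun t => L (zero, t)) = l.
  by apply: lift_unique => // t; rewrite pL H0.
have ez : (fun s => L (s, zero)) = (fun=> l zero).
  by apply: lift_unique => // s; rewrite pL Hz.
have e1 : (fun t => L (one, t)) = l'.
  apply: lift_unique => // [t|]; first by rewrite pL H1.
  by rewrite -ll' -[RHS]/((fun=> l zero) (one : I)) -ez.
have eo : (fun s => L (s, one)) = (fun=> l one).
  apply: lift_unique => // [s|]; first by rewrite pL Ho.
  by rewrite -e0.
exists L; split => // u.
- by rewrite -e0.
- by rewrite -e1.
- by rewrite -[LHS]/((fun s => L (s, zero)) u) ez.
- by rewrite -[LHS]/((fun s => L (s, one)) u) eo.
Qed.

End Lifting.

(** * Induced morphisms and twofold coverings *)
Section InducedMorphism.
Variables (R : realType) (T U : topologicalType) (f : continuousType T U) (x : T).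

Lemma pi1_map_class (l : {path (uI R) from x to x}) :
  pi1_map f (pi1_class l) = pi1_class (Defs.path_map f l).
Proof.
apply/pi1_classP; have [H [cH H0 H1 He]] := pi1_repr l.
exists (fun q => f (H q)); split.
- exact: Defs.compose_continuous cH (@cts_fun _ _ f).
- by move=> t; rewrite H0.
- by move=> t; rewrite H1.
- by move=> s; have [-> ->] := He s.
Qed.

Lemma pi1_mapM (a b : pi1 R x) :
  pi1_map f (a * b)%g = (pi1_map f a * pi1_map f b)%g.
Proof.
rewrite -(pi1_classK a) -(pi1_classK b) -[(_ * _)%g]pi1_class_cat !pi1_map_class.
rewrite -[(_ * _)%g]pi1_class_cat; congr pi1_class; apply/path_eqP => t.
change (f (pcat_fun (repr a) (repr b) t) = pcat_fun (f \o repr a) (f \o repr b) t).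
by rewrite /pcat_fun; case: ifP.
Qed.

Lemma pi1_map1 : pi1_map f (1%g : pi1 R x) = 1%g.
Proof.
have := pi1_mapM 1%g 1%g; rewrite mulg1 => /(congr1 (fun g => (pi1_map f 1)^-1 * g)%g).
by rewrite mulKg mulVg.
Qed.

End InducedMorphism.

Section TwoSheets.
Variables (R : realType) (E C2 : topologicalType).
Local Notation I := (uI R).
Variables (p : continuousType C2 E) (sigma : continuousType C2 C2) (c0 : C2).
Hypothesis hp : covering_map bool p.
Hypothesis hC2 : path_connected R C2.
Hypothesis hsigma : covering_transformation p sigma.
Hypothesis sigma_neq : (sigma : C2 -> C2) <> id.
Variables (m : {path I from (p c0) to (p c0)}) (mt : {path I from c0 to (sigma c0)}).
Hypothesis hmt : forall t, p (mt t) = m t.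

Lemma psigma c : p (sigma c) = p c.
Proof. by case: hsigma => _ _ /(congr1 (fun h => h c)). Qed.

(** A covering transformation fixing a point is the identity, by uniqueness of path
lifting. *)
Lemma sigma_base : sigma c0 <> c0.
Proof.
move=> e; apply: sigma_neq; apply/funext => c.
have [l] := hC2 c0 c; rewrite -[c in RHS](@path_one _ _ _ _ l) -[c in LHS](@path_one _ _ _ _ l).
suff e' : (fun t => sigma (l t)) = l :> (I -> C2) by exact: (congr1 (fun h : I -> C2 => h one) e').
apply: (lift_unique hp).
- exact: (Defs.compose_continuous (@cts_fun _ _ l) (@cts_fun _ _ sigma)).
- exact: cts_fun.
- by move=> t; rewrite psigma.
- by rewrite path_zero.
Qed.

(** Two sheets leave no room for a third point over [p c0]. *)
Lemma fibre_base c : p c = p c0 -> c = c0 \/ c = sigma c0.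
Proof.
move=> pc.
have [U [V [k [[oU Ut] oV dV VU hk]]]] := covering_sheets hp c0 (p c0).
have [i Vi] := VU c0 Ut.
have [l Vl] : exists l, V l (sigma c0) by apply: VU; rewrite psigma.
have [n Vn] : exists n, V n c by apply: VU; rewrite pc.
have inj h x x' : V h x -> V h x' -> p x = p x' -> x = x'.
  by move=> Vx Vx' px; have [_ _ kp] := hk h; rewrite -(kp _ Vx) px kp.
have il : i != l.
  apply/eqP => il; rewrite -il in Vl; apply: sigma_base.
  by apply: inj Vl Vi _; rewrite psigma.
have [ni|nl] : n = i \/ n = l by case: (n) (i) (l) il => [] [] []; auto.
  by left; rewrite ni in Vn; exact: inj Vn Vi pc.
by right; rewrite nl in Vn; apply: inj Vn Vl _; rewrite psigma.
Qed.

Lemma pi1_map_inj : injective (@pi1_map R _ _ p c0).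
Proof.
move=> a b; rewrite -(pi1_classK a) -(pi1_classK b) !pi1_map_class => /pi1_classP.
move: (repr a) (repr b) => l l' [H [cH H0 H1 He]]; apply/pi1_classP.
have [] := @lift_homotopy R _ _ _ p hp l l' H.
- exact: cts_fun.
- exact: cts_fun.
- by rewrite !path_zero.
- exact: cH.
- by move=> t; rewrite H0.
- by move=> t; rewrite H1.
- by move=> s; rewrite path_zero; case: (He s).
- by move=> s; rewrite path_one; case: (He s).
move=> L [cL L0 L1 Lz Lo]; exists L; split=> // s.
by rewrite Lz Lo path_zero path_one.
Qed.

(** The lift of the meridian ends at [sigma c0], whereas a loop of the cover ends at
[c0], and the end point of a lift is invariant under homotopy. *)
Lemma meridian_notin_image (a : pi1 R c0) : pi1_map p a <> pi1_class m.
Proof.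
rewrite -(pi1_classK a) pi1_map_class => /pi1_classP.
move: (repr a) => l [H [cH H0 H1 He]].
have [] := @lift_homotopy R _ _ _ p hp l mt H.
- exact: cts_fun.
- exact: cts_fun.
- by rewrite !path_zero.
- exact: cH.
- by move=> t; rewrite H0.
- by move=> t; rewrite H1 hmt.
- by move=> s; rewrite path_zero; case: (He s).
- by move=> s; rewrite path_one; case: (He s).
move=> L [cL L0 L1 Lz Lo]; apply: sigma_base.
by rewrite -(@path_one _ _ _ _ mt) -L1 Lo path_one.
Qed.

(** The lift of a loop ends at [c0] or at [sigma c0]; in the second case it is closed
up by the lift of the meridian run backwards. *)
Lemma image_or_meridian_coset (g : pi1 R (p c0)) :
  exists a, g = pi1_map p a \/ g = (pi1_map p a * pi1_class m)%g.
Proof.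
rewrite -(pi1_classK g); move: (repr g) => f.
have [h [ch ph h0]] := @lift_path R _ _ _ p hp f c0 (@cts_fun _ _ f) (esym (@path_zero _ _ _ _ f)).
have [h1|h1] : h one = c0 \/ h one = sigma c0.
  by apply: fibre_base; rewrite ph path_one.
  exists (pi1_class (mk_path ch h0 h1)); left; rewrite pi1_map_class.
  by congr pi1_class; apply/path_eqP => t; rewrite /Defs.path_map /mk_path /= ph.
exists (pi1_class (pcat (mk_path ch h0 h1) (Defs.prev mt))); right.
rewrite pi1_map_class.
have -> : Defs.path_map p (pcat (mk_path ch h0 h1) (Defs.prev mt)) = pcat f (Defs.prev m).
  apply/path_eqP => t.
  change (p (pcat_fun h (prev_fun mt) t) = pcat_fun f (prev_fun m) t).
  by rewrite /pcat_fun /prev_fun; case: ifP => _; rewrite ?ph ?hmt.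
by rewrite pi1_class_cat pi1_class_rev -[RHS]mulgA mulVg mulg1.
Qed.

Lemma cover_tauE (a : pi1 R c0) :
  pi1_map p (cover_tau mt a) = (pi1_class m * pi1_map p a * (pi1_class m)^-1)%g.
Proof.
rewrite /cover_tau pi1_map_class.
have -> : Defs.path_map p (pcat (pcat mt (Defs.path_map sigma (repr a))) (Defs.prev mt)) =
          pcat (pcat m (Defs.path_map p (repr a))) (Defs.prev m).
  apply/path_eqP => t.
  change (p (pcat_fun (pcat_fun mt (sigma \o repr a)) (prev_fun mt) t) =
          pcat_fun (pcat_fun m (p \o repr a)) (prev_fun m) t).
  rewrite /pcat_fun /prev_fun; case: ifP => _; last by rewrite hmt.
  by case: ifP => _; rewrite /= ?psigma ?hmt.
by rewrite !pi1_class_cat pi1_class_rev.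
Qed.

Lemma base_path_connected (y : E) : inhabited {path I from (p c0) to y}.
Proof.
have [_ /(_ y) [U [oU Uy [V [_ _ _ hV]]]]] := hp.
have [[_ _ /(_ y Uy) [c _ <-]] _] := hV true.
by have [l] := hC2 c0 c; split; exact: (Defs.path_map p l).
Qed.

End TwoSheets.

(** * The holonomy of a morphism on the fundamental group *)
Section PathHolonomy.
Variables (R : realType) (X : topologicalType) (b : X) (G : groupType).
Local Notation I := (uI R).
Variable d : forall x : X, {path I from b to x}.
Variable phi : pi1 R b -> G.
Hypothesis phiM : forall a a', phi (a * a')%g = (phi a * phi a')%g.

(** Paths are closed up to loops by chosen paths from the base point. *)
Definition based x y (l : {path I from x to y}) : pi1 R b :=
  pi1_class (pcat (pcat (d x) l) (Defs.prev (d y))).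

Lemma based_homotopic x y (l l' : {path I from x to y}) :
  homotopic l l' -> based l = based l'.
Proof.
move=> h; apply/pi1_classP; apply: homotopic_cat; last exact: homotopic_refl.
by apply: homotopic_cat => //; exact: homotopic_refl.
Qed.

Lemma based_cat x y z (l : {path I from x to y}) (l' : {path I from y to z}) :
  based (pcat l l') = (based l * based l')%g.
Proof.
rewrite /based -[RHS]pi1_class_cat; apply/pi1_classP.
set D := Defs.prev (d z); set B := Defs.prev (d y); set A := pcat (d x) l.
apply: homotopic_sym.
apply: homotopic_trans (homotopic_sym (pcatA A B (pcat (pcat (d y) l') D))) _.
apply: (@homotopic_trans _ _ _ _ _ (pcat A (pcat l' D))).
  apply: homotopic_cat; first exact: homotopic_refl.
  apply: (@homotopic_trans _ _ _ _ _ (pcat B (pcat (d y) (pcat l' D)))).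
    by apply: homotopic_cat; [exact: homotopic_refl|exact/homotopic_sym/pcatA].
  apply: homotopic_trans (pcatA _ _ _) _.
  apply: homotopic_trans (pcat1p _).
  by apply: homotopic_cat; [exact: pcatVp|exact: homotopic_refl].
apply: homotopic_trans (pcatA _ _ _) _.
by apply: homotopic_cat; [exact/homotopic_sym/pcatA|exact: homotopic_refl].
Qed.

Definition path_hol (f : I -> X) : G :=
  if pselect (continuous f) is left cf then
    phi (based (mk_path cf (erefl (f zero)) (erefl (f one))))
  else 1%g.

Lemma path_holE (f : I -> X) (cf : continuous f) x y (hx : f zero = x) (hy : f one = y) :
  path_hol f = phi (based (mk_path cf hx hy)).
Proof.
case: _ / hx; case: _ / hy; rewrite /path_hol; case: pselect => // cf'.
by rewrite (Prop_irrelevance cf cf').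
Qed.

Lemma path_hol_path x y (l : {path I from x to y}) : path_hol l = phi (based l).
Proof.
rewrite (@path_holE l (@cts_fun _ _ l) x y (@path_zero _ _ _ _ l) (@path_one _ _ _ _ l)).
by congr (phi (based _)); apply/path_eqP.
Qed.

Lemma path_hol_holonomy : holonomy path_hol.
Proof.
split=> [f g cf cg fg|H cH Hz Ho].
  rewrite (path_holE cf erefl fg) (path_holE cg erefl erefl) -phiM -based_cat.
  by rewrite -path_hol_path.
have cr (s : I) : continuous (fun t => H (s, t)).
  apply: (Defs.compose_continuous (g := H)) (cH).
  by apply: pair_continuous; [exact: cst_continuous|move=> ?; exact: cvg_id].
rewrite (path_holE (cr zero) erefl erefl) (path_holE (cr one) (Hz one) (Ho one)).
congr phi; apply: based_homotopic; exists H; split=> // s.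
Qed.

Lemma path_hol_loop (l : {path I from b to b}) :
  path_hol l = (phi (pi1_class (d b)) * phi (pi1_class l) * (phi (pi1_class (d b)))^-1)%g.
Proof.
have phi1 : phi 1%g = 1%g.
  have := phiM 1%g 1%g; rewrite mulg1 => /(congr1 (fun g => (phi 1%g)^-1 * g)%g).
  by rewrite mulKg mulVg.
have phiV a : phi (a^-1)%g = ((phi a)^-1)%g.
  by rewrite -[RHS]mulg1 -phi1 -(mulgV a) phiM mulKg.
by rewrite path_hol_path /based !pi1_class_cat pi1_class_rev !phiM phiV.
Qed.

(** The choice of the paths only conjugates the holonomy of a loop at the base point. *)
Lemma path_hol_loop1 (l : {path I from b to b}) :
  path_hol l = 1%g <-> phi (pi1_class l) = 1%g.
Proof.
rewrite path_hol_loop; split=> [h|->]; last by rewrite mulg1 mulgV.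
move: h => /(congr1 (fun g => (phi (pi1_class (d b)))^-1 * g * phi (pi1_class (d b)))%g).
by rewrite !mulgA mulgVK mulVg mul1g mulg1 mulVg.
Qed.

End PathHolonomy.

(** * Holonomies on a union of two contractible charts *)
Section Charts.
Variables (R : realType) (X : topologicalType) (G : groupType).
Local Notation I := (uI R).
Variable chi : (I -> X) -> G.
Hypothesis hchi : holonomy chi.
Local Open Scope group_scope.

(** A deformation of [U] to [n] within the whole space; only its compositions with
paths in [U] have to be continuous. *)
Definition contraction (U : set X) (n : X) (c : X -> I -> X) : Prop :=
  [/\ forall x, U x -> c x zero = x, forall x, U x -> c x one = n &
      forall f : I -> X, continuous f -> (forall t, U (f t)) ->
        continuous (fun q : I * I => c (f q.1) q.2)].

(** In the square swept by the path under the deformation, the edge opposite to the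
path is constant. *)
Lemma contraction_exact U n c (f : I -> X) : contraction U n c ->
  continuous f -> (forall t, U (f t)) ->
  chi f = chi (c (f zero)) * (chi (c (f one)))^-1.
Proof.
move=> [c0 c1 cc] cf Uf.
have := hol_square hchi (cc f cf Uf) => /=.
have -> : (fun s => c (f s) one) = fun=> n by apply/funext => s; exact: c1.
have -> : (fun s => c (f s) zero) = f by apply/funext => s; exact: c0.
by rewrite (hol_cst hchi) mulg1 => ->; rewrite mulgK.
Qed.

Variables (U V : set X) (n m : X) (c d : X -> I -> X).
Hypotheses (oU : open U) (oV : open V) (UV : forall x, U x \/ V x).
Hypotheses (hc : contraction U n c) (hd : contraction V m d).

(** The cocycle comparing the trivialisations over the two charts. *)
Definition transition x := (chi (c x))^-1 * chi (d x).

Lemma transition_path (f : I -> X) : continuous f -> (forall t, U (f t)) ->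
  (forall t, V (f t)) -> transition (f zero) = transition (f one).
Proof.
move=> cf Uf Vf; rewrite /transition; have := contraction_exact hd cf Vf.
rewrite (contraction_exact hc cf Uf) => h.
have -> : chi (d (f zero)) = chi (c (f zero)) / chi (c (f one)) * chi (d (f one)).
  by rewrite h mulgVK.
by rewrite !mulgA mulVg mul1g.
Qed.

(** If the comparison is one constant on the overlap, even when the overlap is
disconnected, correcting the second trivialisation by it gives a global one. *)
Lemma two_charts k : (forall x, U x -> V x -> transition x = k) ->
  forall f g : I -> X, continuous f -> continuous g ->
    f zero = g zero -> f one = g one -> chi f = chi g.
Proof.
move=> hk.
pose sigma x := if pselect (U x) then chi (c x) else chi (d x) * k^-1.
suff ex : forall f : I -> X, continuous f ->
    chi f = sigma (f zero) * (sigma (f one))^-1.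
  by move=> f g cf cg e0 e1; rewrite !ex // e0 e1.
have sV x : V x -> sigma x = chi (d x) * k^-1.
  move=> Vx; rewrite /sigma; case: pselect => // Ux.
  by rewrite -(hk x Ux Vx) /transition invgM invgK mulgA mulgV mul1g.
have sU x : U x -> sigma x = chi (c x) by rewrite /sigma; case: pselect.
apply: (locally_exact hchi) => x; have [Ux|Vx] := UV x.
  by exists U; split=> // f cf Uf; rewrite !sU // (contraction_exact hc).
exists V; split=> // f cf Vf; rewrite !sV // (contraction_exact hd) //.
by rewrite invgM invgK mulgA mulgVK.
Qed.

End Charts.

(** * Holonomies on a product *)
Section FibreBundleHolonomy.
Variables (R : realType) (A B : topologicalType) (G : groupType).
Local Notation I := (uI R).
Variable chi : (I -> A * B) -> G.
Hypothesis hchi : holonomy chi.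
Local Open Scope group_scope.

Variables (e : B) (w : B -> I -> B).
Hypotheses (cw : forall x, continuous (w x)) (w0 : forall x, w x zero = x)
  (w1 : forall x, w x one = e).
Hypothesis fibre_exact : forall a (f g : I -> B), continuous f -> continuous g ->
  f zero = g zero -> f one = g one ->
  chi (fun t => (a, f t)) = chi (fun t => (a, g t)).

(** The path is homotopic to a path in a fibre followed by a horizontal path; sliding
the latter along [w] moves it to the level [e], and fibre paths with the same end
points have the same holonomy. *)
Lemma product_holonomy_formula (f : I -> A) (g : I -> B) : continuous f -> continuous g ->
  chi (fun t => (f t, g t)) =
    chi (fun t => (f zero, w (g zero) t)) * chi (fun t => (f t, e)) *
    (chi (fun t => (f one, w (g one) t)))^-1.
Proof.
move=> cf cg.
have sq (h : I -> B) : continuous h ->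
    chi (fun t => (f zero, h t)) * chi (fun t => (f t, h one)) =
    chi (fun t => (f t, h zero)) * chi (fun t => (f one, h t)).
  move=> ch; apply: (hol_square hchi (K := fun q : I * I => (f q.1, h q.2))).
  apply: pair_continuous.
    exact: (Defs.compose_continuous (@fst_continuous _ _) cf).
  exact: (Defs.compose_continuous (@snd_continuous _ _) ch).
have -> : chi (fun t => (f t, g t)) =
    chi (fun t => (f zero, g t)) * chi (fun t => (f t, g one)).
  pose F (u : R * R) := (f (clamp u.1), g (clamp u.2)).
  have cF : continuous F.
    apply: pair_continuous.
      exact: (Defs.compose_continuous (clamp_comp_continuous (@fst_continuous _ _)) cf).
    exact: (Defs.compose_continuous (clamp_comp_continuous (@snd_continuous _ _)) cg).
  have := hol_seg hchi (0, 0)%R (0, 1)%R (1, 1)%R cF.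
  rewrite /F /seg /=.
  have E (h : R -> A * B) : (fun t : I => h (0 + ival t * (1 - 0))%R) = (fun t : I => h (ival t)).
    by apply/funext => t; rewrite subr0 mulr1 add0r.
  have E0 (h : R -> R -> A * B) (r : R) : (fun t : I => h (r + ival t * (r - r))%R (0 + ival t * (1 - 0))%R) = (fun t : I => h r (ival t)).
    by apply/funext => t; rewrite subrr mulr0 addr0 subr0 mulr1 add0r.
  have E1 (h : R -> R -> A * B) (r : R) : (fun t : I => h (0 + ival t * (1 - 0))%R (r + ival t * (r - r))%R) = (fun t : I => h (ival t) r).
    by apply/funext => t; rewrite subrr mulr0 addr0 subr0 mulr1 add0r.
  rewrite (E (fun r => (f (clamp r), g (clamp r)))).
  rewrite (E0 (fun r s => (f (clamp r), g (clamp s)))).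
  rewrite (E1 (fun r s => (f (clamp r), g (clamp s)))).
  have K h : (fun t : I => h (clamp (ival t))) = h :> (I -> A * B).
    by apply/funext => t; rewrite ivalK.
  by rewrite (K (fun t => (f t, g t))) (K (fun t => (f zero, g t))) (K (fun t => (f t, g one))).
have -> : chi (fun t => (f t, g one)) = chi (fun t => (f zero, w (g one) t)) *
   chi (fun t => (f t, e)) * (chi (fun t => (f one, w (g one) t)))^-1.
  have := sq _ (@cw (g one)); rewrite w0 w1 => ->.
  by rewrite mulgK.
rewrite !mulgA; congr (_ * _ * _).
have -> : chi (fun t => (f zero, w (g zero) t)) =
    chi (pcat_fun (fun t => (f zero, g t)) (fun t => (f zero, w (g one) t))).
  have -> : pcat_fun (fun t => (f zero, g t)) (fun t => (f zero, w (g one) t)) =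
      (fun t => (f zero, pcat_fun g (w (g one)) t)).
    by apply/funext => t; rewrite /pcat_fun; case: ifP.
  apply: fibre_exact => //.
  - by apply: pcat_fun_continuous; rewrite ?w0.
  - by rewrite w0 pcat_fun_clamp mulr0 invr_ge0 ler0n.
  - rewrite w1 pcat_fun_clamp ifF; last by apply/negbTE; rewrite -ltNge; lra.
    by rewrite mulr1 clamp_ge1 ?w1 //; lra.
rewrite (hol_cat hchi) ?w0 //.
  by apply: pair_continuous => //; exact: cst_continuous.
by apply: pair_continuous => //; exact: cst_continuous.
Qed.

End FibreBundleHolonomy.

(** * Spheres *)
Section RowVectors.
Variable R : realType.

(** The topology on row vectors is that of coordinatewise convergence. *)
Lemma rV_continuous n (X : topologicalType) (f : X -> 'rV[R]_n) :
  (forall i, continuous (fun x => f x ord0 i)) -> continuous f.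
Proof.
move=> cf x A [P fP PA].
have : \forall y \near x, forall i, P ord0 i (f y ord0 i).
  by apply: filter_forall => i; apply: (cf i x); exact: fP.
apply: filterS => y Py; apply: PA => i j; rewrite (ord1 i); exact: Py.
Qed.

Lemma rV_coord_continuous n (X : topologicalType) (f : X -> 'rV[R]_n) i :
  continuous f -> continuous (fun x => f x ord0 i).
Proof.
move=> cf; apply: (Defs.compose_continuous (g := fun v : 'rV[R]_n => v ord0 i)) cf _.
exact: coord_continuous.
Qed.

Lemma real_continuous_sum n (X : topologicalType) (f : 'I_n -> X -> R) :
  (forall i, continuous (f i)) -> continuous (fun x => \sum_i f i x).
Proof.
move=> cf; elim: (index_enum _) => [|i r IH].
  by under eq_fun do rewrite big_nil; exact: cst_continuous.
by under eq_fun do rewrite big_cons; exact: real_continuousD.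
Qed.

Definition sqn n (v : 'rV[R]_n) : R := \sum_i v ord0 i ^+ 2.

Lemma sqn_ge0 n (v : 'rV[R]_n) : 0 <= sqn v.
Proof. by apply: sumr_ge0 => i _; exact: sqr_ge0. Qed.

Lemma sqn_coord n (v : 'rV[R]_n) i : v ord0 i ^+ 2 <= sqn v.
Proof.
by rewrite /sqn (bigD1 i) //= lerDl; apply: sumr_ge0 => k _; exact: sqr_ge0.
Qed.

Lemma sqn_gt0 n (v : 'rV[R]_n) i : v ord0 i != 0 -> 0 < sqn v.
Proof.
move=> v0; apply: lt_le_trans (sqn_coord v i).
by rewrite lt_def sqr_ge0 sqrf_eq0 v0.
Qed.

Lemma sqn_coord2 n (v : 'rV[R]_n) i k : i != k ->
  v ord0 i ^+ 2 + v ord0 k ^+ 2 <= sqn v.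
Proof.
move=> ik; rewrite /sqn (bigD1 i) //= (bigD1 k) 1?eq_sym //= addrA lerDl.
by apply: sumr_ge0 => l _; exact: sqr_ge0.
Qed.

Lemma sqnZ n (a : R) (v : 'rV[R]_n) : sqn (a *: v) = a ^+ 2 * sqn v.
Proof. by rewrite /sqn mulr_sumr; apply: eq_bigr => i _; rewrite mxE exprMn. Qed.

Lemma sqn_continuous n (X : topologicalType) (f : X -> 'rV[R]_n) :
  continuous f -> continuous (fun x => sqn (f x)).
Proof.
move=> cf; apply: real_continuous_sum => i.
by apply: real_continuousM; exact: rV_coord_continuous.
Qed.

Definition unit_vec n (k : 'I_n) : 'rV[R]_n := delta_mx ord0 k.

Lemma unit_vecE n (k i : 'I_n) : unit_vec k ord0 i = (i == k)%:R.
Proof. by rewrite mxE eqxx. Qed.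

Lemma sqn_unit n (k : 'I_n) : sqn (unit_vec k) = 1.
Proof.
rewrite /sqn (bigD1 k) //= unit_vecE eqxx expr1n big1 ?addr0 // => i /negbTE ik.
by rewrite unit_vecE ik expr0n.
Qed.

Lemma sqn_comb n (v : 'rV[R]_n) k (a b : R) :
  sqn (a *: v + b *: unit_vec k) = a ^+ 2 * sqn v + 2 * a * b * v ord0 k + b ^+ 2.
Proof.
transitivity (\sum_i (a ^+ 2 * v ord0 i ^+ 2 +
   (2 * a * b * v ord0 i + b ^+ 2) * (i == k)%:R)).
  apply: eq_bigr => i _; rewrite !mxE eqxx /=.
  by case: (i == k) => /=; rewrite ?mulr1 ?mulr0; ring.
rewrite big_split /= -mulr_sumr -addrA; congr (_ + _).
rewrite (bigD1 k) //= eqxx mulr1 big1 ?addr0 // => i /negbTE ->.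
by rewrite mulr0.
Qed.

(** Chords, radially projected, serve as paths on spheres wherever they miss the
origin. *)
Definition chord n (u v : 'rV[R]_n) (s : R) : 'rV[R]_n := (1 - s) *: u + s *: v.

Lemma chordE n (u v : 'rV[R]_n) s i :
  chord u v s ord0 i = (1 - s) * u ord0 i + s * v ord0 i.
Proof. by rewrite !mxE. Qed.

Lemma chord_continuous n (X : topologicalType) (u v : X -> 'rV[R]_n) (s : X -> R) :
  continuous u -> continuous v -> continuous s ->
  continuous (fun x => chord (u x) (v x) (s x)).
Proof.
move=> cu cv cs; apply: rV_continuous => i.
have -> : (fun x => chord (u x) (v x) (s x) ord0 i) =
    (fun x => (1 - s x) * u x ord0 i + s x * v x ord0 i).
  by apply/funext => x; rewrite chordE.
apply: real_continuousD; apply: real_continuousM; try exact: rV_coord_continuous; first last.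
  exact: cs.
by apply: real_continuousB; [exact: cst_continuous|exact: cs].
Qed.

End RowVectors.

Section SubspaceMaps.
Variables (X T : topologicalType) (A : set T).

Lemma set_type_continuous (f : X -> A) :
  continuous (fun x => \val (f x) : T) -> continuous f.
Proof. by move=> cf; exact: (@continuous_comp_initial (set_type A) X T set_val f cf). Qed.

Lemma val_continuous (f : X -> A) :
  continuous f -> continuous (fun x => \val (f x) : T).
Proof.
move=> cf; apply: (Defs.compose_continuous (g := set_val)) cf _.
exact: initial_continuous.
Qed.

End SubspaceMaps.

Section Spheres.
Variable R : realType.
Local Notation I := (uI R).

Definition vec n (x : sphere R n) : 'rV[R]_n.+1 := \val x.

Lemma vec_continuous n (X : topologicalType) (f : X -> sphere R n) :
  continuous f -> continuous (fun x => vec (f x)).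
Proof. exact: val_continuous. Qed.

Lemma sphereP n (x : sphere R n) : sqn (vec x) = 1.
Proof. by have := valP x; rewrite inE. Qed.

Lemma unit_vec_sphere n (k : 'I_n.+1) : unit_vec R k \in sphere R n.
Proof. by rewrite inE; exact: sqn_unit. Qed.

Definition basis_point n (k : 'I_n.+1) : sphere R n :=
  @exist _ (fun x => x \in sphere R n) (unit_vec R k) (unit_vec_sphere k).

(** The default value [e_0] is taken at the origin only. *)
Definition normalize n (v : 'rV[R]_n.+1) : sphere R n :=
  insubd (basis_point ord0) ((Num.sqrt (sqn v))^-1 *: v).

Lemma normalizeE n (v : 'rV[R]_n.+1) : 0 < sqn v ->
  vec (normalize v) = (Num.sqrt (sqn v))^-1 *: v.
Proof.
move=> v0; rewrite /vec /normalize val_insubd ifT // inE.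
change (sqn ((Num.sqrt (sqn v))^-1 *: v) = 1).
by rewrite sqnZ exprVn sqr_sqrtr ?sqn_ge0 // mulVf // gt_eqF.
Qed.

Lemma normalize_id n (x : sphere R n) : normalize (vec x) = x.
Proof.
by apply: val_inj; rewrite -[LHS]/(vec _) normalizeE sphereP ?ltr01 // sqrtr1 invr1 scale1r.
Qed.

Lemma normalize_continuous n (X : topologicalType) (f : X -> 'rV[R]_n.+1) :
  continuous f -> (forall x, 0 < sqn (f x)) -> continuous (fun x => normalize (f x)).
Proof.
move=> cf f0; apply: set_type_continuous; rewrite -/(vec _); apply: rV_continuous => i.
have -> : (fun x => vec (normalize (f x)) ord0 i) =
    (fun x => (Num.sqrt (sqn (f x)))^-1 * f x ord0 i).
  by apply/funext => x; rewrite normalizeE // mxE.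
have cs : continuous (fun x => Num.sqrt (sqn (f x)) : R).
  exact: (Defs.compose_continuous (sqn_continuous cf) (@sqrt_continuous R)).
apply: real_continuousM; last exact: rV_coord_continuous.
by move=> x; apply: cvgV; [rewrite sqrtr_eq0 -ltNge|exact: cs].
Qed.

(** For a sign [r], the complement of the pole [- r e_0]. *)
Definition punctured n (r : R) : set (sphere R n) := [set x | -1 < r * vec x ord0 ord0].

(** Following the chord to the pole [r e_0] contracts the complement of the opposite
pole. *)
Definition to_pole n (r : R) (x : sphere R n) (t : I) : sphere R n :=
  normalize (chord (vec x) (r *: unit_vec R ord0) (ival t)).

Lemma to_pole_sqn n r (x : sphere R n) (t : I) : r ^+ 2 = 1 -> punctured r x ->
  0 < sqn (chord (vec x) (r *: unit_vec R ord0) (ival t)).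
Proof.
move=> r1 xr; rewrite /chord scalerA sqn_comb sphereP.
have [t0 t1] := unitP t; rewrite /punctured /= in xr; set q := vec x ord0 ord0 in xr *.
have -> : (1 - ival t) ^+ 2 * 1 + 2 * (1 - ival t) * (ival t * r) * q + (ival t * r) ^+ 2
   = (1 - 2 * ival t) ^+ 2 + 2 * (ival t * (1 - ival t)) * (1 + r * q).
  by rewrite exprMn r1; ring.
have [h|h] := eqVneq (1 - 2 * ival t) 0; last first.
  apply: ltr_wpDr; last by rewrite lt_def sqr_ge0 sqrf_eq0 h.
  by apply: mulr_ge0; [apply: mulr_ge0 => //; apply: mulr_ge0; lra|lra].
have -> : ival t = 2^-1 by lra.
nra.
Qed.

Lemma punctured_open n r : open (@punctured n r).
Proof.
have c : continuous (fun x : sphere R n => r * vec x ord0 ord0).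
  apply: real_continuousM; first exact: cst_continuous.
  apply: rV_coord_continuous; apply: vec_continuous => ?; exact: cvg_id.
have -> : @punctured n r = (fun x : sphere R n => r * vec x ord0 ord0) @^-1` [set y | -1 < y].
  by [].
by apply: open_comp => //; exact: open_gt.
Qed.

Lemma to_pole_contraction n r : r ^+ 2 = 1 ->
  contraction (@punctured n r) (normalize (r *: unit_vec R ord0)) (to_pole r).
Proof.
move=> r1; split.
- by move=> x _; rewrite /to_pole ival0 /chord subr0 scale1r scale0r addr0 normalize_id.
- by move=> x _; rewrite /to_pole ival1 /chord subrr scale1r scale0r add0r.
move=> f cf Uf; apply: normalize_continuous => [|[s t]]; last exact: to_pole_sqn.
apply: chord_continuous.
- apply: vec_continuous; exact: (Defs.compose_continuous (@fst_continuous _ _) cf).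
- exact: cst_continuous.
- exact: (Defs.compose_continuous (@snd_continuous _ _) (@ival_continuous R)).
Qed.

Lemma punctured_cover n (x : sphere R n) : punctured 1 x \/ punctured (-1) x.
Proof.
by rewrite /punctured /= mul1r mulN1r; have [h|h] := ltP (-1) (vec x ord0 ord0); [left|right; lra].
Qed.

(** A point off the axis is neither of the two poles. *)
Lemma punctured_coord n r (x : sphere R n) k : r ^+ 2 = 1 -> k != ord0 ->
  vec x ord0 k != 0 -> punctured r x.
Proof.
move=> r1 k0 xk; have := sqn_coord2 (vec x) k0; rewrite sphereP /punctured /= => h.
have : 0 < vec x ord0 k ^+ 2 by rewrite lt_def sqr_ge0 sqrf_eq0 xk.
move: (vec x ord0 ord0) (vec x ord0 k ^+ 2) h => q z h z0.
have : (r * q) ^+ 2 < 1 by rewrite exprMn r1; lra.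
by move: (r * q) => w; nra.
Qed.

Lemma normalize_coord n (v : 'rV[R]_n.+1) k : v ord0 k != 0 ->
  vec (normalize v) ord0 k != 0.
Proof.
move=> vk; have v0 := sqn_gt0 vk.
by rewrite normalizeE // mxE mulf_neq0 // invr_eq0 sqrtr_eq0 -ltNge.
Qed.

Section Transition.
Variables (n : nat) (G : groupType) (chi : (I -> sphere R n) -> G).
Hypothesis hchi : holonomy chi.

Definition pole_transition := transition chi (to_pole 1) (to_pole (-1)) : sphere R n -> G.

(** A chord that avoids the axis projects to a path in the overlap of the two charts,
along which the transition is constant. *)
Lemma pole_transition_chord (x y : sphere R n) :
  (forall s, 0 <= s -> s <= 1 ->
     exists2 k, k != ord0 & chord (vec x) (vec y) s ord0 k != 0) ->
  pole_transition x = pole_transition y.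
Proof.
move=> h.
have h' (t : I) : exists2 k, k != ord0 & chord (vec x) (vec y) (ival t) ord0 k != 0.
  by have [t0 t1] := unitP t; exact: h.
pose f (t : I) := normalize (chord (vec x) (vec y) (ival t)).
have f0 : f zero = x.
  by rewrite /f ival0 /chord subr0 scale1r scale0r addr0 normalize_id.
have f1 : f one = y.
  by rewrite /f ival1 /chord subrr scale1r scale0r add0r normalize_id.
have puncturedf r : r ^+ 2 = 1 -> forall t, punctured r (f t).
  move=> r1 t; have [k k0 hk] := h' t.
  exact: (punctured_coord r1 k0 (normalize_coord hk)).
rewrite -f0 -f1; apply: (transition_path hchi).
- by apply: to_pole_contraction; rewrite expr1n.
- by apply: to_pole_contraction; rewrite sqrrN expr1n.
- apply: normalize_continuous => [|t]; last by have [k _ /sqn_gt0] := h' t.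
  apply: chord_continuous; [exact: cst_continuous|exact: cst_continuous|].
  exact: ival_continuous.
- by apply: puncturedf; rewrite expr1n.
- by apply: puncturedf; rewrite sqrrN expr1n.
Qed.

Lemma sphere_exact g :
  (forall x k, k != ord0 -> vec x ord0 k != 0 -> pole_transition x = g) ->
  forall f f' : I -> sphere R n, continuous f -> continuous f' ->
    f zero = f' zero -> f one = f' one -> chi f = chi f'.
Proof.
move=> hg.
have s1 : (1 : R) ^+ 2 = 1 by rewrite expr1n.
have s2 : (-1 : R) ^+ 2 = 1 by rewrite sqrrN expr1n.
apply: (two_charts hchi (@punctured_open n 1) (@punctured_open n (-1)) (@punctured_cover n)
  (to_pole_contraction _ s1) (to_pole_contraction _ s2) (k := g)) => x ux vx.
have [k k0 xk] : exists2 k, k != ord0 & vec x ord0 k != 0.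
  apply: contrapT => H.
  have z k : k != ord0 -> vec x ord0 k = 0.
    by move=> k0; apply/eqP/negPn/negP => xk; apply: H; exists k.
  have := sphereP x; rewrite /sqn (bigD1 ord0) //= big1 => [|k k0]; last first.
    by rewrite z // expr0n.
  by move: ux vx; rewrite /punctured /=; nra.
exact: hg xk.
Qed.

End Transition.

(** Chords lead to the north pole from everywhere but the south pole, which is left
through an equatorial point. *)
Lemma sphere_path n (x y : sphere R n.+1) : inhabited {path I from x to y}.
Proof.
have mk (u v : sphere R n.+1) :
    (forall t, 0 < sqn (chord (vec u) (vec v) (ival t))) ->
    inhabited {path I from u to v}.
  move=> h; pose f (t : I) := normalize (chord (vec u) (vec v) (ival t)).
  have cf : continuous f.
    apply: normalize_continuous => //.
    apply: chord_continuous; [exact: cst_continuous|exact: cst_continuous|].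
    exact: ival_continuous.
  have f0 : f zero = u.
    by rewrite /f ival0 /chord subr0 scale1r scale0r addr0 normalize_id.
  have f1 : f one = v.
    by rewrite /f ival1 /chord subrr scale1r scale0r add0r normalize_id.
  by split; exact: (mk_path cf f0 f1).
have cat (u v w : sphere R n.+1) : inhabited {path I from u to v} ->
    inhabited {path I from v to w} -> inhabited {path I from u to w}.
  by move=> [f] [g]; split; exact: pcat f g.
have rev (u v : sphere R n.+1) : inhabited {path I from u to v} ->
    inhabited {path I from v to u}.
  by move=> [f]; split; exact: Defs.prev f.
have pos (u : sphere R n.+1) : punctured 1 u -> inhabited {path I from u to basis_point ord0}.
  move=> hu; apply: mk => t; rewrite -[vec (basis_point ord0)]scale1r.
  by apply: to_pole_sqn; rewrite ?expr1n.
have e01 : (ord0 == ord_max :> 'I_n.+2) = false by [].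
have toN (u : sphere R n.+1) : inhabited {path I from u to basis_point ord0}.
  have [hu|hu] := ltP (-1) (vec u ord0 ord0).
    by apply: pos; rewrite /punctured /= mul1r.
  apply: (cat _ (basis_point ord_max)); last first.
    by apply: pos; rewrite /punctured /= unit_vecE e01 mulr0; lra.
  apply: mk => t.
  have [->|t1] := eqVneq (ival t) 1.
    by rewrite /chord subrr scale0r add0r scale1r sqn_unit.
  apply: (sqn_gt0 (i := ord0)); rewrite chordE unit_vecE e01.
  rewrite mulr0 addr0 mulf_neq0 ?subr_eq0 1?eq_sym //; lra.
exact: cat (toN x) (rev _ _ (toN y)).
Qed.

(** In dimension at least two the overlap of the two charts is connected: a point off
the axis is joined to [e_1] by a projected chord, after a detour through [e_max]
if only the coordinate of [e_1] is known not to vanish. *)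
Lemma sphere_simply_connected n (x : sphere R n.+2) (l : {path I from x to x}) :
  homotopic l (pconst R x).
Proof.
have d1 (y : sphere R n.+2) : exists d : {path I from x to y}, True.
  by have [d] := sphere_path x y; exists d.
pose d0 y := sval (cid (d1 y)).
pose chi := path_hol d0 (fun a : pi1 R x => a).
have hchi : holonomy chi by exact: path_hol_holonomy.
pose k1 : 'I_n.+3 := lift ord0 ord0; pose k2 : 'I_n.+3 := ord_max.
have k12 : k1 != k2 by [].
have tr (y : sphere R n.+2) i k : i != ord0 -> k != ord0 -> i != k -> vec y ord0 i != 0 ->
    pole_transition chi y = pole_transition chi (basis_point k).
  move=> i0 k0 ik yi; apply: pole_transition_chord => // s s0 s1.
  have [->|s1'] := eqVneq s 1.
    by exists k => //; rewrite chordE unit_vecE eqxx subrr mul0r add0r mul1r oner_eq0.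
  exists i => //; rewrite chordE unit_vecE (negbTE ik) mulr0 addr0.
  by rewrite mulf_neq0 // subr_eq0 eq_sym.
have e21 : pole_transition chi (basis_point k2) = pole_transition chi (basis_point k1).
  by apply: (tr _ k2 k1) => //; rewrite /= unit_vecE eqxx oner_eq0.
have /(_ l (fun=> x) (@cts_fun _ _ l) (@cst_continuous _ _ _)) h :
    forall f f' : I -> sphere R n.+2, continuous f -> continuous f' ->
    f zero = f' zero -> f one = f' one -> chi f = chi f'.
  apply: (sphere_exact hchi (g := pole_transition chi (basis_point k1))) => y k k0 yk.
  have [k1E|kk1] := eqVneq k k1; last exact: (tr y k k1).
  have y1 : vec y ord0 k1 != 0 by rewrite -k1E.
  by rewrite (tr y k1 k2 _ _ k12 y1).
apply/pi1_classP.
have /(path_hol_loop1 d0 (phi := fun a => a)) -> // : chi l = 1%g.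
by apply: etrans (h _ _) (hol_cst hchi x); [exact: path_zero|exact: path_one].
Qed.

End Spheres.

(** * Holonomies on the circle *)
Section Circle.
Variable R : realType.
Local Notation I := (uI R).
Local Notation S1 := (sphere R 1).

Lemma sqn2 (v : 'rV[R]_2) : sqn v = v ord0 ord0 ^+ 2 + v ord0 ord_max ^+ 2.
Proof.
rewrite /sqn big_ord_recl big_ord_recl big_ord0 addr0; congr (_ + _ ^+ 2).
by congr (v ord0 _); apply: val_inj.
Qed.

Lemma circle_path0 (t : R) : circle_path t ord0 ord0 = cos (2 * pi * t).
Proof. by rewrite mxE eqxx. Qed.

Lemma circle_path1 (t : R) : circle_path t ord0 ord_max = sin (2 * pi * t).
Proof. by rewrite mxE. Qed.

Lemma sqn_circle (t : R) : sqn (circle_path t) = 1.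
Proof. by rewrite sqn2 circle_path0 circle_path1 cos2Dsin2. Qed.

Definition circle_loop (t : I) : S1 := normalize (circle_path (ival t)).

Lemma vec_circle_loop t : vec (circle_loop t) = circle_path (ival t).
Proof. by rewrite normalizeE sqn_circle ?ltr01 // sqrtr1 invr1 scale1r. Qed.

Lemma circle_path_continuous : continuous (@circle_path R).
Proof.
have cm : continuous (fun t : R => 2 * pi * t).
  by apply: real_continuousM; [exact: cst_continuous|move=> ?; exact: cvg_id].
apply: rV_continuous => i.
have [->|i0] := eqVneq i ord0.
  under eq_fun do rewrite circle_path0.
  exact: (Defs.compose_continuous cm (@continuous_cos R)).
have -> : i = ord_max by apply: val_inj; case: i i0 => -[|[]].
under eq_fun do rewrite circle_path1.
exact: (Defs.compose_continuous cm (@continuous_sin R)).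
Qed.

Lemma circle_loop_continuous : continuous circle_loop.
Proof.
apply: normalize_continuous => [|t]; last by rewrite sqn_circle.
exact: (Defs.compose_continuous (@ival_continuous R) circle_path_continuous).
Qed.

Let pi_mono (s t : R) : s <= t -> 2 * pi * s <= 2 * pi * t.
Proof. by move=> st; rewrite ler_wpM2l // mulr_ge0 // pi_ge0. Qed.

Lemma cos_turn_right (t : R) : - 4^-1 <= t -> t <= 4^-1 -> 0 <= cos (2 * pi * t).
Proof.
by move=> /pi_mono h /pi_mono h'; apply: cos_ge0_pihalf; apply/andP; split; lra.
Qed.

Lemma cos_turn_left (t : R) : 4^-1 <= t -> t <= 3 / 4 -> 0 <= -1 * cos (2 * pi * t).
Proof.
move=> h h'; rewrite mulN1r -cosDpi.
have -> : 2 * pi * t + pi = 2 * pi * (t - 2^-1) + pi *+ 2.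
  by rewrite mulr2n; field.
by rewrite cosD2pi; apply: cos_turn_right; lra.
Qed.

Lemma cos_turn_end (t : R) : 3 / 4 <= t -> t <= 1 -> 0 <= cos (2 * pi * t).
Proof.
move=> h h'; have -> : 2 * pi * t = 2 * pi * (t - 1) + pi *+ 2.
  by rewrite mulr2n; ring.
by rewrite cosD2pi; apply: cos_turn_right; lra.
Qed.

Let conv_bounds (a b : R) (t : I) : a <= b ->
  a <= a + ival t * (b - a) /\ a + ival t * (b - a) <= b.
Proof.
move=> ab; have [t0 t1] := unitP t.
have h0 : 0 <= ival t * (b - a) by apply: mulr_ge0 => //; lra.
have h1 : ival t * (b - a) <= b - a by rewrite ler_piMl //; lra.
by split; lra.
Qed.

Variables (G : groupType) (chi : (I -> S1) -> G).
Hypothesis hchi : holonomy chi.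
Hypothesis chi_circle : chi circle_loop = 1%g.

Lemma to_pole_cst (r : R) x : vec x = r *: unit_vec R ord0 ->
  chi (to_pole r x) = 1%g.
Proof.
move=> xE; have -> : to_pole r x = fun=> x; last exact: hol_cst.
apply/funext => t; rewrite /to_pole -xE /chord -scalerDl subrK scale1r.
exact: normalize_id.
Qed.

Definition circle_point (a : R) : S1 := circle_loop (clamp a).

Lemma vec_circle_point a : 0 <= a -> a <= 1 -> vec (circle_point a) = circle_path a.
Proof. by move=> a0 a1; rewrite vec_circle_loop clampK ?a0. Qed.

Lemma circle_point0 : vec (circle_point 0) = 1 *: unit_vec R ord0.
Proof.
rewrite vec_circle_point ?ler01 // scale1r; apply/rowP => j.
by rewrite !mxE mulr0 cos0 sin0 eqxx /=; case: eqP.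
Qed.

Lemma circle_point1 : vec (circle_point 1) = 1 *: unit_vec R ord0.
Proof.
rewrite vec_circle_point ?ler01 // scale1r; apply/rowP => j; rewrite !mxE mulr1.
by rewrite mulr_natl cos2pi sin2pi eqxx /=; case: eqP.
Qed.

Lemma circle_point_half : vec (circle_point 2^-1) = (-1) *: unit_vec R ord0.
Proof.
rewrite vec_circle_point; [|lra|lra]; apply/rowP => j; rewrite !mxE.
have -> : 2 * pi * 2^-1 = pi :> R by field.
by rewrite cospi sinpi eqxx /=; case: eqP; rewrite ?mulr1 ?mulr0.
Qed.

Lemma circle_point_quarter : vec (circle_point 4^-1) = unit_vec R ord_max.
Proof.
rewrite vec_circle_point; [|lra|lra]; apply/rowP => j; rewrite !mxE.
have -> : 2 * pi * 4^-1 = pi / 2 :> R by field.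
rewrite cos_pihalf sin_pihalf eqxx /=; have [->//|j0] := eqVneq j ord0.
by have -> : j = ord_max by apply: val_inj; case: j j0 => -[|[]].
Qed.

Lemma circle_point_3quarter : vec (circle_point (3 / 4)) = - unit_vec R ord_max.
Proof.
rewrite vec_circle_point; [|lra|lra]; apply/rowP => j; rewrite !mxE.
have -> : 2 * pi * (3 / 4) = pi / 2 + pi :> R by field.
rewrite cosDpi sinDpi cos_pihalf sin_pihalf eqxx /=; have [->|j0] := eqVneq j ord0.
  by rewrite oppr0.
by have -> : j = ord_max by apply: val_inj; case: j j0 => -[|[]].
Qed.

(** An arc that stays away from the pole [- r e_0] is measured in the chart of the
other pole. *)
Lemma hol_arc r a b : r ^+ 2 = 1 -> 0 <= a -> a <= b -> b <= 1 ->
  (forall t, a <= t -> t <= b -> 0 <= r * cos (2 * pi * t)) ->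
  chi (subpath circle_loop a b) =
    (chi (to_pole r (circle_point a)) * (chi (to_pole r (circle_point b)))^-1)%g.
Proof.
move=> r1 a0 ab b1 hr.
rewrite (contraction_exact hchi (to_pole_contraction _ r1)).
- by rewrite subpath_zero subpath_one.
- by apply: subpath_continuous; exact: circle_loop_continuous.
move=> t; have [h0 h1] := conv_bounds t ab.
have h : -1 < r * vec (circle_point (a + ival t * (b - a))) ord0 ord0; last by exact: h.
rewrite vec_circle_point; [|lra|lra].
by rewrite circle_path0; apply: lt_le_trans (hr _ h0 h1); lra.
Qed.

Let quarter_turns (s01 s12 s23 s34 u0 u1 u3 u4 v1 v2 v3 : G) :
  (s01 = u0 * u1^-1)%g -> (s12 = v1 * v2^-1)%g ->
  (s23 = v2 * v3^-1)%g -> (s34 = u3 * u4^-1)%g ->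
  u0 = 1%g -> v2 = 1%g -> u4 = 1%g -> (s01 * s12 * (s23 * s34) = 1)%g ->
  (u1^-1 * v1 = u3^-1 * v3)%g.
Proof.
move=> -> -> -> -> -> -> ->; rewrite !invg1 !mul1g !mulg1 => h.
have -> : (u1^-1 * v1 = (v3^-1 * u3)^-1)%g by rewrite -[RHS]mul1g -h mulgK.
by rewrite invgM invgK.
Qed.

(** Each quarter of the circle lies in one of the two charts, and the two half-turns
compute the transition on the two components of the overlap.  Their
values coincide because the whole circle has trivial holonomy. *)
Lemma pole_transition_circle :
  pole_transition chi (circle_point 4^-1) = pole_transition chi (circle_point (3 / 4)).
Proof.
have s1 : (1 : R) ^+ 2 = 1 by rewrite expr1n.
have s2 : (-1 : R) ^+ 2 = 1 by rewrite sqrrN expr1n.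
have add a b c := hol_subpath hchi a b c circle_loop_continuous.
have tot : (chi (subpath circle_loop 0 4^-1) * chi (subpath circle_loop 4^-1 2^-1) *
    (chi (subpath circle_loop 2^-1 (3 / 4)) * chi (subpath circle_loop (3 / 4) 1)) = 1)%g.
  apply: etrans (etrans (congr1 chi (subpath01 circle_loop)) chi_circle).
  apply: etrans (esym (add 0 2^-1 1)).
  exact: esym (congr2 (fun x y => x * y)%g (add 0 4^-1 2^-1) (add 2^-1 (3 / 4) 1)).
apply: (quarter_turns _ _ _ _ (to_pole_cst circle_point0) (to_pole_cst circle_point_half)
  (to_pole_cst circle_point1) tot); apply: hol_arc => //; try lra; move=> t ? ?.
- by rewrite mul1r; apply: cos_turn_right; lra.
- by apply: cos_turn_left; lra.
- by apply: cos_turn_left; lra.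
- by rewrite mul1r; apply: cos_turn_end; lra.
Qed.

(** The holonomy of the loop run once around is the only obstruction, which is the
surjectivity half of the computation of the fundamental group of the circle. *)
Lemma circle_exact (f g : I -> S1) : continuous f -> continuous g ->
  f zero = g zero -> f one = g one -> chi f = chi g.
Proof.
apply: (sphere_exact hchi (g := pole_transition chi (circle_point 4^-1))) => x k k0 xk.
have kE : k = ord_max by apply: val_inj; case: k k0 {xk} => -[|[]].
rewrite kE in xk; have m0 : (ord_max : 'I_2) != ord0 by [].
have [xp|xn] := ltP 0 (vec x ord0 ord_max).
  apply: (pole_transition_chord hchi) => s h0 h1; exists ord_max => //.
  rewrite chordE circle_point_quarter unit_vecE eqxx mulr1 gt_eqF //.
  have [->|s0] := eqVneq s 0; first by rewrite subr0 mul1r addr0.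
  by apply: ltr_wpDl; [apply: mulr_ge0; lra|rewrite lt_def s0].
rewrite pole_transition_circle.
apply: (pole_transition_chord hchi) => s h0 h1; exists ord_max => //.
have xn' : vec x ord0 ord_max < 0 by rewrite lt_neqAle xk.
rewrite chordE circle_point_3quarter mxE unit_vecE eqxx mulrN1 lt_eqF //.
have [->|s0] := eqVneq s 0; first by rewrite !subr0 mul1r.
have : 0 < s by rewrite lt_def s0.
have : (1 - s) * vec x ord0 ord_max <= 0 by apply: mulr_ge0_le0; lra.
by lra.
Qed.

End Circle.

(** * The meridian normally generates the group of a knot *)

(** Changing the trivialisation of the fibres by [eps] changes a holonomy by the
coboundary of [eps]. *)
Lemma hol_twist (R : realType) (X : topologicalType) (G : groupType)
    (chi : (uI R -> X) -> G) (eps : X -> G) : holonomy chi ->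
  holonomy (fun f => eps (f zero) * chi f * (eps (f one))^-1)%g.
Proof.
move=> hchi; split=> [f g cf cg fg|H cH Hz Ho].
- have -> : pcat_fun f g zero = f zero by rewrite pcat_fun_clamp mulr0 invr_ge0 ler0n.
  have -> : pcat_fun f g one = g one.
    rewrite pcat_fun_clamp ifF; last by apply/negbTE; rewrite -ltNge; lra.
    by rewrite mulr1 clamp_ge1 //; lra.
  by rewrite (hol_cat hchi) // fg !mulgA mulgVK.
- by rewrite (hol_homotopy hchi cH Hz Ho) (Hz one) (Ho one).
Qed.

Lemma hol_prev (R : realType) (X : topologicalType) (G : groupType)
    (chi : (uI R -> X) -> G) (f : uI R -> X) : holonomy chi -> continuous f ->
  chi (prev_fun f) = (chi f)^-1%g.
Proof.
move=> hchi cf; rewrite -[X in (chi X)^-1%g]subpath01 -(hol_subpath_rev hchi) //.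
by congr chi; apply/funext => t; rewrite /subpath /prev_fun sub0r mulrN1.
Qed.

Section Exterior.
Variable R : realType.
Local Notation I := (uI R).
Local Notation S1 := (sphere R 1).
Local Notation S3 := (sphere R 3).
Variable nu : (S1 * 'rV[R]_2)%type -> S3.
Hypotheses (cnu : continuous nu) (inu : injective nu)
  (onu : forall A, open A -> open (nu @` A)).

Local Notation E := (knot_exterior nu).

Lemma exteriorP theta z : (nu (theta, z) \in E) = (1 <= sqn z).
Proof.
apply/idP/idP; rewrite inE => h.
  rewrite leNgt; apply/negP => zlt; apply: h; by exists (theta, z).
move=> [[theta' z'] hz] /inu [_ e]; move: h; rewrite -e leNgt => /negP; apply.
exact: hz.
Qed.

(** The closed tube is a continuous image of the compact space [S^1 x D^2], so that
its complement is an open part of the exterior, which with the open tube covers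
the sphere. *)
Lemma closed_tube_closed : closed (nu @` [set q | sqn q.2 <= 1]).
Proof.
have cS1 : compact [set: S1].
  have cc : compact (S1 : set 'rV[R]_2).
    have cs : continuous (fun v : 'rV[R]_2 => sqn v).
      by apply: sqn_continuous => v; exact: cvg_id.
    have box : compact [set v : 'rV[R]_2 | forall i, (fun=> `[(-1 : R), 1]%classic) i (v ord0 i)].
      by apply: (@rV_compact R 2 (fun=> `[(-1 : R), 1]%classic)) => _; exact: segment_compact.
    apply: (subclosed_compact _ box) => [|v hv i /=].
      have -> : (S1 : set 'rV[R]_2) = (fun v => sqn v) @^-1` [set r | r = 1] by [].
      by apply: closed_comp => //; exact: closed_eq.
    have := sqn_coord v i; rewrite [sqn v]hv => h; rewrite in_itv /=.
    by apply/andP; split; nra.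
  have -> : [set: S1] = (@normalize R 1) @` (S1 : set 'rV[R]_2).
    apply/seteqP; split => // x _; exists (vec x); last exact: normalize_id.
    exact: sphereP.
  apply: continuous_compact cc; apply/subspace_sigL_continuousP.
  have -> : sigL (S1 : set 'rV[R]_2) (@normalize R 1) = id.
    by apply/funext => x; exact: normalize_id.
  by move=> x; exact: cvg_id.
have cD : compact [set z : 'rV[R]_2 | sqn z <= 1].
  have cs : continuous (fun v : 'rV[R]_2 => sqn v).
    by apply: sqn_continuous => v; exact: cvg_id.
  have box : compact [set v : 'rV[R]_2 | forall i, (fun=> `[(-1 : R), 1]%classic) i (v ord0 i)].
    by apply: (@rV_compact R 2 (fun=> `[(-1 : R), 1]%classic)) => _; exact: segment_compact.
  apply: (subclosed_compact _ box) => [|v hv i /=].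
    have -> : [set z : 'rV[R]_2 | sqn z <= 1] = (fun v => sqn v) @^-1` [set r | r <= 1] by [].
    by apply: closed_comp => //; exact: closed_le.
  have := sqn_coord v i => h; have {}h := le_trans h hv; rewrite in_itv /=.
  by apply/andP; split; nra.
have cvnu : continuous (fun q => vec (nu q)) by exact: vec_continuous.
have cl : closed ((fun q => vec (nu q)) @` ([set: S1] `*` [set z | sqn z <= 1])).
  apply: compact_closed; first exact: norm_hausdorff.
  apply: continuous_compact; last exact: compact_setX.
  exact: continuous_subspaceT.
have -> : nu @` [set q | sqn q.2 <= 1] =
    (@vec R 3) @^-1` ((fun q => vec (nu q)) @` ([set: S1] `*` [set z | sqn z <= 1])).
  apply/seteqP; split => x /=.
    by move=> [q hq <-]; exists q.
  by move=> [q [_ hq] e]; exists q => //; exact: val_inj.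
apply: closed_comp => // x _.
have : continuous (fun x : S3 => vec x) by apply: vec_continuous => ?; exact: cvg_id.
by apply.
Qed.

(** The segment from [z] to the unit circle, which stays out of the open disc when [z]
does. *)
Definition radial (z : 'rV[R]_2) (t : R) : 'rV[R]_2 := chord z (vec (normalize z : S1)) t.

Lemma radial_sqn z (t : I) : 1 <= sqn z -> 1 <= sqn (radial z (ival t)).
Proof.
move=> hz; have z0 : 0 < sqn z by lra.
have [t0 t1] := unitP t.
rewrite /radial /chord normalizeE // scalerA -scalerDl sqnZ.
set r := Num.sqrt (sqn z).
have r1 : 1 <= r by rewrite /r -[X in X <= _]sqrtr1 ler_wsqrtr.
have -> : sqn z = r ^+ 2 by rewrite /r sqr_sqrtr // ltW.
rewrite -exprMn; have -> : (1 - ival t + ival t / r) * r = (1 - ival t) * r + ival t.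
  by rewrite mulrDl mulfVK // gt_eqF //; lra.
have h : 1 <= (1 - ival t) * r + ival t by nra.
by rewrite expr2; nra.
Qed.

Variable b : E.
Variable d : forall y : E, {path I from b to y}.

(** The base point is the value taken at points of the open tube of radius one. *)
Definition to_exterior (x : S3) : E := insubd b x.

Lemma to_exteriorK x : x \in E -> \val (to_exterior x) = x.
Proof. by move=> hx; rewrite /to_exterior val_insubd hx. Qed.

Lemma to_exterior_continuous (X : topologicalType) (f : X -> S1) (g : X -> 'rV[R]_2) :
  continuous f -> continuous g -> (forall x, 1 <= sqn (g x)) ->
  continuous (fun x => to_exterior (nu (f x, g x))).
Proof.
move=> cf cg hg; apply: set_type_continuous.
have -> : (fun x => \val (to_exterior (nu (f x, g x)))) = (fun x => nu (f x, g x)).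
  by apply/funext => x; rewrite to_exteriorK // exteriorP.
exact: (Defs.compose_continuous (pair_continuous cf cg) cnu).
Qed.

Variables (G : groupType) (chi : (I -> E) -> G).
Hypothesis hchi : holonomy chi.

(** The restriction of the holonomy to the boundary torus of the exterior. *)
Definition torus_hol (f : I -> S1 * S1) : G :=
  chi (fun t => to_exterior (nu ((f t).1, vec (f t).2))).

Lemma torus_holonomy : holonomy torus_hol.
Proof.
apply: (hol_pull (j := fun q : S1 * S1 => to_exterior (nu (q.1, vec q.2))) _ hchi).
apply: to_exterior_continuous => [||q]; last by rewrite sphereP.
  exact: fst_continuous.
by apply: vec_continuous; exact: snd_continuous.
Qed.

Lemma fibre_holonomy (theta : S1) : holonomy (fun f : I -> S1 => torus_hol (fun t => (theta, f t))).
Proof.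
apply: (hol_pull (j := fun x : S1 => (theta, x)) _ torus_holonomy).
by apply: pair_continuous; [exact: cst_continuous|move=> ?; exact: cvg_id].
Qed.

Variable theta0 : S1.
Hypothesis meridian1 : torus_hol (fun t => (theta0, circle_loop t)) = 1%g.

(** All meridian circles of the boundary torus are freely homotopic. *)
Lemma meridian_hol_trivial theta : torus_hol (fun t => (theta, circle_loop t)) = 1%g.
Proof.
have [om] := sphere_path theta0 theta.
have cK : continuous (fun q : I * I => (om q.1, @circle_loop R q.2)).
  apply: pair_continuous.
    exact: (Defs.compose_continuous (@fst_continuous _ _) (@cts_fun _ _ om)).
  exact: (Defs.compose_continuous (@snd_continuous _ _) (@circle_loop_continuous R)).
have := hol_square torus_holonomy cK.
rewrite /= path_zero path_one meridian1 mul1g.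
have -> : @circle_loop R one = circle_loop zero.
  apply: val_inj; rewrite -[LHS]/(vec _) -[RHS]/(vec _) !vec_circle_loop ival0 ival1.
  by apply/rowP => j; rewrite !mxE mulr0 mulr1 mulr_natl cos2pi sin2pi cos0 sin0.
by move=> /(congr1 (fun g => (torus_hol (fun s => (om s, circle_loop zero)))^-1 * g)%g);
  rewrite mulKg mulVg.
Qed.

Let e : S1 := basis_point R ord0.

Let wP (x : S1) : exists w : {path I from x to e}, True.
Proof. by have [w] := sphere_path x e; exists w. Qed.

Let w (x : S1) : I -> S1 := sval (cid (wP x)).

(** The change of trivialisation from a point of the tube to the point of the longitude
[S^1 x {e}] in the same fibre: first to the boundary torus along a radius, then
along the torus fibre. *)
Definition tube_twist (q : S1 * 'rV[R]_2) : G :=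
  (chi (fun t => to_exterior (nu (q.1, radial q.2 (ival t)))) *
   torus_hol (fun t => (q.1, w (normalize q.2) t)))%g.

(** As meridians have trivial holonomy, the holonomy of the tube only depends on the
projection to the core; it is read off the parallel longitude [S^1 x {e}], which
lies in the exterior, and therefore makes sense for paths that meet the knot. *)
Definition tube_hol (g : I -> S1 * 'rV[R]_2) : G :=
  (tube_twist (g zero) * torus_hol (fun t => ((g t).1, e)) * (tube_twist (g one))^-1)%g.

Lemma tube_holonomy : holonomy tube_hol.
Proof.
apply: hol_twist.
apply: (hol_pull (j := fun q : S1 * 'rV[R]_2 => (q.1, e)) _ torus_holonomy).
by apply: pair_continuous; [exact: fst_continuous|exact: cst_continuous].
Qed.

(** A path in the overlap is pushed radially to the boundary torus, where the fibres
are circles of trivial holonomy. *)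
Lemma tube_compat (f : I -> E) (g : I -> S1 * 'rV[R]_2) :
  continuous f -> continuous g -> (forall t, \val (f t) = nu (g t)) ->
  chi f = tube_hol g.
Proof.
move=> cf cg fg.
have c1 : continuous (fun t => (g t).1) by exact: Defs.compose_continuous cg (@fst_continuous _ _).
have c2 : continuous (fun t => (g t).2) by exact: Defs.compose_continuous cg (@snd_continuous _ _).
have hz t : 1 <= sqn (g t).2.
  rewrite -(exteriorP (g t).1) -surjective_pairing -fg; exact: valP.
have z0 t : 0 < sqn (g t).2 by apply: lt_le_trans (hz t).
have cn : continuous (fun t => normalize (g t).2 : S1) by exact: normalize_continuous.
pose K (q : I * I) := to_exterior (nu ((g q.1).1, radial (g q.1).2 (ival q.2))).
have cK : continuous K.
  apply: to_exterior_continuous => [||q]; last exact: radial_sqn.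
    exact: (Defs.compose_continuous (@fst_continuous _ _) c1).
  apply: chord_continuous.
  - exact: (Defs.compose_continuous (@fst_continuous _ _) c2).
  - apply: vec_continuous; exact: (Defs.compose_continuous (@fst_continuous _ _) cn).
  - exact: (Defs.compose_continuous (@snd_continuous _ _) (@ival_continuous R)).
have Kf s : K (s, zero) = f s.
  apply: val_inj.
  rewrite /K /= ival0 /radial /chord subr0 scale1r scale0r addr0 -surjective_pairing.
  by rewrite to_exteriorK -fg //; exact: valP.
have Kn s : K (s, one) = to_exterior (nu ((g s).1, vec (normalize (g s).2 : S1))).
  by rewrite /K /= ival1 /radial /chord subrr scale0r scale1r add0r.
have : (chi (fun t => K (zero, t)) *
     torus_hol (fun s => ((g s).1, normalize (g s).2)) =
   chi f * chi (fun t => K (one, t)))%g.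
  exact: (hol_square_edges hchi cK (fun=> erefl) Kn Kf (fun=> erefl)).
rewrite (product_holonomy_formula torus_holonomy (e := e) (w := w)) //; first last.
- move=> a u v cu cv u0 v0.
  exact: (circle_exact (fibre_holonomy a) (meridian_hol_trivial a)).
- by move=> x; rewrite /w path_one.
- by move=> x; rewrite /w path_zero.
- by move=> x; exact: cts_fun.
move=> h; apply: (can_inj (fun x => mulgK (chi (fun t => K (one, t))) x)).
by rewrite -h /tube_hol /tube_twist invgM !mulgA mulgVK.
Qed.

(** The exterior and the full tube are the two pieces of the sphere, in which every
loop is null-homotopic. *)
Theorem exterior_hol_trivial (l : {path I from b to b}) : chi l = 1%g.
Proof.
pose Y (i : bool) : topologicalType := if i then E : topologicalType else (S1 * 'rV[R]_2)%type.
pose j (i : bool) : Y i -> S3 :=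
  match i return Y i -> S3 with true => fun y => \val y | false => nu end.
pose chis (i : bool) : (I -> Y i) -> G :=
  match i return (I -> Y i) -> G with true => chi | false => tube_hol end.
have cvl : continuous (fun t => \val (l t)) by apply: val_continuous; exact: cts_fun.
have vl0 : \val (l zero) = \val b by rewrite path_zero.
have vl1 : \val (l one) = \val b by rewrite path_one.
have [H [cH H0 H1 He]] := sphere_simply_connected (mk_path cvl vl0 vl1).
apply: (@van_kampen_holonomy R S3 bool Y j G chis _ _ _ true l H (\val b)).
- by case; [exact: hchi|exact: tube_holonomy].
- case=> [] [] f g cf cg fg.
  + by congr chi; apply/funext => t; apply: val_inj; exact: fg.
  + by apply: tube_compat.
  + by apply/esym; apply: tube_compat => // t; rewrite -fg.
  + by congr tube_hol; apply/funext => t; apply: inu; exact: fg.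
- move=> x; have [[q _ qx]|nx] := pselect ((nu @` setT) x).
    pose k (y : S3) := xget q [set q' | nu q' = y].
    have kK q' : k (nu q') = q'.
      by rewrite /k; case: xgetP => [q'' _ /inu|/(_ q') /(_ erefl)].
    exists (nu @` setT), false, k; split.
    + by apply: onu; exact: openT.
    + by exists q.
    + move=> _ [q' _ <-] A; rewrite kK nbhsE => -[B [oB Bq] BA].
      apply: (filterS (P := nu @` B)); last first.
        by apply: open_nbhs_nbhs; split; [exact: onu|exists q'].
      by move=> _ [q'' Bq'' <-]; rewrite /= kK; exact: BA.
    + by move=> _ [q' _ <-]; rewrite kK.
  have sub y : (~` (nu @` [set q | sqn q.2 <= 1])) y -> y \in E.
    rewrite inE => hy [q hq qy]; apply: hy; exists q => //.
    exact: ltW hq.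
  exists (~` (nu @` [set q | sqn q.2 <= 1])), true, to_exterior; split.
  + by apply: closed_openC; exact: closed_tube_closed.
  + by move=> [q _ qx]; apply: nx; exists q.
  + move=> y hy A [B [[B' oB' <-] By] BA].
    have hW : nbhs y (~` (nu @` [set q | sqn q.2 <= 1]) `&` B').
      apply: filterI; apply: open_nbhs_nbhs; split => //.
        by apply: closed_openC; exact: closed_tube_closed.
      by move: By; rewrite /= -[set_val _]/(\val (to_exterior y)) to_exteriorK //; exact: sub.
    apply: filterS hW => z [hz Bz]; apply: BA.
    by rewrite /= -[set_val _]/(\val (to_exterior z)) to_exteriorK //; exact: sub.
  + by move=> y hy; rewrite -[LHS]/(\val (to_exterior y)) to_exteriorK //; exact: sub.
- exact: cts_fun.
- exact: cH.
- exact: H0.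
- exact: H1.
- by move=> t; have [] := He t.
- by move=> t; have [] := He t.
Qed.

End Exterior.

(** Apply the triviality of holonomies to the projection onto the quotient of the knot
group by the normal closure of the meridian. *)
Theorem meridian_normally_generates (R : realType) (K : set (sphere R 3))
    (nu : (sphere R 1 * 'rV[R]_2)%type -> sphere R 3) (b : knot_exterior nu)
    (m : {path (uI R) from b to b}) :
  tubular_parametrization K nu ->
  (forall y : knot_exterior nu, inhabited {path (uI R) from b to y}) ->
  meridian_loop m -> forall g : pi1 R b, normal_closure [set pi1_class m] g.
Proof.
move=> [cnu inu onu _] pc [theta [y [a [c [cE mh]]]]] g.
have dP z : exists l : {path (uI R) from b to z}, True by have [l] := pc z; exists l.
pose d z := sval (cid (dP z)).
pose phi : pi1 R b -> gquot [set pi1_class m] := gproj [set pi1_class m].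
have phiM u v : phi (u * v)%g = (phi u * phi v)%g by exact: gprojM.
pose chi := path_hol d phi; have hchi : holonomy chi by exact: path_hol_holonomy.
have chim : chi m = 1%g.
  apply/(path_hol_loop1 d phiM); apply/gprojP; rewrite invg1 mulg1.
  by move=> N [_ sub]; exact: sub.
have chic : chi c = 1%g.
  have := chim; rewrite /chi path_hol_path (based_homotopic _ mh) -path_hol_path -/chi.
  rewrite -[chi _]/(chi (pcat_fun (pcat_fun a c) (prev_fun a))).
  rewrite (hol_cat hchi) ?(hol_cat hchi) ?(hol_prev hchi) //; try exact: cts_fun.
  - move=> h; have : (chi c = (chi a)^-1 * (chi a * chi c * (chi a)^-1) * chi a)%g.
      by rewrite !mulgA mulVg mul1g mulgVK.
    by rewrite h mulg1 mulVg.
  - by rewrite path_one path_zero.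
  - exact: (@cts_fun _ _ (pcat a c)).
  - exact: (@cts_fun _ _ (Defs.prev a)).
  - by rewrite -[LHS]/(pcat a c one) -[RHS]/(Defs.prev a zero) path_one path_zero.
rewrite -(pi1_classK g).
have : chi (repr g) = 1%g.
  apply: (exterior_hol_trivial cnu inu onu hchi (theta0 := theta)).
  rewrite -[RHS]chic; congr chi; apply/funext => t; apply: val_inj.
  by rewrite /= vec_circle_loop to_exteriorK ?cE // exteriorP // sqn_circle.
move=> /(path_hol_loop1 d phiM) /gprojP; by rewrite invg1 mulg1.
Qed.

(** * Two by two matrices of determinant one *)
Section Matrices2.
Variable F : fieldType.
Implicit Types A B : 'M[F]_2.

Lemma mx2P m (A B : 'M[F]_(2, m)) :
  (forall j, A ord0 j = B ord0 j) -> (forall j, A ord_max j = B ord_max j) -> A = B.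
Proof.
move=> h0 h1; apply/matrixP => i j; have [->//|i0] := eqVneq i ord0.
by have -> : i = ord_max by apply: val_inj; case: i i0 => -[|[]].
Qed.

Lemma sum2 (f : 'I_2 -> F) : \sum_i f i = f ord0 + f ord_max.
Proof.
by rewrite big_ord_recl big_ord_recl big_ord0 addr0; congr (_ + f _); apply: val_inj.
Qed.

Lemma det2 A : \det A = A ord0 ord0 * A ord_max ord_max - A ord0 ord_max * A ord_max ord0.
Proof.
have e : lift ord0 ord0 = ord_max :> 'I_2 by apply: val_inj.
have e' : lift ord_max ord0 = ord0 :> 'I_2 by apply: val_inj.
rewrite (expand_det_row _ ord0) sum2 /cofactor !det_mx11 !mxE e e' /=.
by rewrite addn0 expr0 mul1r expr1 mulN1r mulrN.
Qed.

Lemma cayley_hamilton2 A : A *m A = \tr A *: A - \det A *: 1%:M.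
Proof.
rewrite det2 /mxtrace sum2; apply: mx2P => j; rewrite !mxE sum2;
  (have [->|j0] := eqVneq j ord0; last
    have -> : j = ord_max by apply: val_inj; case: j j0 => -[|[]]);
  rewrite /= ?eqxx ?mulr1n ?mulr0n; ring.
Qed.

Lemma det1_unit A : \det A = 1 -> A \in unitmx.
Proof. by move=> dA; rewrite unitmxE dA unitr1. Qed.

Lemma det1_neq0 A (v : 'cV[F]_2) : \det A = 1 -> v != 0 -> A *m v != 0.
Proof.
move=> dA; apply: contraNneq => e.
by rewrite -[v](mulKmx (det1_unit dA)) e mulmx0.
Qed.

Lemma tracefree_sq A : \det A = 1 -> \tr A = 0 -> A *m A = - 1%:M.
Proof. by move=> dA tA; rewrite cayley_hamilton2 dA tA scale0r scale1r sub0r. Qed.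

Lemma sq_tracefree A : \det A = 1 -> A *m A = - 1%:M -> \tr A = 0.
Proof.
move=> dA; rewrite cayley_hamilton2 dA scale1r => /(canRL (subrK _)).
rewrite addNr => /eqP; rewrite scaler_eq0 => /orP[/eqP//|/eqP A0].
by move: dA; rewrite A0 det2 !mxE mul0r subr0 => /esym/eqP; rewrite oner_eq0.
Qed.

Lemma cV2_neq0 (v : 'cV[F]_2) : v != 0 -> v ord0 ord0 != 0 \/ v ord_max ord0 != 0.
Proof.
move=> v0; have [e|] := eqVneq (v ord0 ord0) 0; last by left.
right; apply: contraNneq v0 => e'; apply/eqP.
by apply: mx2P => j; rewrite (ord1 j) mxE.
Qed.

(** The matrices of determinant one that fix [v] are the transvections along [v]: they
form a line of matrices through the identity. *)
Lemma det1_fixing (v : 'cV[F]_2) : v != 0 -> exists W : 'M[F]_2,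
  forall A, \det A = 1 -> A *m v = v -> exists t, A = 1%:M + t *: W.
Proof.
move=> v0.
have e01 : (ord0 == ord_max :> 'I_2) = false by [].
have e10 : (ord_max == ord0 :> 'I_2) = false by [].
have key A : \det A = 1 -> A *m v = v ->
   [/\ A ord0 ord0 * A ord_max ord_max - A ord0 ord_max * A ord_max ord0 = 1,
       A ord0 ord0 * v ord0 ord0 + A ord0 ord_max * v ord_max ord0 = v ord0 ord0 &
       A ord_max ord0 * v ord0 ord0 + A ord_max ord_max * v ord_max ord0 = v ord_max ord0].
  move=> dA /matrixP e; split; first by rewrite -det2.
    by have := e ord0 ord0; rewrite !mxE sum2.
  by have := e ord_max ord0; rewrite !mxE sum2.
have [x0|y0] := cV2_neq0 v0.
(* [W] is [v] times the linear form with kernel spanned by [v], scaled so that one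
   off-diagonal entry is 1. *)
- pose t := v ord_max ord0 / v ord0 ord0.
  exists (\matrix_(i, j) (if i == ord0 then (if j == ord0 then - t else 1)
                        else (if j == ord0 then - t ^+ 2 else t))).
  move=> A dA Av; have [e1 e2 e3] := key A dA Av; exists (A ord0 ord_max).
  have yE : v ord_max ord0 = t * v ord0 ord0 by rewrite /t mulfVK.
  rewrite yE in e2 e3; have {}e2 : A ord0 ord0 = 1 - A ord0 ord_max * t.
    by apply: (mulIf x0); apply/eqP; rewrite mulrBl mul1r -mulrA eq_sym subr_eq e2.
  have {}e3 : A ord_max ord0 = t - A ord_max ord_max * t.
    by apply: (mulIf x0); apply/eqP; rewrite mulrBl -[A ord_max ord_max * t * _]mulrA eq_sym subr_eq e3.
  have e4 : A ord_max ord_max = 1 + A ord0 ord_max * t.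
    by rewrite -e1 e2 e3; ring.
  apply: mx2P => j; rewrite !mxE /=;
  (have [->|j0] := eqVneq j ord0; last
    have -> : j = ord_max by apply: val_inj; case: j j0 => -[|[]]);
  rewrite /= ?eqxx ?mulr1n ?mulr0n ?e01 ?e10 /= ?e2 ?e3 ?e4; ring.
- pose t := v ord0 ord0 / v ord_max ord0.
  exists (\matrix_(i, j) (if i == ord0 then (if j == ord0 then t else - t ^+ 2)
                        else (if j == ord0 then 1 else - t))).
  move=> A dA Av; have [e1 e2 e3] := key A dA Av; exists (A ord_max ord0).
  have xE : v ord0 ord0 = t * v ord_max ord0 by rewrite /t mulfVK.
  rewrite xE in e2 e3; have {}e3 : A ord_max ord_max = 1 - A ord_max ord0 * t.
    by apply: (mulIf y0); apply/eqP; rewrite mulrBl mul1r -mulrA eq_sym subr_eq addrC e3.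
  have {}e2 : A ord0 ord_max = t - A ord0 ord0 * t.
    by apply: (mulIf y0); apply/eqP; rewrite mulrBl -[A ord0 ord0 * t * _]mulrA eq_sym subr_eq addrC e2.
  have e4 : A ord0 ord0 = 1 + A ord_max ord0 * t.
    by rewrite -e1 e2 e3; ring.
  apply: mx2P => j; rewrite !mxE /=;
  (have [->|j0] := eqVneq j ord0; last
    have -> : j = ord_max by apply: val_inj; case: j j0 => -[|[]]);
  rewrite /= ?eqxx ?mulr1n ?mulr0n ?e01 ?e10 /= ?e2 ?e3 ?e4; ring.
Qed.

Lemma det1_fixing_commute A B (v : 'cV[F]_2) : v != 0 -> \det A = 1 -> \det B = 1 ->
  A *m v = v -> B *m v = v -> A *m B = B *m A.
Proof.
move=> /det1_fixing [W hW] dA dB /(hW _ dA) [s ->] /(hW _ dB) [t ->].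
rewrite !mulmxDl !mulmxDr !mul1mx !mulmx1 -!scalemxAl -!scalemxAr !scalerA.
by rewrite [s * t]mulrC addrACA [t *: W + _]addrC addrACA.
Qed.

(** A matrix is determined by its values on two independent vectors; [D] in the proof
is the determinant of the pair. *)
Lemma eigen_dependent (u v : 'cV[F]_2) : v != 0 ->
  (exists c, u = c *: v) \/
  forall A B, A *m v = B *m v -> A *m u = B *m u -> A = B.
Proof.
move=> v0.
pose D := v ord0 ord0 * u ord_max ord0 - v ord_max ord0 * u ord0 ord0.
have [D0|D0] := eqVneq D 0.
  left; move/eqP: D0; rewrite subr_eq0 => /eqP D0.
  have [x0|y0] := cV2_neq0 v0.
    exists (u ord0 ord0 / v ord0 ord0); apply: mx2P => j; rewrite (ord1 j) mxE.
      by rewrite mulfVK.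
    by apply: (mulIf x0); rewrite mulrC D0 mulrAC mulfVK // mulrC.
  exists (u ord_max ord0 / v ord_max ord0); apply: mx2P => j; rewrite (ord1 j) mxE.
    by apply: (mulIf y0); rewrite mulrC -D0 mulrAC mulfVK // mulrC.
  by rewrite mulfVK.
right=> A B /matrixP ev /matrixP eu.
have row i : A i ord0 = B i ord0 /\ A i ord_max = B i ord_max.
  have := ev i ord0; have := eu i ord0; rewrite !mxE !sum2 => e1 e2.
  split; apply: (mulIf D0); rewrite /D.
  - transitivity ((A i ord0 * v ord0 ord0 + A i ord_max * v ord_max ord0) * u ord_max ord0
      - (A i ord0 * u ord0 ord0 + A i ord_max * u ord_max ord0) * v ord_max ord0); first ring.
    by rewrite e1 e2; ring.
  - transitivity ((A i ord0 * u ord0 ord0 + A i ord_max * u ord_max ord0) * v ord0 ord0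
      - (A i ord0 * v ord0 ord0 + A i ord_max * v ord_max ord0) * u ord0 ord0); first ring.
    by rewrite e1 e2; ring.
apply/matrixP => i j; have [h0 h1] := row i; have [->//|j0] := eqVneq j ord0.
by have -> : j = ord_max by apply: val_inj; case: j j0 => -[|[]].
Qed.

Lemma eigen_commute A B (v : 'cV[F]_2) a b : A *m v = a *: v -> B *m v = b *: v ->
  (A *m B) *m v = (B *m A) *m v.
Proof.
by move=> ea eb; rewrite -!mulmxA ea eb -!scalemxAr ea eb !scalerA mulrC.
Qed.

End Matrices2.

(** * Commutators and the degree *)
Section SubgroupFacts.
Variable G : groupType.
Local Open Scope group_scope.
Implicit Types H : set G.

Lemma subgroupV H x : is_subgroup H -> H x -> H x^-1.
Proof. by move=> [H1 HD] Hx; have := HD _ _ H1 Hx; rewrite mul1g. Qed.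

Lemma subgroupM H x y : is_subgroup H -> H x -> H y -> H (x * y).
Proof.
by move=> sH Hx /(subgroupV sH) Hy; have := sH.2 _ _ Hx Hy; rewrite invgK.
Qed.

Lemma subgroupX H x n : is_subgroup H -> H x -> H (x ^+ n).
Proof.
move=> sH Hx; elim: n => [|n IH]; first by rewrite expg0; case: sH.
by rewrite expgS; exact: subgroupM.
Qed.

Lemma commutator_subgroupP : is_subgroup (@commutator_subgroup G).
Proof.
split=> [H [[H1 _] _]|x y cx cy H sH]; first exact: H1.
by apply: (sH.1).2; [exact: cx|exact: cy].
Qed.

Lemma commutator_mem (x y : G) : commutator_subgroup [~ x, y].
Proof. by move=> H [_ sub]; apply: sub; exists x => //; exists y. Qed.

Lemma commutator_conj (x y : G) : commutator_subgroup x -> commutator_subgroup (x ^ y).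
Proof.
move=> cx; have -> : x ^ y = x * [~ x, y] by rewrite /commg mulVKg.
exact: subgroupM commutator_subgroupP cx (commutator_mem x y).
Qed.

(** The class [n] of [g] in the infinite cyclic homology is that of [mu^n], so that
[g] and [mu^n] differ by an element of the commutator subgroup.  The sign of [n]
is split off because exponents are natural numbers. *)
Lemma homology_decomposition (mu : G) (cls : G -> int) : homology_class mu cls ->
  forall g, exists c n, [/\ commutator_subgroup c, cls g = (n%:Z)%R & g = c * mu ^+ n] \/
                 [/\ commutator_subgroup c, cls g = (- (n%:Z))%R & g = c * mu ^- n].
Proof.
move=> [clsM cls1 clsC] g.
have clsX n : cls (mu ^+ n) = (n%:Z)%R.
  elim: n => [|n IH]; last by rewrite expgS clsM cls1 IH intS.
  have := clsM 1 1; rewrite mulg1 expg0 => /eqP.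
  by rewrite -subr_eq0 opprD addNKr oppr_eq0 => /eqP.
have clsV x : cls x^-1 = (- cls x)%R.
  apply/eqP; rewrite -addr_eq0 -clsM mulVg -(expg0 mu) clsX; exact: eqxx.
have [n cn] : exists n : nat, cls g = (n%:Z)%R \/ cls g = (- (n%:Z))%R.
  by case: (cls g) => n; [exists n; left|exists n.+1; right].
case: cn => cn.
  exists (g * mu ^- n), n; left; split=> //; last by rewrite mulgVK.
  by apply/clsC; rewrite clsM clsV clsX cn subrr.
exists (g * mu ^+ n), n; right; split=> //; last by rewrite mulgK.
by apply/clsC; rewrite clsM clsX cn addNr.
Qed.

End SubgroupFacts.

(** * Extension of a representation from a subgroup of index two *)
Section IndexTwo.
Variables (A G : groupType) (p : A -> G) (mu : G) (tau : A -> A) (mu2 : A).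
Local Open Scope group_scope.
Hypotheses (pM : forall a b, p (a * b) = p a * p b) (pI : injective p)
  (ptau : forall a, p (tau a) = mu * p a * mu^-1) (pmu2 : p mu2 = mu ^+ 2)
  (pcover : forall g, exists a, g = p a \/ g = p a * mu) (pmu : forall a, p a <> mu).

Let p1 : p 1 = 1.
Proof.
have := pM 1 1; rewrite mulg1 => /(congr1 (fun g => (p 1)^-1 * g)).
by rewrite mulKg mulVg.
Qed.

Let pV a : p a^-1 = (p a)^-1.
Proof. by rewrite -[RHS]mulg1 -p1 -(mulgV a) pM mulKg. Qed.

Lemma tauM a b : tau (a * b) = tau a * tau b.
Proof. by apply: pI; rewrite pM !ptau pM !mulgA mulgVK. Qed.

Lemma tauV a : tau a^-1 = (tau a)^-1.
Proof. by apply: pI; rewrite pV !ptau pV !invgM invgK mulgA. Qed.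

Lemma tau1 : tau 1 = 1.
Proof. by apply: pI; rewrite ptau p1 mulg1 mulgV. Qed.

Lemma tau_mu2 : tau mu2 = mu2.
Proof. by apply: pI; rewrite ptau pmu2 expgS expg1 !mulgA mulgK. Qed.

(** [tau] is conjugation by [mu] on the subgroup, and [mu^2] belongs to it. *)
Lemma tau_tau a : tau (tau a) = mu2 * a * mu2^-1.
Proof. by apply: pI; rewrite !ptau !pM pV pmu2 expgS expg1 invgM !mulgA. Qed.

Lemma tau_normal_closure a :
  normal_closure [set mu2] a -> normal_closure [set mu2] (tau a).
Proof.
suff nN : is_normal_subgroup [set x | normal_closure [set mu2] (tau x)].
  move=> ca; apply: (ca _ (conj nN _)) => x ->; rewrite /= tau_mu2.
  by move=> N [_]; apply.
split; first split.
- by rewrite /= tau1; exact: ncl1.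
- by move=> x y /= hx hy; rewrite tauM tauV; exact: nclF.
- by move=> x y /= hx; rewrite /conjg !tauM tauV; exact: nclJ.
Qed.

(** The normal form of the elements of [G], in the cosets [p(A)] and [p(A) mu]. *)
Definition index2_elt (a : A) (e : bool) : G := p a * (if e then mu else 1).

Lemma index2_eltP g : exists ae : A * bool, g = index2_elt ae.1 ae.2.
Proof.
have [a [->|->]] := pcover g; first by exists (a, false); rewrite /index2_elt mulg1.
by exists (a, true).
Qed.

Lemma index2_elt_inj a e b f : index2_elt a e = index2_elt b f -> a = b /\ e = f.
Proof.
rewrite /index2_elt; case: e f => [] [] h.
- by split=> //; apply: pI; exact: mulIg h.
- by case: (@pmu (a^-1 * b)); rewrite pM pV; apply: (mulgI (p a)); rewrite mulVKg h mulg1.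
- by case: (@pmu (b^-1 * a)); rewrite pM pV; apply: (mulgI (p b)); rewrite mulVKg -h mulg1.
- by split=> //; apply: pI; exact: mulIg h.
Qed.

Lemma index2_eltM a e b f : index2_elt a e * index2_elt b f =
  index2_elt (a * (if e then tau b else b) * (if e && f then mu2 else 1)) (e (+) f).
Proof.
rewrite /index2_elt; case: e f => [] [] /=; rewrite !pM ?ptau ?pmu2 ?p1 ?mulg1 //.
- by rewrite expgS expg1 !mulgA mulgVK.
- by rewrite !mulgA mulgVK.
- by rewrite mulgA.
Qed.

Definition index2_coord g : A * bool := sval (cid (index2_eltP g)).

Lemma index2_coordK g : g = index2_elt (index2_coord g).1 (index2_coord g).2.
Proof. by rewrite /index2_coord; case: cid. Qed.

Lemma index2_coordE a e : index2_coord (index2_elt a e) = (a, e).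
Proof.
have /esym/index2_elt_inj [] := index2_coordK (index2_elt a e).
by case: index2_coord => /= ? ? -> ->.
Qed.

(** The second coordinate is the quotient map onto Z/2. *)
Lemma parityM g h :
  (index2_coord (g * h)).2 = (index2_coord g).2 (+) (index2_coord h).2.
Proof. by rewrite {1}(index2_coordK g) {1}(index2_coordK h) index2_eltM index2_coordE. Qed.

(** The quotient by the subgroup is of order two, hence abelian. *)
Lemma commutator_in_image g : commutator_subgroup g -> exists a, g = p a.
Proof.
have par1 : (index2_coord 1).2 = false.
  by have := parityM 1 1; rewrite mulg1; case: (index2_coord 1).2.
have parV x : (index2_coord x^-1).2 = (index2_coord x).2.
  have := parityM x x^-1; rewrite mulgV par1.
  by case: (index2_coord x).2; case: (index2_coord _).2.
have sP : is_subgroup [set g | (index2_coord g).2 = false].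
  split=> // x y /= hx hy; by rewrite parityM parV hx hy.
move=> /(_ _ (conj sP _)) h; exists (index2_coord g).1.
rewrite {1}(index2_coordK g) h /index2_elt ?mulg1 //.
move=> _ [x _ [y _ <-]] /=; rewrite /commg /conjg !parityM !parV.
by case: (index2_coord x).2; case: (index2_coord y).2.
Qed.

(** The parity of the degree is the quotient map onto Z/2: both kill commutators and
are odd on [mu]. *)
Lemma even_class (cls : G -> int) : homology_class mu cls ->
  forall a, exists k, (cls (p a) = k + k)%R.
Proof.
move=> hc a; have [c [n hn]] := homology_decomposition hc (p a).
have par_mu : (index2_coord mu).2 = true.
  have -> : mu = index2_elt 1 true by rewrite /index2_elt p1 mul1g.
  by rewrite index2_coordE.
have par1 : (index2_coord 1).2 = false.
  by have := parityM 1 1; rewrite mulg1; case: (index2_coord 1).2.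
have parV x : (index2_coord x^-1).2 = (index2_coord x).2.
  have := parityM x x^-1; rewrite mulgV par1.
  by case: (index2_coord x).2; case: (index2_coord _).2.
have parX m : (index2_coord (mu ^+ m)).2 = odd m.
  by elim: m => [|m IH]; rewrite ?expg0 // expgS parityM par_mu IH.
have parp b : (index2_coord (p b)).2 = false.
  have -> : p b = index2_elt b false by rewrite /index2_elt mulg1.
  by rewrite index2_coordE.
have nE : odd n = false.
  have := parp a; case: hn => -[/commutator_in_image [b ->] _ ->]; rewrite parityM parp ?parV parX //.
have n2 : n = (n./2 + n./2)%N by rewrite addnn -[LHS]odd_double_half nE.
case: hn => -[_ -> _]; first by exists (n./2%:Z)%R; rewrite {1}n2 PoszD.
by exists (- (n./2%:Z))%R; rewrite {1}n2 PoszD opprD.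
Qed.

Variables (F : fieldType) (r : A -> 'M[F]_2) (B : 'M[F]_2).
Hypotheses (rM : forall a b, r (a * b) = r a *m r b) (r1 : r 1 = 1%:M)
  (B_unit : B \in unitmx) (r_mu2 : r mu2 = B *m B)
  (r_tau : forall a, r (tau a) = B *m r a *m invmx B).

Definition index2_ext (g : G) : 'M[F]_2 :=
  r (index2_coord g).1 *m (if (index2_coord g).2 then B else 1%:M).

Lemma index2_extE a e : index2_ext (index2_elt a e) = r a *m (if e then B else 1%:M).
Proof. by rewrite /index2_ext index2_coordE. Qed.

Lemma index2_ext_p a : index2_ext (p a) = r a.
Proof. by have := index2_extE a false; rewrite /index2_elt mulg1 mulmx1. Qed.

Lemma index2_ext_mu : index2_ext mu = B.
Proof. by have := index2_extE 1 true; rewrite /index2_elt p1 mul1g r1 mul1mx. Qed.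

(** The hypotheses on [B] are the relations [mu p(a) mu^-1 = p(tau a)] and
[mu^2 = p(mu2)] that present [G] over [A]. *)
Lemma index2_extM g h : index2_ext (g * h) = index2_ext g *m index2_ext h.
Proof.
rewrite (index2_coordK g) (index2_coordK h) index2_eltM !index2_extE.
case: (index2_coord g) (index2_coord h) => a [] [b []] /=;
  rewrite !rM ?r_tau ?r_mu2 ?r1 ?mulmx1 ?mulmxA //.
- by rewrite mulmxKV.
- by rewrite mulmxKV.
Qed.

End IndexTwo.

(** * Representations in SL_2 *)
Section RepresentationFacts.
Variables (R : realType) (G : groupType) (rho : G -> 'M[R[i]]_2).
Hypothesis hrho : reps rho.
Local Notation C := R[i].

Lemma rep_det g : \det (rho g) = 1. Proof. by case: hrho. Qed.

Lemma rep_mul g h : rho (g * h)%g = rho g *m rho h. Proof. by case: hrho. Qed.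

Lemma rep_one : rho 1%g = 1%:M.
Proof.
have u := det1_unit (rep_det 1%g).
by have := rep_mul 1%g 1%g; rewrite mulg1 => /(congr1 (mulmx (invmx (rho 1%g))));
  rewrite mulKmx // mulVmx.
Qed.

Lemma rep_inv g : rho g^-1%g = invmx (rho g).
Proof.
have u := det1_unit (rep_det g).
by rewrite -[RHS]mulmx1 -rep_one -(mulgV g) rep_mul mulKmx.
Qed.

Lemma rep_kernel_normal : is_normal_subgroup [set g | rho g = 1%:M].
Proof.
split; first split; first exact: rep_one.
  by move=> x y /= hx hy; rewrite rep_mul rep_inv hx hy invmx1 mulmx1.
move=> x y /= hx; rewrite /conjg !rep_mul hx rep_inv mul1mx mulVmx //.
exact: det1_unit (rep_det y).
Qed.

(** The group acts on the invariant line by scalars, and scalars commute. *)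
Lemma rep_fixes_commutators (v : 'cV[C]_2) :
  (forall g, exists c, rho g *m v = c *: v) ->
  forall g, commutator_subgroup g -> rho g *m v = v.
Proof.
move=> ev.
have sF : is_subgroup [set g | rho g *m v = v].
  split; first by rewrite /= rep_one mul1mx.
  move=> x y /= hx hy; rewrite rep_mul rep_inv -mulmxA -{1}hy mulKmx //.
  exact: det1_unit (rep_det y).
move=> g hg; apply: (hg _ (conj sF _)) => _ [x _ [y _ <-]] /=.
have -> : [~ x, y]%g = ((y * x)^-1 * (x * y))%g.
  by rewrite /commg /conjg invgM !mulgA.
rewrite rep_mul rep_inv -mulmxA; have [a ea] := ev x; have [b eb] := ev y.
have -> : rho (x * y)%g *m v = rho (y * x)%g *m v.
  by rewrite !rep_mul; exact: eigen_commute ea eb.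
by rewrite mulKmx //; exact: det1_unit (rep_det _).
Qed.

(** Commutators fix a vector spanning the invariant line, and the transvections along
a vector commute. *)
Lemma reducible_metabelian : reducible_rep rho -> metabelian_rep rho.
Proof.
move=> [v v0 ev] g h hg hh; apply: (det1_fixing_commute v0); try exact: rep_det.
  exact: rep_fixes_commutators.
exact: rep_fixes_commutators.
Qed.

Lemma rep_eigen_subgroup (v : 'cV[C]_2) : v != 0 ->
  is_subgroup [set g | exists c, rho g *m v = c *: v].
Proof.
move=> v0; split; first by exists 1; rewrite rep_one mul1mx scale1r.
move=> x y [a ea] [b eb].
have b0 : b != 0.
  by apply: contraTneq (det1_neq0 (rep_det y) v0) => b0; rewrite eb b0 scale0r eqxx.
exists (b^-1 * a); rewrite rep_mul rep_inv -mulmxA.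
have -> : invmx (rho y) *m v = b^-1 *: v.
  rewrite -[v in LHS](scalerK b0) -eb -scalemxAr mulKmx //.
  exact: det1_unit (rep_det y).
by rewrite -scalemxAr ea scalerA.
Qed.

End RepresentationFacts.

Section ImaginaryPowers.
Variable R : realType.
Local Notation i_ := ('i : R[i]).

Lemma iexpD (m n : int) : i_ ^ (m + n) = i_ ^ m * i_ ^ n.
Proof. by rewrite expfzDr // neq0Ci. Qed.

(** An even power of [i] is a sign. *)
Lemma iexp_even (k : int) : (i_ ^ (k + k)) ^+ 2 = 1.
Proof.
rewrite iexpD -expr2 -exprM -[LHS]/((i_ ^ k) ^ (4 : nat)%:Z) exprz_exp mulrC -exprz_exp.
have -> : i_ ^ (4 : nat)%:Z = 1.
  by rewrite -exprnP -[4%N]/(2 * 2)%N exprM sqrCi sqrrN expr1n.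
by rewrite exp1rz.
Qed.

End ImaginaryPowers.

(** * The correspondence between representations of the knot group and of the branched cover *)
Section BranchedCover.
Variables (R : realType) (E C2 : topologicalType).
Local Notation I := (uI R).
Local Notation C := R[i].
Variables (p : continuousType C2 E) (sigma : continuousType C2 C2) (c0 : C2).
Hypotheses (hp : covering_map bool p) (hC2 : path_connected R C2)
  (hsigma : covering_transformation p sigma)
  (sigma_neq : (sigma : C2 -> C2) <> id).
Variables (m : {path I from (p c0) to (p c0)}) (mt : {path I from c0 to (sigma c0)}).
Hypothesis hmt : forall t, p (mt t) = m t.
Variable cls : pi1 R (p c0) -> int.
Local Notation mu := (pi1_class m).
Hypothesis hcls : homology_class mu cls.
Variable mu2 : pi1 R c0.
Hypothesis hmu2 : pi1_map p mu2 = (mu ^+ 2)%g.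

Local Notation P := (@pi1_map R _ _ p c0).
Local Notation tau := (cover_tau mt).

Let pM a b : P (a * b)%g = (P a * P b)%g. Proof. exact: pi1_mapM. Qed.
Let pI : injective P. Proof. exact: (pi1_map_inj hp). Qed.
Let ptau a : P (tau a) = (mu * P a * mu^-1)%g. Proof. exact: (cover_tauE hsigma hmt). Qed.
Let pcover g : exists a, g = P a \/ g = (P a * mu)%g.
Proof. exact: (image_or_meridian_coset hp hC2 hsigma sigma_neq hmt). Qed.
Let pmu a : P a <> mu.
Proof. exact: (meridian_notin_image hp hC2 hsigma sigma_neq hmt). Qed.

Let clsM g h : cls (g * h)%g = cls g + cls h. Proof. by case: hcls. Qed.
Let cls_mu : cls mu = 1. Proof. by case: hcls. Qed.
Let clsC g : cls g = 0 <-> commutator_subgroup g. Proof. by case: hcls. Qed.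
Let cls_even a : exists k, cls (P a) = k + k.
Proof. exact: (even_class pM pI ptau hmu2 pcover pmu hcls). Qed.

Let cls_tau a : cls (P (tau a)) = cls (P a).
Proof.
rewrite ptau; have := clsM (mu * P a * mu^-1)%g mu.
by rewrite mulgVK clsM addrC => /addIr <-.
Qed.

Section Forward.
Variable rho : pi1 R (p c0) -> 'M[C]_2.
Hypothesis R0rho : tracefree_reps mu rho.

Let hrho : reps rho. Proof. by case: R0rho. Qed.
Let rho_mu : rho mu *m rho mu = - 1%:M.
Proof. by case: R0rho => _; exact: tracefree_sq (rep_det hrho mu). Qed.

Lemma Phi_cover_rep : reps (Phi_cover cls rho).
Proof.
split=> [a|a b].
  rewrite /Phi_cover detZ (rep_det hrho) mulr1.
  by have [k ->] := cls_even a; exact: iexp_even.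
rewrite /Phi_cover pM clsM iexpD (rep_mul hrho).
by rewrite -scalemxAl -scalemxAr scalerA.
Qed.

Lemma Phi_cover_mu2 : Phi_cover cls rho mu2 = 1%:M.
Proof.
rewrite /Phi_cover hmu2 expgS expg1 clsM cls_mu (rep_mul hrho) rho_mu.
by rewrite iexpD expr1z -expr2 sqrCi scaleN1r opprK.
Qed.

(** [Phi_cover cls rho] kills the normal closure of [mu2], so its value does not
depend on the representative. *)
Lemma Phi_to_branched a : Phi cls rho (to_branched mu2 a) = Phi_cover cls rho a.
Proof.
rewrite /Phi; set b := repr _.
have : normal_closure [set mu2] (b / a)%g by apply/gprojP; rewrite gprojK.
move=> h; have hr := Phi_cover_rep.
have e : Phi_cover cls rho (b / a)%g = 1%:M.
  by apply: (h _ (conj (rep_kernel_normal hr) _)) => _ ->; exact: Phi_cover_mu2.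
by rewrite -[b](mulgVK a) (rep_mul hr) e mul1mx.
Qed.

Lemma Phi_cover_tau a :
  Phi_cover cls rho (tau a) = rho mu *m Phi_cover cls rho a *m invmx (rho mu).
Proof.
rewrite /Phi_cover cls_tau ptau !(rep_mul hrho) (rep_inv hrho).
by rewrite -scalemxAr -scalemxAl.
Qed.

Lemma Phi_equivariant :
  equivariant_reps (branched_tau mt (mu2 := mu2)) (Phi cls (mu2 := mu2) rho).
Proof.
have hr := Phi_cover_rep.
split; first split.
- by move=> b; exact: (rep_det hr).
- move=> b b'; rewrite -[(b * b')%g]/(to_branched mu2 (repr b * repr b')%g).
  by rewrite Phi_to_branched (rep_mul hr).
exists (rho mu); first exact: rep_det.
by move=> b; rewrite /branched_tau Phi_to_branched Phi_cover_tau.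
Qed.

Lemma Phi_cover_commutator a : commutator_subgroup (P a) ->
  Phi_cover cls rho a = rho (P a).
Proof. by move=> /clsC e; rewrite /Phi_cover e expr0z scale1r. Qed.

Lemma commutator_image g : commutator_subgroup g -> exists a, g = P a.
Proof. exact: (commutator_in_image pM pI ptau hmu2 pcover pmu). Qed.

(** Multiplying [a] by a power of [mu2], which the representation kills, brings its
degree to zero, and the twist is trivial in degree zero. *)
Lemma Phi_cover_in_commutator a :
  exists2 g, commutator_subgroup g & Phi_cover cls rho a = rho g.
Proof.
have hr := Phi_cover_rep.
have killX n : Phi_cover cls rho (mu2 ^+ n)%g = 1%:M.
  apply: (subgroupX n (rep_kernel_normal hr).1); exact: Phi_cover_mu2.
suff [z [ez hz]] : exists z, Phi_cover cls rho z = 1%:M /\ cls (P (a * z)%g) = 0.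
  exists (P (a * z)%g); first exact/clsC.
  by rewrite -Phi_cover_commutator ?(rep_mul hr) ?ez ?mulmx1 //; exact/clsC.
have [k hk] := cls_even a.
have clsX n : cls (P (mu2 ^+ n)%g) = n%:Z + n%:Z.
  elim: n => [|n IH].
    by rewrite expg0 pi1_map1; apply/clsC; case: (@commutator_subgroupP (pi1 R (p c0))).
  rewrite expgS pM clsM IH hmu2 expgS expg1 clsM cls_mu !intS; ring.
case: k hk => n hk.
  exists (mu2 ^+ n)^-1%g; split; first by rewrite (rep_inv hr) killX invmx1.
  apply: (@addIr _ (cls (P (mu2 ^+ n)%g))).
  by rewrite -clsM -pM mulgVK add0r hk clsX.
exists (mu2 ^+ n.+1)%g; split; first exact: killX.
by rewrite pM clsM hk clsX NegzE; ring.
Qed.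

Lemma Phi_abelian : abelian_rep rho -> Phi cls rho = trivial_rep (pi1_branched mu2).
Proof.
move=> ab; apply/funext => b; rewrite /Phi.
have [g cg ->] := Phi_cover_in_commutator (repr b).
apply: (cg _ (conj (rep_kernel_normal hrho).1 _)) => _ [x _ [y _ <-]] /=.
have -> : [~ x, y]%g = ((y * x)^-1 * (x * y))%g.
  by rewrite /commg /conjg invgM !mulgA.
rewrite (rep_mul hrho) (rep_inv hrho) !(rep_mul hrho) ab mulVmx // -(rep_mul hrho).
exact: det1_unit (rep_det hrho _).
Qed.

Lemma meridian_and_commutators (H : set (pi1 R (p c0))) : is_subgroup H ->
  H mu -> (forall g, commutator_subgroup g -> H g) -> forall g, H g.
Proof.
move=> sH Hmu Hc g; have [c [n [[/Hc cg _ ->]|[/Hc cg _ ->]]]] := homology_decomposition hcls g.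
  by apply: subgroupM => //; exact: subgroupX.
by apply: subgroupM => //; apply: subgroupV => //; exact: subgroupX.
Qed.

(** Such a representation factors through the cyclic group generated by the image of
[mu], and [rho mu], having square [-1], has an eigenvector for [i] or is scalar. *)
Lemma trivial_on_commutators_reducible :
  (forall g, commutator_subgroup g -> rho g = 1%:M) -> reducible_rep rho.
Proof.
move=> triv.
have [v v0 [c ev]] : exists2 v : 'cV[C]_2, v != 0 & exists c, rho mu *m v = c *: v.
  (* As [(rho mu - i) (rho mu + i) = 0], every nonzero column of [N] is an eigenvector. *)
  pose N := rho mu + ('i : C) *: 1%:M.
  have NN : (rho mu - ('i : C) *: 1%:M) *m N = 0.
    rewrite /N mulmxDr !mulmxBl rho_mu -!scalemxAl -!scalemxAr !mul1mx mulmx1.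
    by rewrite scalerA -expr2 sqrCi scaleN1r opprK addrA subrK addNr.
  have [N0|N0] := eqVneq N 0.
    exists (const_mx 1).
      apply/eqP => /matrixP /(_ ord0 ord0); rewrite !mxE => /eqP.
      by rewrite oner_eq0.
    exists (- 'i); have -> : rho mu = - ('i : C) *: 1%:M.
      by rewrite scaleNr; apply/eqP; rewrite -addr_eq0; exact/eqP.
    by rewrite -scalemxAl mul1mx.
  have [j hj] : exists j, col j N != 0.
    apply: contrapT => h; case/eqP: N0; apply/matrixP => i j.
    have e : col j N = 0 by apply/eqP/negPn/negP => hj; apply: h; exists j.
    by have := congr1 (fun M : 'cV[C]_2 => M i ord0) e; rewrite !mxE.
  exists (col j N) => //; exists 'i.
  have := congr1 (col j) NN; rewrite colE -mulmxA -colE mulmxBl -scalemxAl mul1mx col0.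
  by move/eqP; rewrite subr_eq0 => /eqP.
exists v => //; apply: (meridian_and_commutators (rep_eigen_subgroup hrho v0)).
  by exists c.
by move=> g /triv e; exists 1; rewrite e mul1mx scale1r.
Qed.

Lemma Phi_metabelian : irreducible_rep rho -> metabelian_rep rho ->
  Phi cls rho <> trivial_rep (pi1_branched mu2) /\
  abelian_rep (Phi cls (mu2 := mu2) rho).
Proof.
move=> irr mab; split=> [e|b b']; last first.
  rewrite /Phi; have [g cg ->] := Phi_cover_in_commutator (repr b).
  by have [h ch ->] := Phi_cover_in_commutator (repr b'); exact: mab.
apply: irr; apply: trivial_on_commutators_reducible => g cg.
have [a ga] := commutator_image cg; rewrite ga in cg *.
by rewrite -Phi_cover_commutator // -Phi_to_branched e.
Qed.

(** If [v] spans a line preserved by [Phi rho], it is an eigenvector of [rho] on the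
commutator subgroup, and so is [u], since that subgroup is normal.  Either the two
lines coincide and are preserved by all of [rho], or they diagonalise [rho] on
the commutator subgroup. *)
Lemma Phi_nonmetabelian : ~ metabelian_rep rho ->
  irreducible_rep rho /\ irreducible_rep (Phi cls (mu2 := mu2) rho).
Proof.
move=> nmab; split; first by move=> /(reducible_metabelian hrho).
move=> [v v0 ev]; apply: nmab.
have evc g : commutator_subgroup g -> exists c, rho g *m v = c *: v.
  move=> cg; have [a ga] := commutator_image cg; rewrite ga in cg *.
  by rewrite -Phi_cover_commutator // -Phi_to_branched.
pose u := rho mu *m v.
have euc g : commutator_subgroup g -> exists c, rho g *m u = c *: u.
  move=> cg; have [c ec] := evc _ (commutator_conj mu cg); exists c.
  have -> : rho g *m u = rho mu *m (rho (g ^ mu)%g *m v).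
    by rewrite /u !mulmxA -!(rep_mul hrho) /conjg mulVKg.
  by rewrite ec -scalemxAr.
have [[c uc]|indep] := eigen_dependent u v0.
  apply: (reducible_metabelian hrho); exists v => //.
  by apply: (meridian_and_commutators (rep_eigen_subgroup hrho v0)) => //; exists c.
move=> g h /[dup] /evc [a ea] /euc [a' ea'] /[dup] /evc [b eb] /euc [b' eb'].
by apply: indep; [exact: eigen_commute ea eb|exact: eigen_commute ea' eb'].
Qed.

End Forward.

Hypothesis hgen : forall g, normal_closure [set mu] g.

Section Backward.
Variable r : pi1_branched mu2 -> 'M[C]_2.
Hypothesis hr : reps r.

Let rt a := r (to_branched mu2 a).

Lemma to_branchedM a b : to_branched mu2 (a * b)%g = (to_branched mu2 a * to_branched mu2 b)%g.
Proof. exact: gprojM. Qed.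

Lemma lift_rep : reps rt.
Proof.
split=> [a|a b]; first exact: (rep_det hr).
by rewrite /rt to_branchedM (rep_mul hr).
Qed.

Lemma lift_rep_mu2 : rt mu2 = 1%:M.
Proof.
rewrite /rt -(rep_one hr); congr r; apply/gprojP; rewrite invg1 mulg1.
by move=> N [_ sub]; exact: sub.
Qed.

Lemma branched_tau_to_branched a :
  branched_tau mt (to_branched mu2 a) = to_branched mu2 (tau a).
Proof.
rewrite /branched_tau; set b := repr _.
have hb : normal_closure [set mu2] (b / a)%g by apply/gprojP; rewrite gprojK.
have := tau_normal_closure pM pI ptau hmu2 hb.
by rewrite (tauM pM pI ptau) (tauV pM pI ptau) => h; exact/gprojP.
Qed.

(** [B *m B = -1] is the value which the untwisted representation [s] takes at [mu2],
so that [s] extends by [mu |-> B]. *)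
Lemma Phi_lift (B : 'M[C]_2) : \det B = 1 -> B *m B = - 1%:M ->
  (forall b, r (branched_tau mt b) = B *m r b *m invmx B) ->
  exists2 rho, tracefree_reps mu rho & Phi cls rho = r.
Proof.
move=> dB BB rB.
pose s a := 'i ^ (- cls (P a)) *: rt a.
have hrt := lift_rep.
have sM a b : s (a * b)%g = s a *m s b.
  rewrite /s pM clsM opprD iexpD (rep_mul hrt).
  by rewrite -scalemxAl -scalemxAr scalerA.
have cls1 : cls 1%g = 0 by apply/clsC; case: (@commutator_subgroupP (pi1 R (p c0))).
have s1 : s 1%g = 1%:M by rewrite /s pi1_map1 cls1 oppr0 expr0z scale1r (rep_one hrt).
have s_mu2 : s mu2 = B *m B.
  rewrite /s lift_rep_mu2 BB hmu2 expgS expg1 clsM cls_mu.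
  have -> : 'i ^ (- (1 + 1)) = -1 :> C.
    by rewrite -[- _]/(- (2%:Z)) -exprnN sqrCi invrN1.
  by rewrite scaleN1r.
have s_tau a : s (tau a) = B *m s a *m invmx B.
  rewrite /s cls_tau /rt -branched_tau_to_branched rB.
  by rewrite -scalemxAr -scalemxAl.
pose rho := index2_ext pcover s B.
have rhoM g h : rho (g * h)%g = rho g *m rho h.
  exact: (index2_extM pM pI ptau hmu2 pcover pmu sM s1 (det1_unit dB) s_mu2 s_tau).
have rhoP a : rho (P a) = s a by exact: (index2_ext_p pM pI pcover pmu).
have rho_mu : rho mu = B by exact: (index2_ext_mu pM pI pcover pmu B s1).
have s_det a : \det (s a) = 1.
  rewrite /s detZ (rep_det hrt) mulr1; have [k ->] := cls_even a.
  by rewrite opprD; exact: iexp_even.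
exists rho; first split; first split.
- move=> g; have [a [->|->]] := pcover g; first by rewrite rhoP.
  by rewrite rhoM rhoP rho_mu det_mulmx s_det dB mulr1.
- exact: rhoM.
- by rewrite rho_mu; exact: sq_tracefree.
apply/funext => b; rewrite /Phi /Phi_cover rhoP /s scalerA -iexpD addrN.
by rewrite expr0z scale1r /rt /to_branched gprojK.
Qed.

(** The extension by [mu |-> 1] kills the meridian and all its conjugates, that is, the
whole knot group. *)
Lemma tau_invariant_trivial : (forall b, r (branched_tau mt b) = r b) ->
  forall b, r b = 1%:M.
Proof.
move=> inv b; have hrt := lift_rep.
pose rho := index2_ext pcover rt 1%:M.
have u1 : (1%:M : 'M[C]_2) \in unitmx by exact: unitmx1.
have rt_mu2 : rt mu2 = 1%:M *m 1%:M by rewrite mulmx1; exact: lift_rep_mu2.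
have rt_tau a : rt (tau a) = 1%:M *m rt a *m invmx 1%:M.
  by rewrite mul1mx invmx1 mulmx1 /rt -branched_tau_to_branched inv.
have rhoM g h : rho (g * h)%g = rho g *m rho h.
  exact: (index2_extM pM pI ptau hmu2 pcover pmu (rep_mul hrt) (rep_one hrt) u1 rt_mu2 rt_tau).
have rhoP a : rho (P a) = rt a by exact: (index2_ext_p pM pI pcover pmu).
have rho_mu : rho mu = 1%:M by exact: (index2_ext_mu pM pI pcover pmu 1%:M (rep_one hrt)).
have hrho : reps rho.
  split=> // g; have [a [->|->]] := pcover g; first by rewrite rhoP (rep_det hrt).
  by rewrite rhoM rhoP rho_mu mulmx1 (rep_det hrt).
have : rho (P (repr b)) = 1%:M.
  by apply: (hgen _ (conj (rep_kernel_normal hrho) _)) => _ ->.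
by rewrite rhoP /rt /to_branched gprojK.
Qed.

(** [B *m B] commutes with the representation, as [tau] squared is inner by [mu2],
which dies in the branched cover; by Cayley-Hamilton, [B] commutes with it as
well unless its trace vanishes. *)
Lemma Phi_surjective : equivariant_reps (branched_tau mt (mu2 := mu2)) r ->
  exists2 rho, tracefree_reps mu rho & Phi cls rho = r.
Proof.
move=> [_ [B dB rB]].
have hrt := lift_rep; have uB := det1_unit dB.
have BBc a : B *m B *m rt a = rt a *m (B *m B).
  have := congr1 rt (tau_tau pM pI ptau hmu2 a).
  rewrite /rt -!branched_tau_to_branched !rB -!/(rt _) !(rep_mul hrt) (rep_inv hrt).
  rewrite lift_rep_mu2 invmx1 mul1mx mulmx1 => h.
  by rewrite -[in RHS]h !mulmxA !mulmxKV.
have [t0|t0] := eqVneq (\tr B) 0.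
  by apply: (Phi_lift dB _ rB); exact: tracefree_sq.
have Bc a : B *m rt a = rt a *m B.
  have := BBc a; rewrite cayley_hamilton2 dB scale1r mulmxBl mulmxBr mul1mx mulmx1.
  by move=> /addIr; rewrite -scalemxAl -scalemxAr => /(scalerI t0).
have triv : forall b, r b = 1%:M.
  apply: tau_invariant_trivial => b; rewrite rB.
  by rewrite -[b]gprojK -/(to_branched mu2 _) -/(rt _) Bc mulmxK.
(* a trace-free matrix of determinant one, to replace [B] *)
pose D : 'M[C]_2 := \matrix_(i, j) (if i == j then (if i == ord0 then 'i else - 'i) else 0).
have D2 : D *m D = - 1%:M.
  apply: mx2P => j; rewrite !mxE sum2 !mxE;
  (have [->|j0] := eqVneq j ord0; last
    have -> : j = ord_max by apply: val_inj; case: j j0 => -[|[]]);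
  rewrite /= ?mulrNN ?mulr0 ?mul0r ?addr0 ?add0r -?expr2 ?sqrCi //= ?oppr0 //.
have dD : \det D = 1.
  by rewrite det2 !mxE /= mul0r subr0 mulrN -expr2 sqrCi opprK.
by apply: (Phi_lift dD D2) => b; rewrite !triv mulmx1 mulmxV // det1_unit.
Qed.

End Backward.

End BranchedCover.

Theorem proposition6p2 (R : realType)
    (* the knot K, and its exterior E_K = knot_exterior nu *)
    (K : set (sphere R 3))
    (nu : (sphere R 1 * 'rV[R]_2)%type -> sphere R 3)
    (hK : tubular_parametrization K nu)
    (* the 2-fold cyclic cover p : C_2 -> E_K and its deck transformation *)
    (C2 : topologicalType) (p : continuousType C2 (knot_exterior nu))
    (hp : covering_map bool p) (hC2 : path_connected R C2)
    (sigma : continuousType C2 C2) (hsigma : covering_transformation p sigma)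
    (sigma_neq : (sigma : C2 -> C2) <> id)
    (* the meridian mu and its lift *)
    (c0 : C2) (m : {path (uI R) from (p c0) to (p c0)})
    (hm : meridian_loop m)
    (mt : {path (uI R) from c0 to (sigma c0)})
    (hmt : forall t, p (mt t) = m t)
    (* the isomorphism from H_1(E_K) to Z *)
    (cls : pi1 R (p c0) -> int) (hcls : homology_class (pi1_class m) cls)
    (* mu_2, hence pi_1(B_2) = pi1_branched mu2 *)
    (mu2 : pi1 R c0) (hmu2 : pi1_map p mu2 = (pi1_class m ^+ 2)%g) :
  let R0 := tracefree_reps (pi1_class m) in
  let Rtau := equivariant_reps (branched_tau mt (mu2 := mu2)) in
  let Ph := Phi cls (mu2 := mu2) in
  [/\ forall rho, R0 rho ->
        forall a, Ph rho (to_branched mu2 a) = Phi_cover cls rho a,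
      set_fun R0 Rtau Ph,
      set_surj R0 Rtau Ph &
      forall rho, R0 rho ->
        [/\ abelian_rep rho -> Ph rho = trivial_rep (pi1_branched mu2),
            irreducible_rep rho -> metabelian_rep rho ->
              [/\ Ph rho <> trivial_rep (pi1_branched mu2),
                  abelian_rep (Ph rho) & Rtau (Ph rho)] &
            ~ metabelian_rep rho ->
              [/\ irreducible_rep rho, irreducible_rep (Ph rho) &
                  Rtau (Ph rho)]]].
Proof.
move=> R0 Rtau Ph.
have hgen : forall g, normal_closure [set pi1_class m] g.
  apply: (meridian_normally_generates hK _ hm).
  exact: base_path_connected hp hC2.
have even := Phi_equivariant hp hC2 hsigma sigma_neq hmt hcls hmu2.
split.
- by move=> rho hrho a; exact: (Phi_to_branched hp hC2 hsigma sigma_neq hmt hcls hmu2 hrho).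
- exact: even.
- move=> r hr; have [rho hrho e] : exists2 rho, R0 rho & Ph rho = r.
    by apply: (Phi_surjective hp hC2 hsigma sigma_neq hmt hcls hmu2 hgen) => //; case: hr.
  by exists rho.
move=> rho hrho; split.
- exact: (Phi_abelian hp hC2 hsigma sigma_neq hmt hcls hmu2 hrho).
- move=> irr mab.
  have [nt ab] := Phi_metabelian hp hC2 hsigma sigma_neq hmt hcls hmu2 hrho irr mab.
  by split; [exact: nt|exact: ab|exact: even].
- move=> nmab.
  have [i1 i2] := Phi_nonmetabelian hp hC2 hsigma sigma_neq hmt hcls hmu2 hrho nmab.
  by split; [exact: i1|exact: i2|exact: even].
Qed.
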